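(* Let $(E,C)$ be a finite bipartite separated graph with $|C_v|\ge2$ for all $v\in E^{0,0}$ and $s(E^1)=E^{0,1}$. Let $\Omega(E,C)$ be the universal space associated to $(E,C)$, and let $w\in E^{0,1}$. Then the points of $\Omega(E,C)_w$ are in one-to-one correspondence (via $\xi\mapsto\mathfrak f_\xi$) with the $E$-functions $(\Omega_1,f_1),(\Omega_2,f_2),\dots$ such that $\Omega_1=s^{-1}(w)$. Moreover, given a point $\xi\in\Omega(E,C)_w$ represented by the $E$-function $(\Omega_1,f_1),(\Omega_2,f_2),\dots$, the partial $E$-functions $(\Omega_1,f_1),\dots,(\Omega_r,f_r)$, $r\ge1$, represent a fundamental system of clopen neighbourhoods of $\xi$ in $\Omega(E,C)$. The clopen set represented by the partial $E$-function $(\Omega_1,f_1),\dots,(\Omega_r,f_r)$ corresponds to a vertex in $F_\infty$ lying in the level $D_{2r+1}$ of $F_\infty^0=\bigsqcup_{i=0}^\infty D_i$ (i.e. it equals $A_v$ for some $v\in D_{2r+1}$).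
   Context: A separated graph is a pair $(E,C)$, where $E=(E^0,E^1,r,s)$ is a directed graph and $C=\bigsqcup_{v\in E^0}C_v$ with $C_v$ a partition of $r^{-1}(v)$ into nonempty subsets ($C_v=\emptyset$ if $r^{-1}(v)=\emptyset$). It is finite if $E^0,E^1$ are finite, and bipartite if $E^0=E^{0,0}\sqcup E^{0,1}$ with all arrows going from $E^{0,1}$ to $E^{0,0}$ (with $r(E^1)=E^{0,0}$, $s(E^1)=E^{0,1}$). $C^*(E,C)$ is the universal C*-algebra with generators $v\in E^0$, $e\in E^1$ and relations: $vv'=\delta_{v,v'}v$, $v=v^*$; $r(e)e=e=es(e)$; $e^*e'=\delta_{e,e'}s(e)$ for $e,e'\in X$, $X\in C$; $v=\sum_{e\in X}ee^*$ for $X\in C_v$, $v\in E^0$. Canonical sequence: $(E_0,C^0)=(E,C)$; given $(E_n,C^n)$ with $C^n_u=\{X_1^u,\dots,X_{k_u}^u\}$ for $u\in E_n^{0,0}$, set $E_{n+1}^{0,0}=E_n^{0,1}$; $E_{n+1}^{0,1}=\{v(x_1,\dots,x_{k_u}):u\in E_n^{0,0},x_i\in X_i^u\}$ (distinct new vertices); $E_{n+1}^1$ consists of arrows $\alpha^{x_i}(x_1,\dots,\widehat{x_i},\dots,x_{k_u})$, for $u\in E_n^{0,0}$, $1\le i\le k_u$, $(x_1,\dots,x_{k_u})\in\prod_jX_j^u$, with range $s(x_i)$ and source $v(x_1,\dots,x_{k_u})$; and for $v\in E_{n+1}^{0,0}$, $C^{n+1}_v=\{X(x): x\in E_n^1,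 s(x)=v\}$ where for $x=x_i\in X_i^u$, $X(x_i)=\{\alpha^{x_i}(x_1,\dots,\widehat{x_i},\dots,x_{k_u}):x_j\in X_j^u,\ j\neq i\}$. Put $D_n=E_n^{0,0}$ (so $E_n^{0,1}=D_{n+1}$); $F_\infty$ is the union of the graphs $E_n$, with $F_\infty^0=\bigsqcup_{n\ge0}D_n$, $F_\infty^1=\bigsqcup_nE_n^1$. There are surjective $*$-homomorphisms $\phi_n\colon C^*(E_n,C^n)\to C^*(E_{n+1},C^{n+1})$ with $\phi_n(w)=w$ ($w\in E_n^{0,1}$), $\phi_n(u)=\sum v(x_1,\dots,x_{k_u})$ (sum over $\prod_iX_i^u$, $u\in E_n^{0,0}$), $\phi_n(x_i)=\sum_{x_j\in X_j^u,\,j\ne i}(\alpha^{x_i}(x_1,\dots,\widehat{x_i},\dots,x_{k_u}))^*$. Put $\mathcal O(E,C)=\varinjlim(C^*(E_n,C^n),\phi_n)$, let $\underline x$ be the image of $x\in E^1$, and let $\mathcal B_0$ be the commutative C*-subalgebra generated by the images of all vertices in $\bigcup_nE_n^0=F_\infty^0$. $\Omega(E,C)$ is the spectrum (character space) of $\mathcal B_0$. For $v\in F_\infty^0$ let $A_v=\{\xi:\xi(v)=1\}$, the clopen set corresponding to $v$; for $v\in E^0$, $\Omega(E,C)_v=A_v$. For $x\in E^1$, $\underline x\,\underline x^*\in\mathcal B_0$, $H_x=\{\xi:\xi(\underline x\,\underline x^* )=1\}$, and $\theta_x\colon\Omega(E,C)_{s(x)}\to H_x$ is the homeomorphism $\theta_x(\xi)(b)=\xi(\underline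 x^*b\underline x)$. Then $\Omega(E,C)=\bigsqcup_{v\in E^0}\Omega(E,C)_v$ and $\Omega(E,C)_v=\bigsqcup_{x\in X}H_x$ for $X\in C_v$, $v\in E^{0,0}$. $E$-functions. Let $\mathbb F$ be the free group on $E^1$. For $e\in E^1$, $X_e$ is the unique element of $C$ containing $e$. For $v\in E^{0,0}$, $X\in C_v$, put $Z_X=\prod_{Y\in C_v,\,Y\ne X}Y$, with projections $\pi_Y\colon Z_X\to Y$. A partial $E$-function is a finite sequence $(\Omega_1,f_1),\dots,(\Omega_r,f_r)$, with $\Omega_i\subseteq\mathbb F$ finite and $f_i\colon\Omega_i\to\bigsqcup_{X\in C}Z_X$, such that: (1) $\Omega_1=s^{-1}(w)$ for some $w\in E^{0,1}$ and $f_1(e)\in Z_{X_e}$ for $e\in s^{-1}(w)$; (2) for $2\le j\le r$, $\Omega_j$ is the set of all elements $e_{2j-1}e_{2j-2}^{-1}e_{2j-3}\cdots e_3e_2^{-1}e_1$ where $e_{2j-3}\cdots e_2^{-1}e_1\in\Omega_{j-1}$, $e_{2j-2}=\pi_Y(f_{j-1}(e_{2j-3}\cdots e_2^{-1}e_1))$ for some $Y\in C$ which is a factor of $Z_X$, where $f_{j-1}(e_{2j-3}\cdots e_2^{-1}e_1)\in Z_X$, and $e_{2j-1}\in E^1$ satisfies $s(e_{2j-1})=s(e_{2j-2})$, $e_{2j-1}\ne e_{2j-2}$; (3) $f_j(e_{2j-1}e_{2j-2}^{-1}\cdots e_2^{-1}e_1)\in Z_{X_{e_{2j-1}}}$ for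 all elements of $\Omega_j$. An $E$-function is an infinite sequence $(\Omega_1,f_1),(\Omega_2,f_2),\dots$ satisfying these conditions for all $j$ (possibly $\Omega_j=\emptyset$ for large $j$). Correspondence: for $\xi\in\Omega(E,C)_w$, the $E$-function $\mathfrak f_\xi$ representing $\xi$ has $\Omega_1=s^{-1}(w)$ and, for $g=e_{2j-1}e_{2j-2}^{-1}\cdots e_2^{-1}e_1\in\Omega_j$ and $Y\in C_{r(e_{2j-1})}$ with $Y\neq X_{e_{2j-1}}$, $\pi_Y(f_j(g))$ is the unique $y\in Y$ with $\theta_{e_{2j-1}}\theta_{e_{2j-2}}^{-1}\cdots\theta_{e_2}^{-1}\theta_{e_1}(\xi)\in H_y$. The set represented by a partial $E$-function $(\Omega_1,f_1),\dots,(\Omega_r,f_r)$ with $\Omega_1=s^{-1}(w)$ is the set of $\eta\in\Omega(E,C)_w$ whose $E$-function starts with it. *)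

(* Defs.v *)
From HB Require Import structures.
From mathcomp Require Import all_boot all_order all_algebra.
From mathcomp Require Import finmap.
From mathcomp Require Import all_classical all_reals all_analysis.
From mathcomp Require Import complex.
Import Order.TTheory GRing.Theory Num.Theory.
Import numFieldNormedType.Exports.

Set Implicit Arguments.
Unset Strict Implicit.
Unset Printing Implicit Defensive.

Local Open Scope ring_scope.
Local Open Scope classical_set_scope.

(* A letter (x, false) stands for x and (x, true) for its inverse; elements of
   the free group are reduced words, read from left to right.                *)

Section FreeGroup.
Context {T : choiceType}.
Implicit Types (a b : T * bool) (u v w : seq (T * bool)).

Definition linv a : T * bool := (a.1, ~~ a.2).

Definition reduced w : bool := sorted (fun a b => b != linv a) w.

Definition rcancel a w : seq (T * bool) :=
  if w is b :: w' then if b == linv a then w' else a :: w else [:: a].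

Definition wmul u v : seq (T * bool) := foldr rcancel v u.

Definition winv w : seq (T * bool) := rev (map linv w).

Lemma linvK : involutive linv.
Proof. by case=> x b; rewrite /linv /= negbK. Qed.

Lemma rcancel_reduced a w : reduced w -> reduced (rcancel a w).
Proof.
case: w => [|b w] //=; case: ifPn => [_|ab] rw; first exact: path_sorted rw.
by rewrite /reduced /= ab.
Qed.

Lemma wmul_reduced u v : reduced v -> reduced (wmul u v).
Proof. by move=> rv; elim: u => //= a u IH; apply: rcancel_reduced. Qed.

Lemma rcancelK a w : reduced w -> rcancel a (rcancel (linv a) w) = w.
Proof.
case: w => [|b w] /=; first by rewrite eqxx.
rewrite linvK; case: eqVneq => [-> | ba _] /=; last by rewrite eqxx.
by case: w => [|c w] //= /andP[/negPf ->].
Qed.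

Lemma wmul_rcancel a u w :
  reduced w -> wmul (rcancel a u) w = rcancel a (wmul u w).
Proof.
move=> rw; case: u => [|b u] //=; case: eqVneq => [-> | //].
by rewrite rcancelK // wmul_reduced.
Qed.

Lemma wmulA u v w : reduced w -> wmul u (wmul v w) = wmul (wmul u v) w.
Proof. by move=> rw; elim: u => //= a u ->; rewrite wmul_rcancel. Qed.

Lemma wmulw1 w : reduced w -> wmul w [::] = w.
Proof.
elim: w => //= a w IH rw; rewrite IH; last exact: path_sorted rw.
by case: w rw {IH} => [|b w] //= /andP[/negPf ->].
Qed.

Lemma wmulVw w : wmul (winv w) w = [::].
Proof.
elim: w => // a w IH; rewrite /winv /= rev_cons /wmul -cats1 foldr_cat /=.
by rewrite linvK eqxx.
Qed.

Lemma winv_reduced w : reduced w -> reduced (winv w).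
Proof.
rewrite /reduced /winv rev_sorted sorted_map.
by apply: sub_sorted => a b /=; apply: contraNneq => ->; rewrite linvK.
Qed.

Lemma winvK : involutive winv.
Proof. by move=> w; rewrite /winv map_rev revK -map_comp map_id_in // => a _; apply: linvK. Qed.

End FreeGroup.

Record freeGroup (T : choiceType) := FreeGroup {
  word : seq (T * bool);
  word_reduced : reduced word
}.

HB.instance Definition _ (T : choiceType) := [isSub for @word T].
HB.instance Definition _ (T : choiceType) := [Choice of freeGroup T by <:].

Section FreeGroupOps.
Context (T : choiceType).
Implicit Types g h k : freeGroup T.

Definition fg_one : freeGroup T := @FreeGroup T [::] isT.
Definition fg_mul g h : freeGroup T :=
  FreeGroup (wmul_reduced (word g) (word_reduced h)).
Definition fg_inv g : freeGroup T := FreeGroup (winv_reduced (word_reduced g)).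
Definition fg_gen (x : T) : freeGroup T := @FreeGroup T [:: (x, false)] isT.

Lemma fg_mulA : associative fg_mul.
Proof. by move=> g h k; apply/val_inj/wmulA/word_reduced. Qed.
Lemma fg_mul1g : left_id fg_one fg_mul.
Proof. by move=> g; apply: val_inj. Qed.
Lemma fg_mulg1 : right_id fg_one fg_mul.
Proof. by move=> g; apply/val_inj/wmulw1/word_reduced. Qed.
Lemma fg_mulVg : left_inverse fg_one fg_inv fg_mul.
Proof. by move=> g; apply/val_inj/wmulVw. Qed.
Lemma fg_mulgV : right_inverse fg_one fg_inv fg_mul.
Proof. by move=> g; apply: val_inj => /=; rewrite -{1}[word g]winvK wmulVw. Qed.

End FreeGroupOps.

HB.instance Definition _ (T : choiceType) :=
  isGroup.Build (freeGroup T) (@fg_mulA T) (@fg_mul1g T) (@fg_mulg1 T)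
    (@fg_mulVg T) (@fg_mulgV T).

Record sepGraph := SepGraph {
  vertex : finType;
  arrow : finType;
  rng : arrow -> vertex;
  src : arrow -> vertex;
  colours : vertex -> {set {set arrow}};
  coloursP : forall v, finset.partition (colours v) [set e | rng e == v]%SET
}.

(* Bipartite separated graphs: every arrow goes from E^{0,1} = bV1 to
   E^{0,0} = bV0. As no arrow ends in bV1, only the vertices of bV0 carry a
   nonempty C_v.                                                             *)
Record bipGraph := BipGraph {
  bV0 : finType;
  bV1 : finType;
  bE : finType;
  br : bE -> bV0;
  bs : bE -> bV1;
  bC : bV0 -> {set {set bE}};
  bCP : forall v, finset.partition (bC v) [set e | br e == v]%SET
}.

Section BipToSep.
Context (G : bipGraph).

Definition bip_colours (v : bV0 G + bV1 G) : {set {set bE G}} :=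
  if v is inl u then bC u else finset.set0.

Lemma bip_coloursP (v : bV0 G + bV1 G) :
  finset.partition (bip_colours v) [set e | inl (br e) == v]%SET.
Proof.
case: v => [u | w] /=; first exact: bCP.
suff -> : [set e : bE G | inl (br e) == inr w :> bV0 G + bV1 G]%SET = finset.set0.
  by rewrite finset.partition_set0.
by apply/finset.setP => e; rewrite !inE.
Qed.

End BipToSep.

Coercion sep_of_bip (G : bipGraph) : sepGraph :=
  @SepGraph (bV0 G + bV1 G)%type (bE G) (fun e => inl (br e))
    (fun e => inr (bs e)) (@bip_colours G) (@bip_coloursP G).

(* The product of the sets Y in P: a tuple z has z Y = Some y with y in Y when
   Y is in P, and z Y = None otherwise; so z Y is the projection pi_Y z.     *)
Definition prodset (T : finType) (P : {set {set T}}) :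
    {set {ffun {set T} -> option T}} :=
  [set z in pfamily None P (fun Y : {set T} => [pred o | oapp (mem Y) false o])]%SET.

Section NextGraph.
Context (G : bipGraph).

Definition part (e : bE G) : {set bE G} := finset.pblock (bC (br e)) e.

(* v(x_1, ..., x_k), as the pair of u and (x_1, ..., x_k) *)
Definition nextV1 : finType :=
  {p : bV0 G * {ffun {set bE G} -> option (bE G)} | p.2 \in prodset (bC p.1)}.

(* alpha^{x_i}(x_1, .., x_{i-1}, x_{i+1}, .., x_k) is encoded as the pair of
   v(x_1, ..., x_k) and the entry x_i of that tuple.                         *)
Definition nextE : finType :=
  {p : nextV1 * bE G | (val p.1).2 (part p.2) == Some p.2}.

Definition nextX (x : bE G) : {set nextE} :=
  [set a : nextE | (val a).2 == x]%SET.

Definition nextC (w : bV1 G) : {set {set nextE}} :=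
  [set nextX x | x in [pred x | bs x == w]]%SET.

Lemma part_in (x : bE G) : part x \in bC (br x).
Proof.
have /and3P[/eqP cov _ _] := bCP (br x).
by apply: finset.pblock_mem; rewrite cov !inE.
Qed.

Lemma nextX_neq0 (x : bE G) : nextX x != finset.set0.
Proof.
have /and3P[/eqP cov _ n0] := bCP (br x).
have xp : x \in part x by rewrite finset.mem_pblock cov !inE.
pose z := [ffun Y : {set bE G} => if Y \in bC (br x) then
  (if Y == part x then Some x else [pick y in Y]) else None].
have zP : (br x, z).2 \in prodset (bC (br x, z).1).
  rewrite inE; apply/pfamilyP; split=> [|Y YC].
    by apply/fintype.subsetP => Y; rewrite !inE ffunE; case: ifP; rewrite ?eqxx.
  rewrite !inE ffunE YC; case: eqVneq => [-> // | _].
  case: pickP => [y //|Y0]; have /finset.set0Pn[y] : Y != finset.set0.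
    by apply: contraNneq n0 => <-.
  by rewrite Y0.
have aP : (val (exist _ (br x, z) zP : nextV1, x).1).2 (part x) == Some x.
  by rewrite /= ffunE part_in eqxx.
apply/finset.set0Pn; exists (exist _ (exist _ (br x, z) zP : nextV1, x) aP : nextE).
by rewrite inE.
Qed.

Lemma nextCP (w : bV1 G) :
  finset.partition (nextC w) [set a : nextE | bs (val a).2 == w]%SET.
Proof.
apply/and3P; split.
- apply/eqP/finset.setP => a; rewrite inE; apply/finset.bigcupP/idP => [[X] | aw].
    by case/imsetP => x; rewrite !inE => /eqP <- ->; rewrite inE => /eqP ->.
  by exists (nextX (val a).2); rewrite ?inE //; apply/imsetP; exists (val a).2.
- apply/finset.trivIsetP => _ _ /imsetP[x _ ->] /imsetP[y _ ->] xy.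
  rewrite -finset.setI_eq0; apply/eqP/finset.setP => a; rewrite !inE.
  by apply/negP => /andP[/eqP -> /eqP yx]; rewrite yx eqxx in xy.
- by apply/imsetP => -[x _ /esym/eqP]; rewrite (negPf (nextX_neq0 x)).
Qed.

Definition nextG : bipGraph :=
  @BipGraph (bV1 G) nextV1 nextE (fun a => bs (val a).2) (fun a => (val a).1)
    nextC nextCP.

End NextGraph.

Fixpoint canon (G : bipGraph) (n : nat) : bipGraph :=
  if n is n'.+1 then nextG (canon G n') else G.

(* The n-th level D_n of the vertices of F_oo. *)
Definition level (G : bipGraph) (n : nat) : finType := bV0 (canon G n).

(* The complex numbers, as a field with the topology of its norm. *)
Definition cplx (R : realType) : numFieldType := R[i].

(* Not necessarily unital C*-algebras. *)
Record cstarAlg (R : realType) := CstarAlg {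
  cstar_sort :> completeNormedModType (cplx R);
  smul : cstar_sort -> cstar_sort -> cstar_sort;
  star : cstar_sort -> cstar_sort;
  smulA : associative smul;
  smulDl : left_distributive smul +%R;
  smulDr : right_distributive smul +%R;
  smulZl : forall (k : cplx R) a b, smul (k *: a) b = k *: smul a b;
  smulZr : forall (k : cplx R) a b, smul a (k *: b) = k *: smul a b;
  starK : involutive star;
  starD : {morph star : a b / a + b};
  starZ : forall (k : cplx R) a, star (k *: a) = conjc k *: star a;
  starM : forall a b, star (smul a b) = smul (star b) (star a);
  normM_le : forall a b, `|smul a b| <= `|a| * `|b|;
  norm_starM : forall a, `|smul (star a) a| = `|a| ^+ 2
}.

Notation "a ** b" := (smul a b) (at level 40, left associativity) : ring_scope.

Section CstarTheory.
Context {R : realType}.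

Definition star_hom (A B : cstarAlg R) (f : A -> B) : Prop :=
  [/\ forall (k : cplx R) a b, f (k *: a + b) = k *: f a + f b,
      {morph f : a b / a ** b} & {morph f : a / star a}].

Definition cstar_subalg (A : cstarAlg R) (S : set A) : Prop :=
  [/\ S 0, forall (k : cplx R) a b, S a -> S b -> S (k *: a + b),
      forall a b, S a -> S b -> S (a ** b),
      forall a, S a -> S (star a) & closed S].

(* Characters of a C*-subalgebra B of A are encoded as functions on A that
   vanish outside B, so that two characters of B agree on B iff they are equal. *)
Definition is_character (A : cstarAlg R) (B : set A) (xi : A -> cplx R) : Prop :=
  [/\ forall (k : cplx R) a b, B a -> B b -> xi (k *: a + b) = k * xi a + xi b,
      forall a b, B a -> B b -> xi (a ** b) = xi a * xi b,
      exists2 a, B a & xi a != 0 & forall a, ~ B a -> xi a = 0].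

Definition graph_relations (G : sepGraph) (A : cstarAlg R)
    (p : vertex G -> A) (t : arrow G -> A) : Prop :=
  [/\ (forall v v', p v ** p v' = if v == v' then p v else 0) /\
        (forall v, star (p v) = p v),
      forall e, p (rng e) ** t e = t e /\ t e ** p (src e) = t e,
      forall v (X : {set arrow G}), X \in colours v -> forall e e',
        e \in X -> e' \in X ->
        star (t e) ** t e' = if e == e' then p (src e) else 0 &
      forall v (X : {set arrow G}), X \in colours v ->
        p v = \sum_(e in X) t e ** star (t e)].

(* (A, p, t) is the universal C*-algebra C*(E,C) with its generators. *)
Definition is_graph_algebra (G : sepGraph) (A : cstarAlg R)
    (p : vertex G -> A) (t : arrow G -> A) : Prop :=
  graph_relations p t /\
  forall (B : cstarAlg R) (q : vertex G -> B) (u : arrow G -> B),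
    graph_relations q u ->
    exists! f : A -> B,
      [/\ star_hom f, forall v, f (p v) = q v & forall e, f (t e) = u e].

Definition is_canonical_map (G : bipGraph)
    (A : cstarAlg R) (p : vertex G -> A) (t : arrow G -> A)
    (A' : cstarAlg R) (p' : vertex (nextG G) -> A') (t' : arrow (nextG G) -> A')
    (phi : A -> A') : Prop :=
  [/\ star_hom phi,
      forall w : bV1 G, phi (p (inr w)) = p' (inl w),
      forall u : bV0 G, phi (p (inl u)) =
        \sum_(v : bV1 (nextG G) | (val v).1 == u) p' (inr v) &
      forall x : bE G, phi (t x) = \sum_(a in nextX x) star (t' a)].

Definition is_inductive_limit (A : nat -> cstarAlg R)
    (phi : forall n, A n -> A n.+1) (L : cstarAlg R)
    (iota : forall n, A n -> L) : Prop :=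
  [/\ forall n, star_hom (@iota n),
      forall n a, iota n.+1 (phi n a) = iota n a &
      forall (B : cstarAlg R) (g : forall n, A n -> B),
        (forall n, star_hom (@g n)) ->
        (forall n a, g n.+1 (phi n a) = g n a) ->
        exists! h : L -> B,
          star_hom h /\ forall n a, h (iota n a) = g n a].

End CstarTheory.

(* The algebras C*(E_n, C^n), the maps phi_n and the limit O(E,C), which are
   determined up to isomorphism by their universal properties.               *)
Record graphSystem (R : realType) (G : bipGraph) := GraphSystem {
  gsA : nat -> cstarAlg R;
  gsp : forall n, vertex (canon G n) -> gsA n;
  gst : forall n, arrow (canon G n) -> gsA n;
  gsAP : forall n, is_graph_algebra (@gsp n) (@gst n);
  gsphi : forall n, gsA n -> gsA n.+1;
  gsphiP : forall n, @is_canonical_map R (canon G n) (gsA n) (@gsp n) (@gst n)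
    (gsA n.+1) (@gsp n.+1) (@gst n.+1) (@gsphi n);
  gsO : cstarAlg R;
  gsiota : forall n, gsA n -> gsO;
  gsOP : is_inductive_limit gsphi gsiota
}.

Section Omega.
Context {R : realType} {G : bipGraph} (M : graphSystem R G).

Definition imv (n : nat) (v : vertex (canon G n)) : gsO M :=
  gsiota (gsp M v).

Definition imx (x : bE G) : gsO M := gsiota (@gst R G M 0 x).

Definition B0 : set (gsO M) :=
  smallest (@cstar_subalg R (gsO M))
    [set b | exists n (v : vertex (canon G n)), b = imv v].

(* The weak-* topology is that of pointwise convergence; as a type, Omega
   carries the subspace topology.                                            *)
Definition Omega : set {ptws gsO M -> cplx R} :=
  [set xi | is_character B0 xi].

(* A_v, for v in E_n^0; for n = 0 this is also Omega(E,C)_v. *)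
Definition Aset (n : nat) (v : vertex (canon G n)) : set Omega :=
  [set xi | val xi (imv v) = 1].

Definition Omega_at (v : vertex G) : set Omega := @Aset 0 v.

Definition Hset (x : bE G) : set Omega :=
  [set xi | val xi (imx x ** star (imx x)) = 1].

(* The graph of theta_x; that of its inverse is the converse relation. *)
Definition theta (x : bE G) (xi eta : Omega) : Prop :=
  [/\ Omega_at (inr (bs x)) xi, Hset x eta &
      forall b, B0 b -> val eta b = val xi (star (imx x) ** b ** imx x)].

Fixpoint theta_word (w : seq (bE G * bool)) (xi eta : Omega) : Prop :=
  if w is (x, inv) :: w' then
    exists2 zeta, theta_word w' xi zeta &
      if inv then theta x eta zeta else theta x zeta eta
  else eta = xi.

End Omega.

Arguments B0 {R G} M _.
Arguments Omega {R G} M _.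
Arguments Aset {R G} M n v _.
Arguments Omega_at {R G} M v _.
Arguments Hset {R G} M x _.

Section EFunctions.
Context {G : bipGraph}.

Local Notation F := (freeGroup (bE G)).

(* (X, z) with z in Z_X; the tag X makes the union of the Z_X disjoint. *)
Definition zelt : finType :=
  ({set bE G} * {ffun {set bE G} -> option (bE G)})%type.

Definition Zset (e : bE G) : {set zelt} :=
  [set a : zelt | (a.1 == part e) && (a.2 \in prodset (bC (br e) :\ part e))]%SET.

(* (Omega_j, f_j) is a finite map f_j whose domain is Omega_j. *)
Definition emap := {fmap F -> zelt}.

Definition src_dom (w : bV1 G) : {fset F} :=
  [fset fg_gen e | e in [pred e : bE G | bs e == w]]%fset.

(* e is a coordinate pi_Y(m g), s(e') = s(e) and e' <> e *)
Definition estep (m : emap) (g : F) (e e' : bE G) : bool :=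
  [&& (if m.[? g]%fmap is Some a then [exists Y, a.2 Y == Some e] else false),
      bs e' == bs e & e' != e].

Definition eword (g : F) (e e' : bE G) : F :=
  (fg_gen e' * (fg_gen e)^-1 * g)%g.

Definition next_dom (m : emap) : {fset F} :=
  [fset eword g q.1 q.2 | g in domf m,
    q in [pred q : bE G * bE G | estep m g q.1 q.2]]%fset.

(* The conditions on the j-th term; indices start at 0, so f 0 stands for
   (Omega_1, f_1).                                                           *)
Definition efun_cond (f : nat -> emap) (j : nat) : Prop :=
  if j is i.+1 then
    domf (f j) = next_dom (f i) /\
    forall g e e', estep (f i) g e e' ->
      exists2 a, (f j).[? eword g e e']%fmap = Some a & a \in Zset e'
  else
    exists w : bV1 G, domf (f 0%N) = src_dom w /\
      forall e, bs e = w ->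
        exists2 a, (f 0%N).[? fg_gen e]%fmap = Some a & a \in Zset e.

Definition is_efun (f : nat -> emap) : Prop := forall j, efun_cond f j.

Definition is_partial_efun (s : seq emap) : Prop :=
  (0 < size s)%N /\ forall j, (j < size s)%N -> efun_cond (nth [fmap]%fmap s) j.

End EFunctions.

Section Correspondence.
Context {R : realType} {G : bipGraph} (M : graphSystem R G).

(* For g = e_{2j-1} ... e_1, the element of Z_X with X = X_{e_{2j-1}} whose
   coordinate at Y is the y in Y with theta_g(xi) in H_y; the other words do
   not occur in any Omega_j.                                                 *)
Definition efun_val (xi : Omega M) (g : freeGroup (bE G)) : @zelt G :=
  if word g is (e, false) :: _ then
    (part e, [ffun Y : {set bE G} => if Y \in bC (br e) :\ part e then
       [pick y in Y | `[< exists2 zeta, theta_word (word g) xi zeta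
                                      & Hset M y zeta >]]
     else None])
  else (finset.set0, [ffun=> None]).

Fixpoint efun_of (w : bV1 G) (xi : Omega M) (j : nat) : @emap G :=
  [fmap g : (if j is i.+1 then next_dom (efun_of w xi i) else src_dom w)
     => efun_val xi (fsval g)]%fmap.

Definition represented (w : bV1 G) (s : seq (@emap G)) : set (Omega M) :=
  [set eta | Omega_at M (inr w) eta /\ mkseq (efun_of w eta) (size s) = s].

End Correspondence.

Arguments efun_of {R G} M w xi j.
Arguments represented {R G} M w s _.

(* Main.v *)
Require Import Defs.
From HB Require Import structures.
From mathcomp Require Import all_boot all_order all_algebra.
From mathcomp Require Import finmap.
From mathcomp Require Import all_classical all_reals all_analysis.
From mathcomp Require Import complex.
From mathcomp Require Import ring lra.
Import Order.TTheory GRing.Theory Num.Theory.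
Import numFieldNormedType.Exports.

(** A point over [w] in [E^{0,1}] can be moved by the partial homeomorphisms [theta].  Its
    translates form a tree: at a vertex of [E^{0,1}] all arrows starting there apply, and at
    a vertex of [E^{0,0}] the translate lies in the range of exactly one arrow of each
    colour.  The [E]-function records these arrows.  It has to be shown that every
    assignment of arrows occurs, and that the first [r] layers of the tree amount to the
    vertex of [D_{2r+1}] under the point.

    Existence.  The nodes of the tree of any assignment of arrows carry partial injections
    satisfying the relations of [(E,C)] ([tree_set_rep]).  A set with such partial injections
    carries partial injections for every graph [(E_n,C^n)] as well ([next_set_rep]), and the
    operators that they induce on the square-summable families are compatible with the
    canonical maps, so [O(E,C)] acts on a Hilbert space ([model_hom]).  This uses that the
    bounded operators of a complex Hilbert space form a C*-algebra ([bop_cstar]).  The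
    subalgebra [B0] acts by diagonal operators, since representations are contractive
    ([hom_norm]); hence each node gives a character of [B0], and the characters of
    neighbouring nodes correspond under [theta] ([tree_points]).  The root has the prescribed
    [E]-function ([choice_realised]).

    Levels.  In the limit an arrow [x] of [E_n] is the sum of the adjoints of the arrows of
    [X(x)], of which each tuple of [D_{n+2}] selects one.  Hence conjugation by [x] preserves
    [B0] ([et_normaliser]), and over a tuple with entry [x] the inverse of [theta_x] is
    implemented by an arrow of [E_{n+1}] ([Theta_next]).  Passing from [E_k] to [E_{k+2}] in
    this way, induction shows that two points over the same vertex agree on the level
    [D_{n+1}] if and only if their translates agree on [D_n] ([sim_star], [sim_tuple]).
    Applied along the tree, this gives [efun_agree_sim]: the [E]-functions of two points over
    [w] agree in their first [r] terms if and only if the points agree on [D_{2r+1}].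

    Topology.  The evaluations at the elements of [B0] whose values are approximated by
    finitely many levels form a closed subalgebra, as characters are contractive
    ([char_norm]); it contains the vertices, so it is all of [B0].  Therefore the sets
    represented by partial [E]-functions form a neighbourhood basis ([near_sets_cvg]) and the
    levels separate points ([sim_eq]).  A partial [E]-function is realised by some point, and
    the set that it represents is that of the vertex of [D_{2r+1}] under this point
    ([represented_level]). *)

Set Implicit Arguments.
Unset Strict Implicit.
Unset Printing Implicit Defensive.

Local Open Scope ring_scope.
Local Open Scope classical_set_scope.
Local Open Scope complex_scope.

Local Notation nextE := Defs.nextE.
Local Notation canon := Defs.canon.

(** * Complex Hilbert spaces *)

Definition sqn (R : realType) (z : cplx R) : R := complex.Re z ^+ 2 + complex.Im z ^+ 2.

(** The squared norm is taken as primitive: for square-summable families it is a sum of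
    nonnegative terms, while the inner product would be a conditionally defined one.
    [hsq_polar] says that the conjugate of [k] is the adjoint of [k]. *)
Record hilbert (R : realType) := Hilbert {
  hilbert_sort :> lmodType (cplx R);
  hsq : hilbert_sort -> R;
  hsq_ge0 : forall x, 0 <= hsq x;
  hsq_eq0 : forall x, hsq x = 0 -> x = 0;
  hsqZ : forall k x, hsq (k *: x) = sqn k * hsq x;
  hsq_parallelogram : forall x y,
    hsq (x + y) + hsq (x - y) = 2 * (hsq x + hsq y);
  hsq_polar : forall (k : cplx R) x y,
    hsq (k *: x + y) - hsq (k *: x - y) =
    hsq (x + conjc k *: y) - hsq (x - conjc k *: y);
  hsq_complete : forall u : nat -> hilbert_sort,
    (forall e, 0 < e -> exists N, forall m n, (N <= m)%N -> (N <= n)%N ->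
       hsq (u m - u n) <= e) ->
    exists l, forall e, 0 < e -> exists N, forall n, (N <= n)%N ->
      hsq (u n - l) <= e
}.

Section HilbertTheory.
Context {R : realType} {H : hilbert R}.
Implicit Types x y z : H.

(** Four times the real part of the inner product. *)
Definition hdot x y : R := hsq (x + y) - hsq (x - y).

Definition hnorm x : R := Num.sqrt (hsq x).

Lemma hnorm_ge0 x : 0 <= hnorm x. Proof. exact: sqrtr_ge0. Qed.

Lemma hnormE x : hnorm x ^+ 2 = hsq x. Proof. exact/sqr_sqrtr/hsq_ge0. Qed.

Lemma hnorm_eq0 x : hnorm x = 0 -> x = 0.
Proof. by move=> x0; apply: hsq_eq0; rewrite -hnormE x0 expr0n. Qed.

Lemma sqnC (t : R) : sqn (t%:C : cplx R) = t ^+ 2.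
Proof. by rewrite /sqn /= expr0n addr0. Qed.

Lemma sqn_norm (k : cplx R) : Num.sqrt (sqn k) = complex.Re `|k|.
Proof. by rewrite normc_def. Qed.

Lemma hnormZ (k : cplx R) x : hnorm (k *: x) = complex.Re `|k| * hnorm x.
Proof.
by rewrite /hnorm hsqZ sqrtrM ?sqn_norm // addr_ge0 ?sqr_ge0.
Qed.

Lemma hsqN x : hsq (- x) = hsq x.
Proof. by rewrite -scaleN1r hsqZ /sqn /= oppr0 sqrrN expr1n expr0n addr0 mul1r. Qed.

Lemma hsq0 : hsq (0 : H) = 0.
Proof. by rewrite -(scale0r (0 : H)) hsqZ /sqn /= expr0n addr0 mul0r. Qed.

Lemma hnorm0 : hnorm (0 : H) = 0. Proof. by rewrite /hnorm hsq0 sqrtr0. Qed.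

Lemma hnormN x : hnorm (- x) = hnorm x.
Proof. by rewrite /hnorm hsqN. Qed.

Lemma hdotC x y : hdot x y = hdot y x.
Proof. by rewrite /hdot (addrC x) -(hsqN (x - y)) opprB. Qed.

Lemma hdot0 x : hdot 0 x = 0.
Proof. by rewrite /hdot !add0r hsqN subrr. Qed.

(** The argument of Jordan and von Neumann: subtract the parallelogram laws for
    [x + z, y + z] and for [x - z, y - z]. *)
Lemma hdot_half x y z : hdot x z + hdot y z = 2^-1 * hdot (x + y) (z + z).
Proof.
have p := hsq_parallelogram (x + z) (y + z).
have m := hsq_parallelogram (x - z) (y - z).
have e1 : x + z + (y + z) = x + y + (z + z) by rewrite addrACA.
have e2 : x + z - (y + z) = x - y by rewrite opprD addrACA subrr addr0.
have e3 : x - z + (y - z) = x + y - (z + z) by rewrite addrACA -opprD.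
have e4 : x - z - (y - z) = x - y by rewrite opprB addrA subrK.
rewrite e1 e2 in p; rewrite e3 e4 in m; rewrite /hdot.
lra.
Qed.

Lemma hdotDl x y z : hdot (x + y) z = hdot x z + hdot y z.
Proof.
rewrite hdot_half -[LHS](addr0) -(hdot0 z) hdot_half addr0 //.
Qed.

Lemma hdotDr x y z : hdot z (x + y) = hdot z x + hdot z y.
Proof. by rewrite hdotC hdotDl !(hdotC _ z). Qed.

Lemma hdotNl x y : hdot (- x) y = - hdot x y.
Proof. by apply/eqP; rewrite -addr_eq0 -hdotDl addNr hdot0. Qed.

Lemma hdotNr x y : hdot x (- y) = - hdot x y.
Proof. by rewrite hdotC hdotNl hdotC. Qed.

Lemma hdotZl (k : cplx R) x y : hdot (k *: x) y = hdot x (conjc k *: y).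
Proof. exact: hsq_polar. Qed.

Lemma hdotxx x : hdot x x = 4 * hsq x.
Proof.
rewrite /hdot subrr hsq0 subr0 (_ : x + x = (2 : R)%:C *: x).
  by rewrite hsqZ sqnC; congr (_ * _); ring.
by rewrite rmorph_nat scaler_nat mulr2n.
Qed.

Lemma hdot_inj x y : (forall z, hdot x z = hdot y z) -> x = y.
Proof.
move=> xy; apply/eqP; rewrite -subr_eq0; apply/eqP/hsq_eq0.
have := hdotxx (x - y); rewrite {1}hdotDl hdotNl xy subrr.
by move/esym/eqP; rewrite mulf_eq0 pnatr_eq0 /= => /eqP.
Qed.

Lemma hsqD x y : 2 * hsq (x + y) = 2 * hsq x + 2 * hsq y + hdot x y.
Proof. have := hsq_parallelogram x y; rewrite /hdot; lra. Qed.

(** Cauchy-Schwarz, from [0 <= |s x - y / s|^2] with [s^2 = |y| / |x|], which makes both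
    squares equal to [|x| |y|]. *)
Lemma hdot_le x y : hdot x y <= 4 * (hnorm x * hnorm y).
Proof.
have [x0|x0] := eqVneq (hnorm x) 0; first by rewrite (hnorm_eq0 x0) hdot0 hnorm0 mul0r mulr0.
have [y0|y0] := eqVneq (hnorm y) 0.
  by rewrite (hnorm_eq0 y0) hdotC hdot0 hnorm0 !mulr0.
have xp : 0 < hnorm x by rewrite lt_def x0 hnorm_ge0.
have yp : 0 < hnorm y by rewrite lt_def y0 hnorm_ge0.
pose s := Num.sqrt (hnorm y / hnorm x).
have s2 : s ^+ 2 = hnorm y / hnorm x by rewrite sqr_sqrtr // divr_ge0 ?hnorm_ge0.
have sp : 0 < s by rewrite sqrtr_gt0 divr_gt0.
have e : hdot (s%:C *: x) (- (s^-1%:C *: y)) = - hdot x y.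
  rewrite hdotNr hdotZl conjc_real scalerA -rmorphM divff ?gt_eqF //.
  by rewrite scale1r.
have := hsqD (s%:C *: x) (- (s^-1%:C *: y)); rewrite e hsqN !hsqZ !sqnC.
have := hsq_ge0 (s%:C *: x - s^-1%:C *: y).
rewrite -(hnormE x) -(hnormE y) exprVn s2.
have -> : hnorm y / hnorm x * hnorm x ^+ 2 = hnorm x * hnorm y.
  by field.
have -> : (hnorm y / hnorm x)^-1 * hnorm y ^+ 2 = hnorm x * hnorm y.
  by field; rewrite x0 y0.
lra.
Qed.

Lemma ler_hnormD x y : hnorm (x + y) <= hnorm x + hnorm y.
Proof.
rewrite -(@ler_pXn2r _ 2) ?nnegrE ?addr_ge0 ?hnorm_ge0 // hnormE.
have := hsqD x y; have := hdot_le x y; rewrite -(hnormE x) -(hnormE y).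
rewrite sqrrD; lra.
Qed.

Lemma hnorm_complete (u : nat -> H) :
    (forall e, 0 < e -> exists N, forall m n, (N <= m)%N -> (N <= n)%N ->
       hnorm (u m - u n) <= e) ->
  exists l, forall e, 0 < e -> exists N, forall n, (N <= n)%N ->
      hnorm (u n - l) <= e.
Proof.
move=> cu; have [e e0|l ul] := @hsq_complete _ _ u.
  have [|N uN] := cu (Num.sqrt e); first by rewrite sqrtr_gt0.
  by exists N => m n Nm Nn; rewrite -(ler_sqrt _ (ltW e0)) uN.
exists l => e e0; have [|N uN] := ul (e ^+ 2); first by rewrite exprn_gt0.
exists N => n Nn; rewrite -(@ler_pXn2r _ 2) ?nnegrE ?hnorm_ge0 ?(ltW e0) //.
by rewrite hnormE uN.
Qed.

(** Additivity of [T] and [S] follows from adjointness.  Homogeneity is required separately,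
    since [hdot] only sees the real part of the inner product. *)
Definition adjoint_bounded (K : R) (T S : H -> H) : Prop :=
  [/\ forall (k : cplx R) x, T (k *: x) = k *: T x,
      forall (k : cplx R) x, S (k *: x) = k *: S x,
      forall x y, hdot (T x) y = hdot x (S y),
      forall x, hnorm (T x) <= K * hnorm x &
      forall x, hnorm (S x) <= K * hnorm x].

Lemma adjoint_boundedC K T S :
  adjoint_bounded K T S -> adjoint_bounded K S T.
Proof.
case=> TZ SZ TS bT bS; split=> // x y.
by rewrite hdotC -TS hdotC.
Qed.

(** An adjointable map is additive because [hdot] is additive and separates points. *)
Lemma adjoint_additive K T S : adjoint_bounded K T S ->
  forall x y, T (x + y) = T x + T y.
Proof.
case=> _ _ TS _ _ x y; apply: hdot_inj => z.
by rewrite hdotDl !TS hdotDl.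
Qed.

Lemma adjoint_boundedP (k : cplx R) K K' T T' S S' :
  adjoint_bounded K T S -> adjoint_bounded K' T' S' ->
  adjoint_bounded (complex.Re `|k| * K + K') 
    (fun x => k *: T x + T' x) (fun x => conjc k *: S x + S' x).
Proof.
have nJ : complex.Re `|conjc k : cplx R| = complex.Re `|k| by rewrite -[in RHS]normcJ.
case=> TZ SZ TS bT bS [TZ' SZ' TS' bT' bS']; split=> [l x|l x|x y|x|x].
- by rewrite TZ TZ' scalerDr !scalerA mulrC.
- by rewrite SZ SZ' scalerDr !scalerA mulrC.
- by rewrite hdotDl hdotZl hdotDr TS TS' -[_ *: S y]SZ.
- rewrite (le_trans (ler_hnormD _ _)) // hnormZ mulrDl lerD // -mulrA ler_wpM2l //.
  by rewrite normc_def /= sqrtr_ge0.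
- rewrite (le_trans (ler_hnormD _ _)) // hnormZ mulrDl lerD // -mulrA.
  rewrite nJ ler_wpM2l //.
  by rewrite normc_def /= sqrtr_ge0.
Qed.

Lemma adjoint_bounded_comp K K' T T' S S' : 0 <= K ->  0 <= K' ->
  adjoint_bounded K T S -> adjoint_bounded K' T' S' ->
  adjoint_bounded (K * K') (T \o T') (S' \o S).
Proof.
move=> K0 K'0.
case=> TZ SZ TS bT bS [TZ' SZ' TS' bT' bS']; split=> [l x|l x|x y|x|x] /=.
- by rewrite TZ' TZ.
- by rewrite SZ SZ'.
- by rewrite TS TS'.
- by rewrite (le_trans (bT _)) // -mulrA ler_wpM2l.
- by rewrite (le_trans (bS' _)) // (mulrC K) -mulrA ler_wpM2l.
Qed.

End HilbertTheory.

(** * Bounded operators and their norm *)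

Section BoundedOps.
Context {R : realType} {H : hilbert R}.

Definition bounded_op (T : H -> H) : Prop :=
  exists K S, 0 <= K /\ adjoint_bounded K T S.

Definition bop_pred : {pred (H -> H)} := fun T => `[< bounded_op T >].

Lemma bop_submod_closed : GRing.submod_closed bop_pred.
Proof.
split=> [|k T T' /asboolP[K [S [K0 TS]]] /asboolP[K' [S' [K'0 TS']]]]; apply/asboolP.
  exists 0, (fun=> 0); split => //; split=> [k x|k x|x y|x|x] /=.
  - by rewrite scaler0.
  - by rewrite scaler0.
  - by rewrite [LHS]hdot0 hdotC hdot0.
  - by rewrite [leLHS]hnorm0 mul0r.
  - by rewrite hnorm0 mul0r.
exists (complex.Re `|k| * K + K'), (fun x => conjc k *: S x + S' x).
split; last exact: adjoint_boundedP.
by rewrite addr_ge0 // mulr_ge0 // normc_def /= sqrtr_ge0.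
Qed.

HB.instance Definition _ := GRing.isSubmodClosed.Build (cplx R) (H -> H) bop_pred bop_submod_closed.

End BoundedOps.

Record bop (R : realType) (H : hilbert R) := Bop {
  bop_fun :> H -> H;
  bop_funP : bop_fun \in bop_pred
}.

HB.instance Definition _ (R : realType) (H : hilbert R) := [isSub for @bop_fun R H].
HB.instance Definition _ (R : realType) (H : hilbert R) := [Choice of bop H by <:].
HB.instance Definition _ (R : realType) (H : hilbert R) :=
  [SubChoice_isSubLmodule of bop H by <:].

Section OperatorNorm.
Context {R : realType} {H : hilbert R}.
Implicit Types T S : bop H.

Lemma bopDE T S x : (T + S) x = T x + S x. Proof. by []. Qed.
Lemma bopNE T x : (- T) x = - T x. Proof. by []. Qed.
Lemma bopZE (k : cplx R) T x : (k *: T) x = k *: T x. Proof. by []. Qed.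
Lemma bop0E x : (0 : bop H) x = 0. Proof. by []. Qed.

Lemma bop_ext T S : T =1 S -> T = S.
Proof. by move=> TS; apply/val_inj/funext. Qed.

Definition opn_bounds T : set R :=
  [set K | 0 <= K /\ forall x, hnorm (T x) <= K * hnorm x].

Definition opn T : R := inf (opn_bounds T).

Lemma opn_bounds0 T : opn_bounds T !=set0.
Proof.
have /asboolP[K [S [K0 [_ _ _ TK _]]]] := bop_funP T.
by exists K; split.
Qed.

Lemma opn_ge0 T : 0 <= opn T.
Proof. by apply: lb_le_inf; [exact: opn_bounds0|move=> K []]. Qed.

Lemma opn_le T K : 0 <= K -> (forall x, hnorm (T x) <= K * hnorm x) -> opn T <= K.
Proof. by move=> K0 TK; apply: ge_inf; [exists 0 => ? []|split]. Qed.

Lemma le_opn T x : hnorm (T x) <= opn T * hnorm x.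
Proof.
have [x0|x0] := eqVneq (hnorm x) 0.
  have [K [_ /(_ x)]] := opn_bounds0 T.
  by rewrite x0 !mulr0.
have xp : 0 < hnorm x by rewrite lt_def x0 hnorm_ge0.
rewrite -ler_pdivrMr //; apply: lb_le_inf; first exact: opn_bounds0.
by move=> K [K0 TK]; rewrite ler_pdivrMr.
Qed.

(** The adjoint [S] has the bound of [T] by [|S x|^2 = <T S x, x> <= |T| |S x| |x|]. *)
Lemma bop_adjoint_ex T : exists S : H -> H, adjoint_bounded (opn T) T S.
Proof.
have /asboolP[K [S [K0 [TZ SZ TS bT bS]]]] := bop_funP T.
exists S; split=> // x; first exact: le_opn.
have := hdot_le (T (S x)) x; rewrite TS hdotxx -hnormE expr2.
have := le_opn T (S x); have := hnorm_ge0 x.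
have [->|Sx0] := eqVneq (hnorm (S x)) 0; first by rewrite mulr_ge0 ?opn_ge0 ?hnorm_ge0.
have Sp : 0 < hnorm (S x) by rewrite lt_def Sx0 hnorm_ge0.
move=> x0 h1 h2; rewrite -(ler_pM2l Sp).
apply: (@le_trans _ _ (hnorm (T (S x)) * hnorm x)); first by lra.
by rewrite mulrCA mulrA ler_wpM2r.
Qed.

Lemma bop_star_key T : exists S : bop H, adjoint_bounded (opn T) T S.
Proof.
have [S TS] := bop_adjoint_ex T.
suff Sb : S \in bop_pred by exists (Bop Sb).
by apply/asboolP; exists (opn T), T; split; [exact: opn_ge0|exact: adjoint_boundedC].
Qed.

Definition bop_star T : bop H := sval (cid (bop_star_key T)).

Lemma bop_starP T : adjoint_bounded (opn T) T (bop_star T).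
Proof. exact: svalP (cid (bop_star_key T)). Qed.

Lemma bop_star_uniq T S : (forall x y, hdot (T x) y = hdot x (S y)) -> bop_star T = S.
Proof.
move=> TS; have [_ _ TS' _ _] := bop_starP T.
by apply: bop_ext => x; apply: hdot_inj => z; rewrite hdotC -TS' TS hdotC.
Qed.

Lemma bop_starE T x y : hdot (T x) y = hdot x (bop_star T y).
Proof. by have [] := bop_starP T. Qed.

Lemma bopZ T (k : cplx R) x : T (k *: x) = k *: T x.
Proof. by have [] := bop_starP T. Qed.

Lemma bopD T x y : T (x + y) = T x + T y.
Proof. exact: adjoint_additive (bop_starP T) _ _. Qed.

Lemma bop_mul_key T S : (T \o S) \in bop_pred.
Proof.
apply/asboolP; exists (opn T * opn S), (bop_star S \o bop_star T); split.
  by rewrite mulr_ge0 ?opn_ge0.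
by apply: adjoint_bounded_comp; rewrite ?opn_ge0 //; exact: bop_starP.
Qed.

Definition bop_mul T S : bop H := Bop (bop_mul_key T S).

Lemma bop_starK : involutive bop_star.
Proof. by move=> T; apply: bop_star_uniq => x y; rewrite hdotC -bop_starE hdotC. Qed.

Lemma bop_starD : {morph bop_star : T S / T + S}.
Proof.
by move=> T S; apply: bop_star_uniq => x y; rewrite !bopDE hdotDl hdotDr !bop_starE.
Qed.

Lemma bop_starZ (k : cplx R) T : bop_star (k *: T) = conjc k *: bop_star T.
Proof.
apply: bop_star_uniq => x y.
by rewrite !bopZE hdotZl bop_starE bopZ.
Qed.

Lemma bop_starN T : bop_star (- T) = - bop_star T.
Proof. by apply: bop_star_uniq => x y; rewrite !bopNE hdotNl hdotNr bop_starE. Qed.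

Lemma bop_starM T S : bop_star (bop_mul T S) = bop_mul (bop_star S) (bop_star T).
Proof. by apply: bop_star_uniq => x y /=; rewrite !bop_starE. Qed.

Lemma opnD T S : opn (T + S) <= opn T + opn S.
Proof.
apply: opn_le => [|x]; first by rewrite addr_ge0 ?opn_ge0.
by rewrite bopDE (le_trans (ler_hnormD _ _)) // mulrDl lerD ?le_opn.
Qed.

Lemma opnZ_le (k : cplx R) T : opn (k *: T) <= complex.Re `|k| * opn T.
Proof.
have k0 : 0 <= complex.Re `|k| by rewrite normc_def sqrtr_ge0.
apply: opn_le => [|x]; first by rewrite mulr_ge0 ?opn_ge0.
by rewrite bopZE hnormZ -mulrA ler_wpM2l // le_opn.
Qed.

Lemma opn_eq0 T : opn T = 0 -> T = 0.
Proof.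
move=> T0; apply: bop_ext => x; apply: hnorm_eq0; apply/eqP.
by rewrite eq_le hnorm_ge0 andbT (le_trans (le_opn _ _)) // T0 mul0r.
Qed.

Lemma ReN (k : cplx R) : (complex.Re `|k|)%:C = `|k|.
Proof. by rewrite normc_def. Qed.

Lemma opnZ (k : cplx R) T : opn (k *: T) = complex.Re `|k| * opn T.
Proof.
have [->|k0] := eqVneq k 0.
  rewrite scale0r normr0 mul0r; apply/le_anti.
  by rewrite opn_ge0 opn_le // => x; rewrite bop0E hnorm0 mul0r.
apply/le_anti; rewrite opnZ_le /=.
have := opnZ_le k^-1 (k *: T); rewrite scalerA mulVf // scale1r normfV.
have kp : 0 < complex.Re `|k|.
  by rewrite -ltcR (_ : 0%:C = 0 :> R[i]) // [ltRHS]ReN normr_gt0.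
have -> : complex.Re `|k|^-1 = (complex.Re `|k|)^-1.
  by rewrite -{1}(ReN k) -fmorphV.
by rewrite mulrC ler_pdivlMr // mulrC.
Qed.

Definition bop_norm T : cplx R := (opn T)%:C.

Lemma bop_normD T S : bop_norm (T + S) <= bop_norm T + bop_norm S.
Proof. by rewrite /bop_norm -rmorphD lecR opnD. Qed.

Lemma bop_normZ (k : cplx R) T : bop_norm (k *: T) = `|k| * bop_norm T.
Proof. by rewrite /bop_norm opnZ rmorphM /= ReN. Qed.

Lemma bop_norm_eq0 T : bop_norm T = 0 -> T = 0.
Proof. by move/(@complexI R); exact: opn_eq0. Qed.

End OperatorNorm.

HB.instance Definition _ (R : realType) (H : hilbert R) :=
  Lmodule_isNormed.Build (cplx R) (bop H) (@bop_normD R H) (@bop_normZ R H) (@bop_norm_eq0 R H).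

(** * Completeness of the bounded operators and the norm of T^* T *)

Section Completeness.
Context {R : realType} {H : hilbert R}.
Implicit Types T S : bop H.

Lemma bop_normE T : `|T| = (opn T)%:C. Proof. by []. Qed.

Lemma bop_ballE T S (e : R) : ball T (e%:C : cplx R) S <-> opn (T - S) < e.
Proof. by rewrite -ball_normE /= bop_normE ltcR. Qed.

Lemma hnorm_small (x : H) (c : R) : 0 <= c -> (forall e, 0 < e -> hnorm x <= e * c) -> x = 0.
Proof.
move=> c0 xe; apply: hnorm_eq0; apply/le_anti; rewrite hnorm_ge0 andbT.
have [cz|cn] := eqVneq c 0; first by have := xe 1 ltr01; rewrite cz mulr0.
have cp : 0 < c by rewrite lt_def cn.
apply/ler_addgt0Pr => e e0; rewrite add0r.
by have := xe (e / c) (divr_gt0 e0 cp); rewrite divfK.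
Qed.

Lemma hdot_norm (x y : H) : `|hdot x y| <= 4 * (hnorm x * hnorm y).
Proof.
by rewrite ler_norml hdot_le lerNl -hdotNl -(hnormN x) hdot_le.
Qed.

(** A sequence of operators that is Cauchy in norm converges pointwise, uniformly
    on bounded sets, hence in norm to the pointwise limit. *)
Lemma bop_seq_complete (T : nat -> bop H) :
  (forall e, 0 < e -> exists N, forall m n, (N <= m)%N -> (N <= n)%N ->
     opn (T m - T n) <= e) ->
  exists L, forall e, 0 < e -> exists N, forall n, (N <= n)%N -> opn (T n - L) <= e.
Proof.
have pt (U : nat -> bop H) :
    (forall e, 0 < e -> exists N, forall m n, (N <= m)%N -> (N <= n)%N ->
     opn (U m - U n) <= e) ->
    exists L : H -> H, forall e, 0 < e -> exists N, forall n, (N <= n)%N ->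
     forall x, hnorm (U n x - L x) <= e * hnorm x.
  move=> cU.
  have /choice[L LP] x : exists l, forall e, 0 < e -> exists N, forall n, (N <= n)%N ->
      hnorm (U n x - l) <= e.
    apply: hnorm_complete => e e0.
    have d0 : 0 < hnorm x + 1 by rewrite ltr_wpDl ?hnorm_ge0.
    have [|N UN] := cU (e / (hnorm x + 1)); first by rewrite divr_gt0.
    exists N => m n Nm Nn; rewrite -bopNE -bopDE (le_trans (le_opn _ _)) //.
    apply: (@le_trans _ _ (e / (hnorm x + 1) * hnorm x)).
      by rewrite ler_wpM2r ?hnorm_ge0 ?UN.
    by rewrite -mulrA ler_piMr ?(ltW e0) // mulrC ler_pdivrMr // mul1r lerDl.
  exists L => e e0; have [N UN] := cU e e0; exists N => n Nn x.
  apply/ler_addgt0Pr => d d0; have [N' LN] := LP x d d0.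
  pose m := maxn N N'.
  rewrite -(subrK (U m x) (U n x)) -addrA (le_trans (ler_hnormD _ _)) // lerD //.
    rewrite -bopNE -bopDE (le_trans (le_opn _ _)) // ler_wpM2r ?hnorm_ge0 //.
    by rewrite UN // leq_maxl.
  by rewrite LN // leq_maxr.
move=> cT; have [L LP] := pt T cT.
have cS e : 0 < e -> exists N, forall m n, (N <= m)%N -> (N <= n)%N ->
     opn (bop_star (T m) - bop_star (T n)) <= e.
  move=> e0; have [N TN] := cT e e0; exists N => m n Nm Nn.
  apply: (le_trans _ (TN m n Nm Nn)); apply: opn_le => [|x]; first exact: opn_ge0.
  by have [_ _ _ _] := bop_starP (T m - T n); rewrite bop_starD bop_starN; apply.
have [L' L'P] := pt _ cS.
have close n e : 0 < e -> exists2 m, (n <= m)%N &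
    (forall x, hnorm (T m x - L x) <= e * hnorm x) /\
    (forall x, hnorm (bop_star (T m) x - L' x) <= e * hnorm x).
  move=> e0; have [N LN] := LP e e0; have [N' LN'] := L'P e e0.
  exists (maxn n (maxn N N')); first exact: leq_maxl.
  split=> x; [apply: LN|apply: LN'].
    by rewrite (leq_trans (leq_maxl N N')) // leq_maxr.
  by rewrite (leq_trans (leq_maxr N N')) // leq_maxr.
have Zlim (U : H -> H) (k : cplx R) x :
    (forall e, 0 < e -> exists V : bop H, forall x, hnorm (V x - U x) <= e * hnorm x) ->
    U (k *: x) = k *: U x.
  move=> UV; apply/eqP; rewrite -subr_eq0; apply/eqP.
  have k0 : 0 <= complex.Re `|k| by rewrite normc_def sqrtr_ge0.
  apply: (@hnorm_small _ (complex.Re `|k| * hnorm x + complex.Re `|k| * hnorm x)).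
    by rewrite addr_ge0 // mulr_ge0 ?hnorm_ge0.
  move=> e /UV[V VU].
  rewrite -(subrK (V (k *: x)) (U (k *: x))) -addrA (le_trans (ler_hnormD _ _)) //.
  rewrite -hnormN opprB mulrDr lerD //; first by rewrite -hnormZ VU.
  rewrite bopZ -scalerBr hnormZ mulrCA ler_wpM2l // VU.
have [m _ [Tm Sm]] := close 0%N 1 ltr01.
have bd (U V : H -> H) (x : H) : hnorm (V x) <= opn (T m) * hnorm x ->
    hnorm (V x - U x) <= 1 * hnorm x -> hnorm (U x) <= (1 + opn (T m)) * hnorm x.
  move=> Vx VU; rewrite -(subrK (V x) (U x)) (le_trans (ler_hnormD _ _)) //.
  by rewrite mulrDl lerD // -hnormN opprB.
have [_ _ _ mT mS] := bop_starP (T m).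
have key : adjoint_bounded (1 + opn (T m)) L L'.
  split=> [k x|k x|x y|x|x].
  - by apply: Zlim => e /(close 0%N)[n _ [Tn _]]; exists (T n).
  - by apply: Zlim => e /(close 0%N)[n _ [_ Sn]]; exists (bop_star (T n)).
  - set c := hnorm x * hnorm y.
    suff le0 e : 0 < e -> `|hdot (L x) y - hdot x (L' y)| <= e.
      apply/eqP; rewrite -subr_eq0 -normr_le0; apply/ler_addgt0Pr => e e0.
      by rewrite add0r le0.
    move=> e0.
    have c0 : 0 <= c by rewrite mulr_ge0 ?hnorm_ge0.
    have d0 : 0 < e / (8 * c + 1) by rewrite divr_gt0 // ltr_wpDl // mulr_ge0.
    have [n _ [Tn Sn]] := close 0%N _ d0; move: d0 Tn Sn; set d := e / _ => d0 Tn Sn.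
    have de : 8 * (d * c) <= e.
      have -> : e = d * (8 * c + 1) by rewrite /d divfK // gt_eqF // ltr_wpDl // mulr_ge0.
      by rewrite mulrDr mulr1 mulrCA lerDl ltW.
    have -> : hdot (L x) y - hdot x (L' y) =
        hdot x (bop_star (T n) y - L' y) - hdot (T n x - L x) y.
      rewrite hdotDr hdotDl hdotNl hdotNr bop_starE; lra.
    apply: le_trans de; rewrite (le_trans (ler_normB _ _)) //.
    have -> : 8 * (d * c) = 4 * (hnorm x * (d * hnorm y)) + 4 * (d * hnorm x * hnorm y).
      by rewrite /c; ring.
    rewrite lerD // (le_trans (hdot_norm _ _)) // ler_wpM2l //.
      by rewrite ler_wpM2l ?hnorm_ge0.
    by rewrite ler_wpM2r ?hnorm_ge0.
  - by apply: (bd _ (T m)).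
  - by apply: (bd _ (bop_star (T m))).
have LB : L \in bop_pred.
  by apply/asboolP; exists (1 + opn (T m)), L'; split; rewrite ?addr_ge0 ?opn_ge0.
exists (Bop LB) => e e0; have [N LN] := LP e e0; exists N => n Nn.
by apply: opn_le => [|x]; [exact: ltW|exact: LN].
Qed.

(** A Cauchy filter contains sets of arbitrarily small diameter; an operator chosen in the
    intersection of the first [n] of them, for each [n], gives a Cauchy sequence whose
    limit is that of the filter. *)
Lemma bop_complete (F : set_system (bop H)) : ProperFilter F -> cauchy F -> cvg F.
Proof.
move=> FF /cauchy_ballP cF.
have small n : exists2 A : set (bop H), F A &
    forall T S, A T -> A S -> opn (T - S) < n.+1%:R^-1.
  have n0 : (0 : cplx R) < (n.+1%:R^-1 : R)%:C by rewrite ltcR invr_gt0.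
  have [[A B] /= [FA FB] AB] := cF _ n0.
  exists (A `&` B); first exact: filterI.
  by move=> T S [AT _] [_ BS]; apply/bop_ballE/(AB (T, S)).
have /choice[A /all_and2[FA smallA]] n : exists A : set (bop H), F A /\
    forall T S, A T -> A S -> opn (T - S) < n.+1%:R^-1.
  by have [A FA ?] := small n; exists A.
have FAn n : F [set T | forall k, (k <= n)%N -> A k T].
  elim: n => [|n IH].
    by apply: filterS (FA 0%N) => T AT k; rewrite leqn0 => /eqP ->.
  apply: filterS (filterI IH (FA n.+1)) => T [Tk Tn] k.
  by rewrite leq_eqVlt => /orP[/eqP -> //|]; rewrite ltnS; exact: Tk.
have /choice[T TA] n : exists T, forall k, (k <= n)%N -> A k T.
  exact: filter_ex (FAn n).
have eN (e : R) : 0 < e -> exists N : nat, N.+1%:R^-1 < e.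
  move=> e0; have [N _ NP] := near_infty_natSinv_lt (PosNum e0).
  by exists N; apply: NP => /=.
have [|L TL] := @bop_seq_complete T.
  move=> e /eN[N Ne]; exists N => m n Nm Nn.
  by rewrite ltW // (lt_trans (smallA N _ _ _ _)) //; apply: TA.
apply/cvg_ex; exists L; apply/cvg_ballP => e e0.
have eE : e = (complex.Re e)%:C by rewrite RRe_real // gtr0_real.
have e20 : 0 < complex.Re e / 2.
  by rewrite divr_gt0 //; move: e0; rewrite eE ltcR.
have [N Ne] := eN _ e20; have [N' LN] := TL _ e20.
pose n := maxn N N'.
apply: filterS (FA N) => S AS /=; rewrite eE; apply/bop_ballE.
have -> : L - S = (T n - S) - (T n - L) by rewrite opprB [RHS]addrC addrA subrK.
rewrite (le_lt_trans (opnD _ _)) // [ltRHS](splitr (complex.Re e)) ltr_leD //.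
  by rewrite (lt_trans _ Ne) // smallA //; apply: TA; rewrite leq_maxl.
by rewrite -scaleN1r opnZ normrN normr1 mul1r LN // leq_maxr.
Qed.

End Completeness.

HB.instance Definition _ (R : realType) (H : hilbert R) :=
  Uniform_isComplete.Build (bop H) (@bop_complete R H).

Section BopCstar.
Context {R : realType} {H : hilbert R}.
Implicit Types T S : bop H.

Lemma bop_mulA : associative (@bop_mul R H).
Proof. by move=> T S U; apply: bop_ext. Qed.

Lemma bop_mulDl : left_distributive (@bop_mul R H) +%R.
Proof. by move=> T S U; apply: bop_ext. Qed.

Lemma bop_mulDr : right_distributive (@bop_mul R H) +%R.
Proof. by move=> T S U; apply: bop_ext => x; rewrite /= bopD. Qed.

Lemma bop_mulZl (k : cplx R) T S : bop_mul (k *: T) S = k *: bop_mul T S.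
Proof. by apply: bop_ext. Qed.

Lemma bop_mulZr (k : cplx R) T S : bop_mul T (k *: S) = k *: bop_mul T S.
Proof. by apply: bop_ext => x; rewrite /= bopZ. Qed.

Lemma opn_mul T S : opn (bop_mul T S) <= opn T * opn S.
Proof.
apply: opn_le => [|x]; first by rewrite mulr_ge0 ?opn_ge0.
by rewrite -mulrA (le_trans (le_opn T _)) // ler_wpM2l ?opn_ge0 // le_opn.
Qed.

Lemma bop_normM T S : `|bop_mul T S| <= `|T| * `|S|.
Proof. by rewrite !bop_normE -rmorphM lecR opn_mul. Qed.

Lemma opn_star_le T : opn (bop_star T) <= opn T.
Proof. by have [_ _ _ _] := bop_starP T; apply: opn_le; exact: opn_ge0. Qed.

(** [|T x|^2 = <T^* T x, x> <= |T^* T| |x|^2]. *)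
Lemma bop_norm_starM T : `|bop_mul (bop_star T) T| = `|T| ^+ 2.
Proof.
rewrite !bop_normE -rmorphXn; congr (_%:C); apply/le_anti/andP; split.
  by rewrite (le_trans (opn_mul _ _)) // expr2 ler_wpM2r ?opn_ge0 // opn_star_le.
rewrite -ler_sqrt ?opn_ge0 // sqrtr_sqr ger0_norm ?opn_ge0 //.
apply: opn_le => [|x]; first exact: sqrtr_ge0.
rewrite -(@ler_pXn2r _ 2) ?nnegrE ?mulr_ge0 ?sqrtr_ge0 ?hnorm_ge0 //.
rewrite exprMn (hnormE (T x)) sqr_sqrtr ?opn_ge0 //.
have := hdot_le x (bop_mul (bop_star T) T x).
rewrite -bop_starE hdotxx ler_pM2l // => /le_trans; apply.
rewrite mulrC expr2 mulrA ler_wpM2r ?hnorm_ge0 //; exact: le_opn.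
Qed.

Definition bop_cstar : cstarAlg R :=
  @CstarAlg R (bop H) (@bop_mul R H) (@bop_star R H) bop_mulA bop_mulDl bop_mulDr
    bop_mulZl bop_mulZr (@bop_starK R H) (@bop_starD R H) (@bop_starZ R H)
    (@bop_starM R H) bop_normM bop_norm_starM.

End BopCstar.

Arguments bop_cstar {R} H.

(** * Square-summable families *)

Lemma seq_cvg_norm {K : numFieldType} {V : completeNormedModType K} (u : nat -> V) :
  (forall e, 0 < e -> exists N, forall n, (N <= n)%N -> `|u N - u n| < e) ->
  cvg (u @ \oo).
Proof.
move=> cu; apply/cauchy_cvgP/cauchy_exP => e /cu[N uN].
by exists (u N), N => // n /uN uNn; rewrite /= -ball_normE.
Qed.

Section SquareSummable.
Context {R : realType} (I : choiceType).
Implicit Types (x y : I -> cplx R) (A : set I).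

Lemma sqn_ge0 (z : cplx R) : 0 <= sqn z.
Proof. by rewrite addr_ge0 ?sqr_ge0. Qed.

Lemma sqn_parallelogram (a b : cplx R) : sqn (a + b) + sqn (a - b) = 2 * (sqn a + sqn b).
Proof. by case: a b => [a1 a2] [b1 b2]; rewrite /sqn /=; ring. Qed.

Lemma sqnM (a b : cplx R) : sqn (a * b) = sqn a * sqn b.
Proof. by case: a b => [a1 a2] [b1 b2]; rewrite /sqn /=; ring. Qed.

(** Both sides differ by the real part of [k a] times the conjugate of [b]. *)
Lemma sqn_polar (k a b : cplx R) :
  sqn (k * a + b) + sqn (a - conjc k * b) = sqn (k * a - b) + sqn (a + conjc k * b).
Proof. by case: k a b => [k1 k2] [a1 a2] [b1 b2]; rewrite /sqn /=; ring. Qed.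

Lemma sqnD_le (a b : cplx R) : sqn (a + b) <= 2 * (sqn a + sqn b).
Proof. by rewrite -sqn_parallelogram lerDl sqn_ge0. Qed.

Lemma sqnN (a : cplx R) : sqn (- a) = sqn a.
Proof. by case: a => [a1 a2]; rewrite /sqn /=; ring. Qed.

Lemma sqn0 : sqn (0 : cplx R) = 0.
Proof. by rewrite /sqn /= expr0n addr0. Qed.

Lemma sqn_eq0 (a : cplx R) : sqn a = 0 -> a = 0.
Proof.
case: a => [a1 a2] /eqP; rewrite /sqn /= paddr_eq0 ?sqr_ge0 // !sqrf_eq0.
by move=> /andP[/eqP -> /eqP ->].
Qed.

Lemma esumZ A (c : R) (f : I -> R) : 0 <= c -> (forall i, 0 <= f i) ->
  (\esum_(i in A) (c * f i)%:E = c%:E * \esum_(i in A) (f i)%:E)%E.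
Proof.
have le (d : R) (g : I -> R) : 0 <= d -> (forall i, 0 <= g i) ->
    (\esum_(i in A) (d * g i)%:E <= d%:E * \esum_(i in A) (g i)%:E)%E.
  move=> d0 g0; apply: ge_ereal_sup => _ [X [fX XA] <-].
  under eq_fsbigr do rewrite EFinM.
  rewrite -ge0_mule_fsumr; last by move=> i; rewrite lee_fin.
  by rewrite lee_wpmul2l ?lee_fin //; apply: ereal_sup_ubound; exists X.
move=> c0 f0; apply/le_anti; rewrite le //=.
have [->|cn] := eqVneq c 0.
  by rewrite mul0e esum_ge0 // => i _; rewrite mul0r.
have cp : 0 < c by rewrite lt_def cn.
rewrite -lee_pdivlMl //; apply: (le_trans _ (le c^-1 (fun i => c * f i) _ _)).
- by apply: le_esum => i _; rewrite mulKf.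
- by rewrite invr_ge0.
- by move=> i; rewrite mulr_ge0.
Qed.

Definition esq A x : \bar R := \esum_(i in A) (sqn (x i))%:E.

Lemma esq_ge0 A x : (0 <= esq A x)%E.
Proof. by apply: esum_ge0 => i _; rewrite lee_fin sqn_ge0. Qed.

Definition ell2_pred : {pred (I -> cplx R)} := fun x => `[< (esq setT x < +oo)%E >].

Lemma ell2_submod_closed : GRing.submod_closed ell2_pred.
Proof.
split=> [|k x y /asboolP x2 /asboolP y2]; apply/asboolP.
  by rewrite /esq esum1 // => i _; rewrite sqn0.
apply: (@le_lt_trans _ _ ((2 * sqn k)%:E * esq setT x + 2%:E * esq setT y)%E).
  rewrite -!esumZ ?mulr_ge0 ?sqn_ge0 //; try by move=> i; exact: sqn_ge0.
  rewrite -esumD; try by move=> i _; rewrite lee_fin ?mulr_ge0 ?sqn_ge0.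
  apply: le_esum => i _; rewrite -EFinD lee_fin.
  by rewrite (le_trans (sqnD_le _ _)) // mulrDr lerD // -mulrA -sqnM.
by rewrite lte_add_pinfty // lte_mul_pinfty // lee_fin ?mulr_ge0 ?sqn_ge0.
Qed.

HB.instance Definition _ :=
  GRing.isSubmodClosed.Build (cplx R) (I -> cplx R) ell2_pred ell2_submod_closed.

End SquareSummable.

Record ell2 (R : realType) (I : choiceType) := Ell2 {
  ell2_fun :> I -> cplx R;
  ell2_funP : ell2_fun \in @ell2_pred R I
}.

HB.instance Definition _ (R : realType) (I : choiceType) := [isSub for @ell2_fun R I].
HB.instance Definition _ (R : realType) (I : choiceType) := [Choice of ell2 R I by <:].
HB.instance Definition _ (R : realType) (I : choiceType) :=
  [SubChoice_isSubLmodule of ell2 R I by <:].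

Section Ell2.
Context {R : realType} {I : choiceType}.
Implicit Types (x y : ell2 R I) (A : set I).

Lemma ell2_ext x y : x =1 y -> x = y.
Proof. by move=> xy; apply/val_inj/funext. Qed.

Lemma ell2DE x y i : (x + y) i = x i + y i. Proof. by []. Qed.
Lemma ell2NE x i : (- x) i = - x i. Proof. by []. Qed.
Lemma ell2ZE (k : cplx R) x i : (k *: x) i = k * x i. Proof. by []. Qed.

Definition psq A x : R := fine (esq A x).

Lemma esq_fin A x : esq A x = (psq A x)%:E.
Proof.
rewrite fineK // ge0_fin_numE ?esq_ge0 //.
have /asboolP := ell2_funP x; apply: le_lt_trans.
rewrite /esq (esum_mkcond A); apply: le_esum => i _.
by case: ifP => // _; rewrite lee_fin sqn_ge0.
Qed.

Lemma psq_ge0 A x : 0 <= psq A x. Proof. by rewrite fine_ge0 ?esq_ge0. Qed.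

Lemma psqID A x : psq setT x = psq A x + psq (~` A) x.
Proof.
apply/EFin_inj; rewrite EFinD -!esq_fin /esq (esumID A) ?setTI //.
by move=> i _; rewrite lee_fin sqn_ge0.
Qed.

Lemma eq_psq A x y : (forall i, A i -> sqn (x i) = sqn (y i)) -> psq A x = psq A y.
Proof. by move=> xy; congr fine; apply: eq_esum => i /xy ->. Qed.

Lemma psq_sub A x : psq A x <= psq setT x.
Proof. by rewrite (psqID A) lerDl psq_ge0. Qed.

Lemma psq_coord x i : sqn (x i) <= psq setT x.
Proof.
apply: le_trans (psq_sub [set i] x).
by rewrite /psq /esq esum_set1 // lee_fin sqn_ge0.
Qed.

Lemma psqD A x y (z w : ell2 R I) : (forall i, A i -> sqn (x i) + sqn (y i) = sqn (z i) + sqn (w i)) ->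
  psq A x + psq A y = psq A z + psq A w.
Proof.
move=> xy; apply/EFin_inj; rewrite !EFinD -!esq_fin /esq.
rewrite -!esumD; try by move=> i _; rewrite lee_fin sqn_ge0.
by apply: eq_esum => i Ai; rewrite -!EFinD xy.
Qed.

Lemma psqZ (k : cplx R) x : psq setT (k *: x) = sqn k * psq setT x.
Proof.
apply/EFin_inj; rewrite EFinM -!esq_fin /esq -esumZ ?sqn_ge0 //.
  by apply: eq_esum => i _; rewrite -sqnM.
by move=> i; rewrite sqn_ge0.
Qed.

Lemma psq_eq0 x : psq setT x = 0 -> x = 0.
Proof.
move=> x0; apply: ell2_ext => i; apply/sqn_eq0/le_anti.
by rewrite sqn_ge0 andbT -x0 psq_coord.
Qed.

Lemma psq_parallelogram x y :
  psq setT (x + y) + psq setT (x - y) = 2 * (psq setT x + psq setT y).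
Proof.
(* The factor 2 is absorbed by rescaling the vectors, so that both sides are sums of two
   squared norms. *)
have s2 : sqn ((Num.sqrt 2 : R)%:C : cplx R) = 2.
  by rewrite /sqn /= expr0n addr0 sqr_sqrtr.
rewrite mulrDr -{1}s2 -[X in X * psq setT y]s2 -!psqZ; apply: psqD => i _.
by rewrite [LHS]sqn_parallelogram mulrDr -{1}s2 -[X in X * sqn (y i)]s2 -!sqnM.
Qed.

Lemma psq_polar (k : cplx R) x y :
  psq setT (k *: x + y) - psq setT (k *: x - y) =
  psq setT (x + conjc k *: y) - psq setT (x - conjc k *: y).
Proof.
suff : psq setT (k *: x + y) + psq setT (x - conjc k *: y) =
       psq setT (k *: x - y) + psq setT (x + conjc k *: y) by lra.
by apply: psqD => i _; rewrite !(ell2DE, ell2NE, ell2ZE) sqn_polar.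
Qed.

Lemma re_cvg (u : nat -> R) :
  (forall e, 0 < e -> exists N, forall m n, (N <= m)%N -> (N <= n)%N -> (u m - u n) ^+ 2 <= e) ->
  exists l, forall e, 0 < e -> exists N, forall n, (N <= n)%N -> (u n - l) ^+ 2 <= e.
Proof.
have sq_lt (a e : R) : 0 < e -> a ^+ 2 <= (e / 2) ^+ 2 -> `|a| < e.
  move=> e0; rewrite -real_normK ?num_real // ler_pXn2r ?nnegrE ?divr_ge0 ?(ltW e0) //.
  by move/le_lt_trans; apply; rewrite ltr_pdivrMr // ltr_pMr // ltr1n.
move=> cu; have : cvg (u @ \oo).
  apply: seq_cvg_norm => e e0.
  have [|N uN] := cu ((e / 2) ^+ 2); first by rewrite exprn_gt0 // divr_gt0.
  by exists N => n nN; apply: sq_lt => //; exact: uN.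
move=> /cvg_ex[l ul]; exists l => e e0.
have e1 : 0 < Num.sqrt e by rewrite sqrtr_gt0.
move/cvgrPdist_le : ul => /(_ _ e1)[N _ uN]; exists N => n Nn.
have := uN n Nn; rewrite distrC /= -(@ler_pXn2r _ 2) ?nnegrE ?sqrtr_ge0 //.
by rewrite real_normK ?num_real // sqr_sqrtr // ltW.
Qed.

(** The limit is taken coordinatewise; the distance to it is estimated on finite sets of
    coordinates, where a later term of the sequence can stand for the limit. *)
Lemma psq_complete (u : nat -> ell2 R I) :
  (forall e, 0 < e -> exists N, forall m n, (N <= m)%N -> (N <= n)%N ->
       psq setT (u m - u n) <= e) ->
  exists l, forall e, 0 < e -> exists N, forall n, (N <= n)%N ->
      psq setT (u n - l) <= e.
Proof.
move=> cu.
have /choice[l lP] i : exists l : cplx R, forall e, 0 < e -> exists N, forall n, (N <= n)%N ->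
     sqn (u n i - l) <= e.
  have [e e0|a aP] := @re_cvg (fun n => complex.Re (u n i)).
    have [N uN] := cu e e0; exists N => m n Nm Nn.
    apply: le_trans (uN m n Nm Nn); apply: le_trans (psq_coord _ i).
    rewrite [leRHS]/(sqn (u m i - u n i)); case: (u m i) (u n i) => [? ?] [? ?].
    by rewrite /sqn /= lerDl sqr_ge0.
  have [e e0|b bP] := @re_cvg (fun n => complex.Im (u n i)).
    have [N uN] := cu e e0; exists N => m n Nm Nn.
    apply: le_trans (uN m n Nm Nn); apply: le_trans (psq_coord _ i).
    rewrite [leRHS]/(sqn (u m i - u n i)); case: (u m i) (u n i) => [? ?] [? ?].
    by rewrite /sqn /= lerDr sqr_ge0.
  exists (a +i* b) => e e0.
  have e20 : 0 < e / 2 by rewrite divr_gt0.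
  have [N aN] := aP _ e20; have [N' bN] := bP _ e20.
  exists (maxn N N') => n; rewrite geq_max => /andP[/aN + /bN].
  case: (u n i) => [c d] /=; rewrite /sqn /= => h1 h2; rewrite (splitr e); exact: lerD.
have fin (X : seq I) (e : R) : 0 < e -> exists N, forall n, (N <= n)%N ->
    \sum_(i <- X) sqn (u n i - l i) <= e.
  elim: X e => [|i X IH] e e0; first by exists 0%N => n _; rewrite big_nil ltW.
  have e20 : 0 < e / 2 by rewrite divr_gt0.
  have [N aN] := lP i _ e20; have [N' bN] := IH _ e20.
  exists (maxn N N') => n; rewrite geq_max => /andP[/aN aE /bN bE].
  by rewrite big_cons (splitr e) lerD.
have lim (e : R) : 0 < e -> exists N, forall n, (N <= n)%N ->
    (esq setT (fun i => (u n i - l i)%R) <= e%:E)%E.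
  move=> e0; have e40 : 0 < e / 4 by rewrite divr_gt0.
  have [N uN] := cu _ e40; exists N => n Nn.
  apply: ge_ereal_sup => _ [X [fX _] <-].
  rewrite fsbig_finite //= sumEFin lee_fin.
  have [N' XN] := fin (fset_set X) _ e40.
  pose m := maxn N N'.
  apply: (@le_trans _ _ (\sum_(i <- fset_set X)
     (2 * sqn (u n i - u m i) + 2 * sqn (u m i - l i)))).
    apply: ler_sum => i _; rewrite -mulrDr; apply: le_trans (sqnD_le _ _).
    by rewrite addrA subrK.
  rewrite big_split /= -!mulr_sumr.
  have h1 := XN m (leq_maxr _ _); have h2 := uN n m Nn (leq_maxl _ _).
  have h3 : \sum_(i <- fset_set X) sqn (u n i - u m i) <= psq setT (u n - u m).
    rewrite -lee_fin -esq_fin -sumEFin.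
    apply: ereal_sup_ubound; exists X; first by split.
    by rewrite fsbig_finite.
  lra.
have [N uN] := lim 1 ltr01.
have uNl : (fun i => u N i - l i) \in @ell2_pred R I.
  by apply/asboolP/(le_lt_trans (uN N (leqnn N))); rewrite ltey.
exists (u N - Ell2 uNl) => e /lim[N' N'P]; exists N' => n N'n.
rewrite -lee_fin -esq_fin; have := N'P n N'n.
congr (_ <= _)%E; apply: eq_esum => i _; congr ((sqn _)%:E).
by rewrite [RHS]/(u n i - (u N i - (u N i - l i))) opprB (addrAC (u N i)) subrr add0r.
Qed.

Definition ell2_hilbert : hilbert R :=
  @Hilbert R (ell2 R I) (psq setT) (psq_ge0 setT) psq_eq0 psqZ psq_parallelogram
    psq_polar psq_complete.

End Ell2.

Arguments ell2_hilbert : clear implicits.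

(** * Operators of partial injections *)

Section PartialInjections.
Context {R : realType} {I : choiceType}.
Local Notation H := (ell2_hilbert R I).
Implicit Types (T S : I -> I -> Prop) (x y : H) (i j : I).

Definition partial_inj T : Prop :=
  (forall i j j', T i j -> T i j' -> j = j') /\ (forall i i' j, T i j -> T i' j -> i = i').

Definition rconv T : I -> I -> Prop := fun i j => T j i.

Definition rcomp T S : I -> I -> Prop := fun i j => exists2 k, T i k & S k j.

Lemma rconv_inj T : partial_inj T -> partial_inj (rconv T).
Proof. by case=> Tf Ti; split=> i j k; [exact: Ti|exact: Tf]. Qed.

Lemma rcomp_inj T S : partial_inj T -> partial_inj S -> partial_inj (rcomp T S).
Proof.
move=> [Tf Ti] [Sf Si]; split=> i j k [l Tl Sl] [m Tm Sm].
  by rewrite (Tf _ _ _ Tl Tm) in Sl; exact: Sf Sl Sm.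
by rewrite (Si _ _ _ Sl Sm) in Tl; exact: Ti Tl Tm.
Qed.

(** [T i j] is read from right to left: [T] sends [j] to [i]. *)
Definition partner T i : option I :=
  if pselect (exists j, T i j) is left h then Some (sval (cid h)) else None.

Lemma partnerE T i j : partial_inj T -> T i j -> partner T i = Some j.
Proof.
move=> [Tf _] Tij; rewrite /partner; case: pselect => [h|[]]; last by exists j.
by case: cid => k /= Tik; rewrite (Tf _ _ _ Tij Tik).
Qed.

Lemma partner_none T i : (forall j, ~ T i j) -> partner T i = None.
Proof. by move=> Tn; rewrite /partner; case: pselect => // h; have [j /Tn] := h. Qed.

Definition move_fun T (x : I -> cplx R) i : cplx R := oapp x 0 (partner T i).

(** Reindexing along the bijection from the domain of [T] to its range. *)
Lemma esq_move T (x : I -> cplx R) : partial_inj T ->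
  esq [set i | exists j, T i j] (move_fun T x) = esq [set j | exists i, T i j] x.
Proof.
move=> hT; rewrite /esq.
have bij : set_bij [set j | exists i, T i j] [set i | exists j, T i j]
    (fun j => odflt j (partner (rconv T) j)).
  have e i j : T i j -> partner (rconv T) j = Some i.
    by move=> Tij; apply: partnerE => //; exact: rconv_inj.
  split=> [j [i Tij]|j j'|i [j Tij]] /=.
  - by rewrite (e _ _ Tij); exists j.
  - rewrite !inE => -[i Tij] [i' Tij']; rewrite (e _ _ Tij) (e _ _ Tij') /= => ii'.
    by have [Tf _] := hT; rewrite -ii' in Tij'; exact: Tf Tij Tij'.
  - by exists j; [exists i|rewrite /= (e _ _ Tij)].
rewrite (reindex_esum _ _ _ _ bij); apply: eq_esum => j [i Tij].
rewrite (@partnerE (rconv T) j i) //=; last exact: rconv_inj.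
by rewrite /move_fun (partnerE hT Tij).
Qed.

Lemma move_funP T x : partial_inj T -> move_fun T x \in @ell2_pred R I.
Proof.
move=> hT; apply/asboolP.
rewrite /esq (esumID [set i | exists j, T i j]); last first.
  by move=> i _; rewrite lee_fin sqn_ge0.
rewrite [X in (_ + X)%E]esum1 ?adde0; last first.
  move=> i [_ Ti]; rewrite /move_fun partner_none /= ?sqn0 // => j Tij.
  by apply: Ti; exists j.
by rewrite setTI -[X in (X < _)%E]/(esq _ _) esq_move // esq_fin ltey.
Qed.

(** The zero map stands for relations that are not partial injections, so that families
    of relations give families of operators without carrying proofs. *)
Definition move_op T (x : H) : H :=
  if pselect (partial_inj T) is left hT then Ell2 (move_funP x hT) else 0.

Lemma move_opK T x : partial_inj T -> (move_op T x : ell2 R I) = move_fun T x :> (I -> cplx R).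
Proof. by move=> hT; rewrite /move_op; case: pselect => // h; case: (h hT). Qed.

Lemma move_opE T x i j : partial_inj T -> T i j -> (move_op T x : ell2 R I) i = (x : ell2 R I) j.
Proof.
move=> hT Tij; rewrite /move_op; case: pselect => // h.
by rewrite /= /move_fun (partnerE hT Tij).
Qed.

Lemma move_op0 T x i : (forall j, ~ T i j) -> (move_op T x : ell2 R I) i = 0.
Proof.
by move=> Tn; rewrite /move_op; case: pselect => // h; rewrite /= /move_fun partner_none.
Qed.

Lemma psq_move T x : partial_inj T ->
  psq [set i | exists j, T i j] (move_op T x) = psq [set j | exists i, T i j] x.
Proof.
by move=> hT; rewrite /psq move_opK // esq_move.
Qed.

(** On the range of [T] the two polarised sums are reindexed over the domain; outside the
    range, respectively the domain, one of the two vectors vanishes. *)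
Lemma hdot_move T x y : partial_inj T ->
  hdot (move_op T x) y = hdot x (move_op (rconv T) y).
Proof.
move=> hT; have hT' := rconv_inj hT.
suff : hsq (move_op T x + y) + hsq (x - move_op (rconv T) y) =
       hsq (move_op T x - y) + hsq (x + move_op (rconv T) y) by rewrite /hdot; lra.
pose ran := [set i | exists j, T i j]; pose dom := [set j | exists i, T i j].
rewrite /hsq /= !(psqID ran (move_op T x + _)) !(psqID dom (x + _)).
have e1 (s : R) : s ^+ 2 = 1 ->
    psq ran (move_op T x + s%:C *: y) = psq dom (x + s%:C *: move_op (rconv T) y).
  move=> s2; rewrite -(psq_move _ hT); apply: eq_psq => i [j Tij].
  rewrite (move_opE _ hT Tij) !ell2DE !ell2ZE (move_opE _ hT Tij).
  by rewrite (move_opE y hT' (Tij : rconv T j i)).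
have e2 : psq ran (move_op T x + y) = psq dom (x + move_op (rconv T) y).
  by have := e1 1; rewrite !scale1r; apply; rewrite expr1n.
have e3 : psq ran (move_op T x - y) = psq dom (x - move_op (rconv T) y).
  by have := e1 (- 1); rewrite !rmorphN !scaleN1r; apply; rewrite sqrrN expr1n.
have e4 : psq (~` ran) (move_op T x + y) = psq (~` ran) (move_op T x - y).
  apply: eq_psq => i nran; rewrite !ell2DE ell2NE move_op0 ?add0r ?sqnN // => j Tij.
  by apply: nran; exists j.
have e5 : psq (~` dom) (x + move_op (rconv T) y) = psq (~` dom) (x - move_op (rconv T) y).
  apply: eq_psq => i ndom; rewrite !ell2DE ell2NE move_op0 ?oppr0 // => j Tij.
  by apply: ndom; exists j.
lra.
Qed.

Lemma move_op_key T : move_op T \in @bop_pred R H.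
Proof.
have [hT|nT] := pselect (partial_inj T); last first.
  rewrite (_ : move_op T = 0) ?rpred0 //; apply/funext => x.
  by rewrite /move_op; case: pselect.
have lin S (k : cplx R) x : partial_inj S -> move_op S (k *: x) = k *: move_op S x.
  move=> hS; apply: ell2_ext => i; rewrite ell2ZE.
  have [[j Sij]|nS] := pselect (exists j, S i j); first by rewrite !(move_opE _ hS Sij).
  by rewrite !move_op0 ?mulr0 // => j Sij; apply: nS; exists j.
have bd S x : partial_inj S -> hnorm (move_op S x) <= 1 * hnorm x.
  move=> hS; rewrite mul1r /hnorm ler_sqrt ?hsq_ge0 // /hsq /=.
  apply: le_trans (psq_sub [set j | exists i, S i j] x); rewrite -psq_move //.
  rewrite (psqID [set i | exists j, S i j]) gerDl.
  rewrite (@eq_psq _ _ _ _ 0) /psq; last first.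
    by move=> i nS; rewrite move_op0 // => j Sij; apply: nS; exists j.
  by rewrite /esq esum1 // => i _; rewrite sqn0.
have hT' := rconv_inj hT.
apply/asboolP; exists 1, (move_op (rconv T)); split=> //; split=> // *.
- exact: lin.
- exact: lin.
- exact: hdot_move.
- exact: bd.
- exact: bd.
Qed.

Definition pop T : bop_cstar H := Bop (move_op_key T).

Definition coord (x : H) i : cplx R := (x : ell2 R I) i.

Lemma popE T x i j : partial_inj T -> T i j -> coord (pop T x) i = coord x j.
Proof. exact: move_opE. Qed.

Lemma pop0 T x i : (forall j, ~ T i j) -> coord (pop T x) i = 0.
Proof. exact: move_op0. Qed.

Lemma coord_ext x y : (forall i, coord x i = coord y i) -> x = y.
Proof. exact: ell2_ext. Qed.

Lemma pop_star T : partial_inj T -> star (pop T) = pop (rconv T).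
Proof. by move=> hT; apply: bop_star_uniq => x y; exact: hdot_move. Qed.

Lemma pop_mul T S : partial_inj T -> partial_inj S -> pop T ** pop S = pop (rcomp T S).
Proof.
move=> hT hS; apply: bop_ext => x; apply: coord_ext => i.
change (coord (pop T (pop S x)) i = coord (pop (rcomp T S) x) i).
have hTS := rcomp_inj hT hS.
have [[k Tik]|nT] := pselect (exists j, T i j); last first.
  rewrite (@pop0 T) => [|j Tij]; last by apply: nT; exists j.
  by rewrite (@pop0 (rcomp T S)) // => j [k Tik _]; apply: nT; exists k.
rewrite (popE _ hT Tik).
have [[j Skj]|nS] := pselect (exists j, S k j).
  by rewrite (popE _ hS Skj) (@popE _ _ _ j) //; exists k.
rewrite (@pop0 S) => [|j Skj]; last by apply: nS; exists j.
rewrite (@pop0 (rcomp T S)) // => j [k' Tik' Skj]; apply: nS; exists j.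
by have [Tf _] := hT; rewrite (Tf _ _ _ Tik Tik').
Qed.

Lemma coordD (A B : bop_cstar H) x i : coord ((A + B) x) i = coord (A x) i + coord (B x) i.
Proof.
have -> : (A + B) x = A x + B x by exact: (bopDE (A : bop H) B x).
exact: (ell2DE (A x : ell2 R I) (B x)).
Qed.

Lemma coord0 x i : coord ((0 : bop_cstar H) x) i = 0.
Proof. by []. Qed.

Lemma coord_sum (J : finType) (P : pred J) (F : J -> bop_cstar H) x i :
  coord ((\sum_(a | P a) F a) x) i = \sum_(a | P a) coord (F a x) i.
Proof.
apply: (big_morph (fun A : bop_cstar H => coord (A x) i)) => [A B|].
  exact: coordD.
exact: coord0.
Qed.

Lemma pop_sum (J : finType) (P : pred J) T (F : J -> I -> I -> Prop) :
  partial_inj T -> (forall a, P a -> partial_inj (F a)) ->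
  (forall i j, T i j <-> exists2 a, P a & F a i j) ->
  (forall a b i j k, P a -> P b -> F a i j -> F b i k -> a = b) ->
  pop T = \sum_(a | P a) pop (F a).
Proof.
move=> hT hF TF dF; apply: bop_ext => x; apply: coord_ext => i; rewrite coord_sum.
have [[j Tij]|nT] := pselect (exists j, T i j); last first.
  rewrite pop0 => [|j Tij]; last by apply: nT; exists j.
  rewrite big1 // => a Pa; rewrite pop0 // => j Fj; apply: nT; exists j.
  by apply/TF; exists a.
have /TF[a Pa Fa] := Tij.
rewrite (popE _ hT Tij) (bigD1 a) //= (popE _ (hF _ Pa) Fa) big1 ?addr0 // => b /andP[Pb ba].
rewrite pop0 // => k Fbk; move: ba; rewrite (dF _ _ _ _ _ Pb Pa Fbk Fa) eqxx //.
Qed.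

Lemma pop_empty T : (forall i j, ~ T i j) -> pop T = 0.
Proof. by move=> nT; apply: bop_ext => x; apply: coord_ext => i; rewrite pop0. Qed.

Definition rdiag (A : set I) : I -> I -> Prop := fun i j => i = j /\ A i.

Lemma rdiag_inj A : partial_inj (rdiag A).
Proof. by split=> [i j k [<- _] [<- _]|i j k [-> _] [-> _]]. Qed.

Lemma rel_ext T S : (forall i j, T i j <-> S i j) -> T = S.
Proof. by move=> TS; apply/funext => i; apply/funext => j; apply/propext. Qed.

End PartialInjections.

(** * Tuples and arrows of the canonical sequence *)

Section Partition.
Context {G : bipGraph}.
Implicit Types (x y : bE G) (u : bV0 G) (X : {set bE G}).

Lemma mem_part x : x \in part x.
Proof.
have /and3P[/eqP cov _ _] := bCP (br x).
by rewrite finset.mem_pblock cov !inE.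
Qed.

Lemma bC_br u X x : X \in bC u -> x \in X -> br x = u.
Proof.
move=> XC xX; have /and3P[/eqP cov _ _] := bCP u.
have : x \in finset.cover (bC u) by apply/finset.bigcupP; exists X.
by rewrite cov inE => /eqP.
Qed.

Lemma bC_part u X x : X \in bC u -> x \in X -> part x = X.
Proof.
move=> XC xX; have /and3P[_ trv _] := bCP u.
by rewrite /part (bC_br XC xX) (finset.def_pblock trv XC xX).
Qed.

Lemma bC_neq0 u X : X \in bC u -> exists x, x \in X.
Proof.
move=> XC; have /and3P[_ _ n0] := bCP u; apply/finset.set0Pn.
by apply: contraNneq n0 => <-.
Qed.

Lemma prodset_some (P : {set {set bE G}}) z X : z \in prodset P -> X \in P ->
  exists2 x, z X = Some x & x \in X.
Proof.
rewrite !inE => /pfamilyP[_ zP] /zP; rewrite inE.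
by case: (z X) => [x|] //= xX; exists x.
Qed.

Lemma prodset_none (P : {set {set bE G}}) z X : z \in prodset P -> X \notin P -> z X = None.
Proof.
rewrite !inE => /pfamilyP[zP _]; apply: contraNeq => zX.
by apply: (fintype.subsetP zP); rewrite inE.
Qed.

Lemma prodsetP (P : {set {set bE G}}) (z : {ffun {set bE G} -> option (bE G)}) :
  (forall X, X \in P -> exists2 x, z X = Some x & x \in X) ->
  (forall X, X \notin P -> z X = None) -> z \in prodset P.
Proof.
move=> zS zN; rewrite !inE; apply/pfamilyP; split.
  apply/fintype.subsetP => X; rewrite inE; apply: contraR => /zN ->.
  by rewrite eqxx.
by move=> X /zS[x zx xX]; rewrite inE zx.
Qed.

Lemma prodset_eq (P : {set {set bE G}}) z z' : z \in prodset P -> z' \in prodset P ->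
  (forall X, X \in P -> z X = z' X) -> z = z'.
Proof.
move=> zP z'P zz'; apply/ffunP => X; have [/zz' //|XP] := boolP (X \in P).
by rewrite (prodset_none zP XP) (prodset_none z'P XP).
Qed.

(** [tbase v] and [tent v X] are the vertex and the entry in [X] of the tuple [v];
    [atup a] and [aent a] are the tuple and the distinguished entry of the arrow [a]. *)
Definition tbase (v : nextV1 G) : bV0 G := (val v).1.
Definition tent (v : nextV1 G) (X : {set bE G}) : option (bE G) := (val v).2 X.
Definition atup (a : nextE G) : nextV1 G := (val a).1.
Definition aent (a : nextE G) : bE G := (val a).2.

Lemma tent_some (v : nextV1 G) X : X \in bC (tbase v) -> exists2 x, tent v X = Some x & x \in X.
Proof. exact: prodset_some (valP v). Qed.

Lemma tent_none (v : nextV1 G) X : X \notin bC (tbase v) -> tent v X = None.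
Proof. exact: prodset_none (valP v). Qed.

Lemma tent_mem (v : nextV1 G) X x : tent v X = Some x ->
  [/\ X \in bC (tbase v), x \in X, br x = tbase v & part x = X].
Proof.
move=> vx; have XC : X \in bC (tbase v).
  by apply/negP => /negP /tent_none; rewrite vx.
have [x'] := tent_some XC; rewrite vx => -[<-] xX.
by rewrite (bC_br XC xX) (bC_part XC xX).
Qed.

Lemma tuple_ext (v v' : nextV1 G) : tbase v = tbase v' ->
  (forall X, X \in bC (tbase v) -> tent v X = tent v' X) -> v = v'.
Proof.
move=> e1 e2; apply: val_inj; rewrite (surjective_pairing (val v)).
rewrite [RHS]surjective_pairing -[(val v').1]e1; congr pair.
by apply: (prodset_eq (valP v)) => //; rewrite [(val v).1]e1; exact: (valP v').
Qed.

Lemma tuple_key u (z : {set bE G} -> option (bE G)) :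
  (forall X, X \in bC u -> exists2 x, z X = Some x & x \in X) ->
  exists v : nextV1 G, tbase v = u /\ forall X, X \in bC u -> tent v X = z X.
Proof.
move=> zS; pose z' := [ffun X : {set bE G} => if X \in bC u then z X else None].
have zin : (u, z').2 \in prodset (bC (u, z').1).
  apply: prodsetP => X XC /=; first by rewrite ffunE XC; exact: zS.
  by rewrite ffunE (negPf XC).
by exists (exist _ (u, z') zin); split=> // X XC; rewrite /tent /= ffunE XC.
Qed.

Lemma aentP (a : nextE G) : tent (atup a) (part (aent a)) = Some (aent a).
Proof. exact/eqP/(valP a). Qed.

Lemma arrow_key (v : nextV1 G) x : tent v (part x) = Some x ->
  exists a : nextE G, atup a = v /\ aent a = x.
Proof. by move/eqP => vx; exists (exist _ (v, x) vx). Qed.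

Lemma arrow_ext (a b : nextE G) : atup a = atup b -> aent a = aent b -> a = b.
Proof.
move=> e1 e2; apply: val_inj; rewrite (surjective_pairing (val a)) [RHS]surjective_pairing.
by rewrite [(val a).1]e1 [(val a).2]e2.
Qed.

Lemma aent_br (a : nextE G) : br (aent a) = tbase (atup a).
Proof. by have [] := tent_mem (aentP a). Qed.

Lemma nextXE (a : nextE G) x : (a \in nextX x) = (aent a == x).
Proof. by rewrite inE. Qed.

End Partition.

Section NextPartition.
Context {G : bipGraph}.

(** The colours at a vertex [w] of the next graph are indexed by the arrows that start at [w]. *)
Lemma nextXP (w : bV1 G) X :
  reflect (exists2 x, bs x = w & X = nextX x) (X \in @bC (nextG G) w).
Proof.
by apply: (iffP imsetP) => -[x]; rewrite ?inE => xw ->; exists x; rewrite ?inE //; apply/eqP.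
Qed.

Lemma part_next (a : nextE G) : part (a : bE (nextG G)) = nextX (aent a).
Proof.
apply: (@bC_part (nextG G) (bs (aent a))); last by rewrite nextXE.
by apply/nextXP; exists (aent a).
Qed.

End NextPartition.

(** * Set representations of separated graphs *)

Section SetRepresentation.
Context {I : choiceType}.

(** The relations of a separated graph, read in the inverse semigroup of partial
    injections of a set [I]. *)
Record set_rep (G : sepGraph) (p : vertex G -> set I) (t : arrow G -> I -> I -> Prop) : Prop := {
  rep_disj : forall v v' i, p v i -> p v' i -> v = v';
  rep_inj : forall e, partial_inj (t e);
  rep_src : forall e i j, t e i j -> p (src e) j;
  rep_rng : forall e i j, t e i j -> p (rng e) i;
  rep_tot : forall e j, p (src e) j -> exists i, t e i j;
  rep_cov : forall v (X : {set arrow G}) i, X \in colours v -> p v i ->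
    exists2 e, e \in X & exists j, t e i j;
  rep_col : forall v (X : {set arrow G}) e e' i j j', X \in colours v -> e \in X -> e' \in X ->
    t e i j -> t e' i j' -> e = e'
}.

Section Operators.
Context (R : realType) (G : sepGraph) (p : vertex G -> set I) (t : arrow G -> I -> I -> Prop).

Definition rep_v (v : vertex G) : bop_cstar (ell2_hilbert R I) := pop (rdiag (p v)).
Definition rep_e (e : arrow G) : bop_cstar (ell2_hilbert R I) := pop (t e).

(** Products, adjoints and orthogonal sums of partial injections are computed on relations. *)
Lemma rep_graph_relations : set_rep p t -> graph_relations rep_v rep_e.
Proof.
move=> rep; have dI v := rdiag_inj (p v); have tI := rep_inj rep.
split.
- split=> [v v'|v]; rewrite /rep_v.
    rewrite pop_mul //; case: eqVneq => [<-|vv'].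
      congr pop; apply: rel_ext => i j; split=> [[k [-> pv] [-> _]]|[-> pv]] //.
      by exists j.
    apply: pop_empty => i j [k [-> pv] [_ pv']].
    by move: vv'; rewrite (rep_disj rep pv pv') eqxx.
  by rewrite pop_star //; congr pop; apply: rel_ext => i j; split=> -[-> ?].
- move=> e; rewrite /rep_v /rep_e !pop_mul //; split; congr pop; apply: rel_ext => i j.
    split=> [[k [-> _]] //|te]; exists i => //; split=> //; exact: rep_rng rep _ _ _ te.
  split=> [[k te [<- _]] //|te]; exists j => //; split=> //; exact: rep_src rep _ _ _ te.
- move=> v X XC e e' eX e'X; rewrite /rep_v /rep_e pop_star // pop_mul //; last exact: rconv_inj.
  case: eqVneq => [<-|ee']; last first.
    apply: pop_empty => i j [k te te']; move: ee'.
    by rewrite (rep_col rep XC eX e'X te te') eqxx.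
  congr pop; apply: rel_ext => i j; split=> [[k te te']|[-> pj]].
    have [Tf _] := tI e; rewrite (Tf _ _ _ te te'); split=> //.
    exact: rep_src rep _ _ _ te'.
  by have [k te] := rep_tot rep pj; exists k.
- move=> v X XC; rewrite /rep_v.
  rewrite (@pop_sum _ _ _ (mem X) (rdiag (p v)) (fun e => rcomp (t e) (rconv (t e)))) //.
  + by apply: eq_bigr => e _; rewrite pop_star // pop_mul //; exact: rconv_inj.
  + by move=> e _; apply: rcomp_inj => //; exact: rconv_inj.
  + move=> i j; split=> [[-> pv]|[e eX [k te te']]].
      by have [e eX [k te]] := rep_cov rep XC pv; exists e => //; exists k.
    have [_ Ti] := tI e; rewrite (Ti _ _ _ te te'); split=> //.
    have := rep_rng rep te'; have /and3P[/eqP cov _ _] := coloursP v.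
    have : e \in finset.cover (colours v) by apply/finset.bigcupP; exists X.
    by rewrite cov inE => /eqP ->.
  + move=> e e' i j k eX e'X [l te _] [l' te' _]; exact: rep_col rep _ _ _ _ _ _ _ XC eX e'X te te'.
Qed.

End Operators.

Section Next.
Context (G : bipGraph) (p : vertex G -> set I) (t : arrow G -> I -> I -> Prop).

(** The points over a tuple are those in the range of all its entries. *)
Definition next_p (v : vertex (nextG G)) : set I :=
  match v with
  | inl w => p (inr w)
  | inr v => [set i | p (inl (tbase v)) i /\
      forall X x, tent v X = Some x -> exists j, t x i j]
  end.

(** An arrow of the next graph acts as the inverse of its entry, on the points over its tuple. *)
Definition next_t (a : nextE G) : I -> I -> Prop :=
  fun i j => t (aent a) j i /\ next_p (inr (atup a)) j.

Hypothesis rep : set_rep p t.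

(** By the covering condition, some arrow of each colour at [u] has the point in its range. *)
Lemma rep_tuple u i : p (inl u) i -> exists2 v : nextV1 G, tbase v = u & next_p (inr v) i.
Proof.
move=> pu; pose z := fun X : {set bE G} => [pick x in X | `[< exists j, t x i j >]].
have zP X : X \in bC u -> exists2 x, z X = Some x & x \in X /\ exists j, t x i j.
  move=> XC; rewrite /z; case: pickP => [x /andP[xX /asboolP tx]|no].
    by exists x.
  have [x xX tx] := @rep_cov _ _ _ rep (inl u) X i XC pu.
  by move: (no x); rewrite xX /= => /asboolP.
have [X /zP[x zx []]|v [vu vz]] := @tuple_key G u z; first by exists x.
exists v => //; split; first by rewrite vu.
move=> X x vx; have [XC _ _ _] := tent_mem vx; rewrite vu in XC.
by have [x'] := zP X XC; rewrite -vz // vx => -[<-] [].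
Qed.

Lemma rep_tuple_uniq (v v' : nextV1 G) i : next_p (inr v) i -> next_p (inr v') i -> v = v'.
Proof.
move=> [pv tv] [pv' tv']; have [e1] := rep_disj rep pv pv'.
apply: tuple_ext => // X XC; have [x vx xX] := tent_some XC.
have [x' vx' x'X] : exists2 x, tent v' X = Some x & x \in X by apply: tent_some; rewrite -e1.
have [[j tx] [j' tx']] := (tv _ _ vx, tv' _ _ vx').
by rewrite vx vx' (@rep_col _ _ _ rep (inl (tbase v)) X x x' i j j').
Qed.

(** For the covering condition at [w], send a point by [x] and take the tuple under its
    image: its entry in the colour of [x] is [x]. *)
Lemma next_set_rep : @set_rep (nextG G) next_p next_t.
Proof.
have tI := rep_inj rep.
split.
- move=> [w|v] [w'|v'] i /=.
  + by move=> pw pw'; have [->] := rep_disj rep pw pw'.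
  + by move=> pw [pv _]; have := rep_disj rep pw pv.
  + by move=> [pv _] pw; have := rep_disj rep pw pv.
  + by move=> h h'; rewrite (@rep_tuple_uniq v v' i).
- move=> a; have [Tf Ti] := tI (aent a); split=> i j k [ta _] [tb _].
    exact: Ti ta tb.
  exact: Tf ta tb.
- by move=> a i j [_ h]; exact: h.
- by move=> a i j [ta _]; exact: (rep_src rep ta).
- move=> a j pj; have [_ tj] := pj.
  by have [i ta] := tj _ _ (aentP a); exists i.
- move=> [w|v] X i; last by rewrite inE.
  move=> /nextXP[x <- ->] pi; have [j tx] := @rep_tot _ _ _ rep x i pi.
  have [v vx vj] := rep_tuple (rep_rng rep tx).
  have [y vy yp] : exists2 y, tent v (part x) = Some y & y \in part x.
    by apply: tent_some; rewrite vx part_in.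
  have [_ /(_ _ _ vy)[k ty]] := vj.
  have yx : y = x.
    exact: (@rep_col _ _ _ rep (inl (br x)) _ y x j k i (part_in x) yp (mem_part x)).
  rewrite yx in vy; have [a [av ax]] := arrow_key vy.
  by exists a; [rewrite nextXE ax|exists j; rewrite /next_t ax av].
- move=> [w|v] X a b i j k; last by rewrite inE.
  move=> /nextXP[x _ ->]; rewrite !nextXE => /eqP ax /eqP bx [ta pa] [tb pb].
  apply: arrow_ext; last by rewrite ax.
  rewrite ax in ta; rewrite bx in tb; have [_ Ti] := tI x.
  by apply: rep_tuple_uniq pa _; rewrite (Ti _ _ _ ta tb).
Qed.

Context {R : realType}.

(** The two splittings are the formulas that define the canonical maps. *)
Lemma rep_v_split (u : bV0 G) : rep_v R p (inl u) =
  \sum_(v : nextV1 G | tbase v == u) @rep_v R (nextG G) next_p (inr v).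
Proof.
rewrite /rep_v; apply: pop_sum => [|v _|i j|v v' i j k _ _ [_ vi] [_ vi']].
- exact: rdiag_inj.
- exact: rdiag_inj.
- split=> [[-> pu]|[v /eqP <- [-> [pv _]]]] //.
  by have [v vu vj] := rep_tuple pu; exists v => //; apply/eqP.
- exact: rep_tuple_uniq vi vi'.
Qed.

Lemma rep_e_split (x : bE G) :
  rep_e R t x = \sum_(a in nextX x) star (@rep_e R (nextG G) next_t a).
Proof.
have nI := rep_inj next_set_rep; have tI := rep_inj rep.
rewrite (eq_bigr (fun a => pop (rconv (next_t a)))); last first.
  by move=> a _; apply: pop_star; exact: nI.
apply: pop_sum => [|a _|i j|a b i j k].
- exact: tI.
- by apply: rconv_inj; exact: nI.
- split=> [tx|[a]]; last by rewrite nextXE => /eqP <- [].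
  have [||a ax [k [ta pa]]] := @rep_cov _ _ _ next_set_rep (inl (bs x)) (nextX x) j.
  + by apply/nextXP; exists x.
  + exact: (@rep_src _ _ _ rep x i j tx).
  + exists a => //; rewrite /rconv /next_t; move: ax; rewrite nextXE => /eqP ax.
    by rewrite ax in ta *; have [_ Ti] := tI x; rewrite (Ti _ _ _ tx ta).
- rewrite !nextXE => /eqP ax /eqP bx [_ pa] [_ pb].
  apply: arrow_ext; last by rewrite ax.
  exact: rep_tuple_uniq pa pb.
Qed.

End Next.

Section Canonical.
Context (G : bipGraph) (p : vertex G -> set I) (t : arrow G -> I -> I -> Prop).

(** One set carries representations of all graphs of the canonical sequence. *)
Fixpoint canon_rep n : (vertex (canon G n) -> set I) * (arrow (canon G n) -> I -> I -> Prop) :=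
  if n is n'.+1 then (next_p (canon_rep n').1 (canon_rep n').2, next_t (canon_rep n').1 (canon_rep n').2)
  else (p, t).

Lemma canon_set_rep n : set_rep p t -> set_rep (canon_rep n).1 (canon_rep n).2.
Proof. by move=> rep; elim: n => //= n IH; exact: next_set_rep. Qed.

End Canonical.
End SetRepresentation.

(** * Norm estimates in C*-algebras *)

Section CstarNorm.
Context {R : realType} {A : cstarAlg R}.
Implicit Types a b c : A.

Definition nrm a : R := complex.Re `|a|.

Lemma nrmE a : `|a| = (nrm a)%:C.
Proof. by rewrite /nrm RRe_real // normr_real. Qed.

Lemma nrm_ge0 a : 0 <= nrm a.
Proof. by have := normr_ge0 a; rewrite nrmE ler0c. Qed.

Lemma nrmD a b : nrm (a + b) <= nrm a + nrm b.
Proof. by have := ler_normD a b; rewrite !nrmE -rmorphD lecR. Qed.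

Lemma nrmN a : nrm (- a) = nrm a. Proof. by rewrite /nrm normrN. Qed.

Lemma nrmB a b : nrm (a - b) = nrm (b - a). Proof. by rewrite /nrm distrC. Qed.

Lemma nrm_eq0 a : nrm a = 0 -> a = 0.
Proof. by move=> a0; apply/eqP; rewrite -normr_eq0 nrmE a0. Qed.

Lemma nrm0 : nrm (0 : A) = 0. Proof. by rewrite /nrm normr0. Qed.

Lemma nrmZ (k : cplx R) a : nrm (k *: a) = complex.Re `|k| * nrm a.
Proof. by rewrite {1}/nrm normrZ nrmE -{1}(ReN k) -rmorphM. Qed.

Lemma nrmZR (r : R) a : 0 <= r -> nrm ((r%:C : cplx R) *: a) = r * nrm a.
Proof. by move=> r0; rewrite nrmZ ger0_norm // ler0c. Qed.

Lemma nrmM a b : nrm (a ** b) <= nrm a * nrm b.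
Proof. by have := normM_le a b; rewrite !nrmE -rmorphM lecR. Qed.

Lemma nrm_starM a : nrm (star a ** a) = nrm a ^+ 2.
Proof. by rewrite {1}/nrm norm_starM nrmE -rmorphXn. Qed.

Lemma nrm_star a : nrm (star a) = nrm a.
Proof.
have le b : nrm b <= nrm (star b).
  have [->|b0] := eqVneq (nrm b) 0; first exact: nrm_ge0.
  have bp : 0 < nrm b by rewrite lt_def b0 nrm_ge0.
  by rewrite -(ler_pM2r bp) -expr2 -nrm_starM nrmM.
by apply/le_anti; rewrite le andbT -[leRHS](congr1 nrm (starK a)) le.
Qed.

Lemma smul0l a : 0 ** a = 0.
Proof. by have := smulZl 0 (0 : A) a; rewrite !scale0r. Qed.

Lemma smul0r a : a ** 0 = 0.
Proof. by have := smulZr 0 a (0 : A); rewrite !scale0r. Qed.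

Lemma smulNl a b : (- a) ** b = - (a ** b).
Proof. by rewrite -scaleN1r smulZl scaleN1r. Qed.

Lemma smulNr a b : a ** (- b) = - (a ** b).
Proof. by rewrite -scaleN1r smulZr scaleN1r. Qed.

Lemma smulBl a b c : (a - b) ** c = a ** c - b ** c.
Proof. by rewrite smulDl smulNl. Qed.

Lemma smulBr a b c : a ** (b - c) = a ** b - a ** c.
Proof. by rewrite smulDr smulNr. Qed.

Lemma star0 : star (0 : A) = 0.
Proof. by have := starZ 0 (0 : A); rewrite !scale0r conjc0 scale0r. Qed.

Lemma starN a : star (- a) = - star a.
Proof. by rewrite -scaleN1r starZ rmorphN rmorph1 scaleN1r. Qed.

Lemma starB a b : star (a - b) = star a - star b.
Proof. by rewrite starD starN. Qed.

Lemma smul_suml (J : Type) (r : seq J) (P : pred J) (F : J -> A) a :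
  (\sum_(j <- r | P j) F j) ** a = \sum_(j <- r | P j) F j ** a.
Proof.
by apply: (big_morph (fun b => b ** a)) => [b c|]; rewrite ?smulDl ?smul0l.
Qed.

Lemma smul_sumr (J : Type) (r : seq J) (P : pred J) (F : J -> A) a :
  a ** (\sum_(j <- r | P j) F j) = \sum_(j <- r | P j) a ** F j.
Proof.
by apply: (big_morph (fun b => a ** b)) => [b c|]; rewrite ?smulDr ?smul0r.
Qed.

Lemma star_sum (J : Type) (r : seq J) (P : pred J) (F : J -> A) :
  star (\sum_(j <- r | P j) F j) = \sum_(j <- r | P j) star (F j).
Proof. exact: (big_morph _ (@starD R A) star0). Qed.

(** Closedness in the norm, with real bounds. *)
Lemma closedP (S : set A) : closed S <->
  forall l, (forall e, 0 < e -> exists2 a, S a & nrm (a - l) <= e) -> S l.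
Proof.
split=> [Sc l Sl|Sl l cl].
  apply: Sc => U /nbhs_ballP[e e0 eU]; have eE : e = (complex.Re e)%:C.
    by rewrite RRe_real // gtr0_real.
  have re0 : 0 < complex.Re e by move: (e0 : 0 < e); rewrite eE ltcR.
  have [a Sa al] := Sl (complex.Re e / 2) (divr_gt0 re0 (ltr0Sn _ 1)).
  exists a; split=> //; apply: eU; rewrite -ball_normE /= eE nrmE ltcR nrmB.
  by rewrite (le_lt_trans al) // ltr_pdivrMr // ltr_pMr // ltr1n.
apply: Sl => e e0; have [|a [Sa]] := cl (ball l (e%:C : cplx R)).
  by apply: nbhsx_ballx; rewrite ltcR.
by rewrite -ball_normE /= nrmE ltcR nrmB => /ltW ale; exists a.
Qed.

Definition seq_lim (u : nat -> A) (l : A) : Prop :=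
  forall e, 0 < e -> exists N, forall n, (N <= n)%N -> nrm (u n - l) <= e.

(** The tails are dominated by those of a geometric series. *)
Lemma geometric_cvg (u : nat -> A) (K q : R) : 0 <= K -> 0 <= q -> q < 1 ->
  (forall n, nrm (u n.+1 - u n) <= K * q ^+ n) -> exists l, seq_lim u l.
Proof.
move=> K0 q0 q1 uq; pose C := K / (1 - q).
have C0 : 0 <= C by rewrite divr_ge0 // subr_ge0 ltW.
have KC : K = C * (1 - q) by rewrite /C divfK // subr_eq0 gt_eqF.
have tail n k : nrm (u (n + k)%N - u n) <= C * (q ^+ n * (1 - q ^+ k)).
  elim: k => [|k IH]; first by rewrite addn0 !subrr nrm0 !mulr0.
  rewrite addnS -(subrK (u (n + k)%N) (u (n + k).+1)) -addrA.
  rewrite (le_trans (nrmD _ _)) // (le_trans (lerD (uq _) IH)) // KC exprD exprS.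
  lra.
have qn e : 0 < e -> exists N, C * q ^+ N < e.
  move=> e0; have := @cvg_expr _ q; rewrite ger0_norm // => /(_ q1).
  move/cvgrPdist_lt => /(_ (e / (C + 1))).
  case=> [|N _ NP]; first by rewrite divr_gt0 // ltr_wpDl.
  have := NP N (leqnn N); rewrite /= sub0r normrN ger0_norm ?exprn_ge0 // ltr_pdivlMr ?ltr_wpDl // => h.
  exists N; apply: le_lt_trans h; rewrite mulrC ler_wpM2l ?exprn_ge0 //; lra.
have cu : cvg (u @ \oo).
  apply: seq_cvg_norm => e e0; have eE : e = (complex.Re e)%:C.
    by rewrite RRe_real // gtr0_real.
  have re0 : 0 < complex.Re e by move: e0; rewrite eE ltcR.
  have [N Ne] := qn _ re0; exists N => n Nn; rewrite eE nrmE ltcR nrmB -(subnKC Nn).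
  apply: le_lt_trans (tail _ _) _; apply: le_lt_trans Ne.
  rewrite ler_wpM2l // ler_piMr ?exprn_ge0 // gerBl exprn_ge0 //.
move/cvg_ex : cu => [l ul]; exists l => e e0.
have e1 : (0 : cplx R) < e%:C by rewrite ltcR.
move/cvgrPdist_le : ul => /(_ _ e1)[N _ uN]; exists N => n Nn.
by have := uN n Nn; rewrite nrmE lecR nrmB.
Qed.

Lemma seq_lim_closed (S : set A) u l : closed S -> (forall n, S (u n)) -> seq_lim u l -> S l.
Proof.
by move=> /closedP Sc Su ul; apply: Sc => e /ul[N uN]; exists (u N) => //; exact: uN.
Qed.

Lemma seq_lim_uniq u l l' : seq_lim u l -> seq_lim u l' -> l = l'.
Proof.
move=> ul ul'; apply/eqP; rewrite -subr_eq0; apply/eqP/nrm_eq0/le_anti.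
rewrite nrm_ge0 andbT; apply/ler_addgt0Pr => e e0; rewrite add0r.
have e20 : 0 < e / 2 by rewrite divr_gt0.
have [[N uN] [N' uN']] := (ul _ e20, ul' _ e20); pose n := maxn N N'.
rewrite (_ : l - l' = (u n - l') - (u n - l)); last first.
  by rewrite opprB [RHS]addrC addrA subrK.
rewrite (le_trans (nrmD _ _)) // nrmN (splitr e) lerD //.
  by rewrite uN' // leq_maxr.
by rewrite uN // leq_maxl.
Qed.

Lemma seq_limS u l : seq_lim u l -> seq_lim (fun n => u n.+1) l.
Proof. by move=> ul e /ul[N uN]; exists N => n Nn; rewrite uN // leqW. Qed.

End CstarNorm.

Section Characters.
Context {R : realType} {A : cstarAlg R} (B : set A) (xi : A -> cplx R).
Hypotheses (hB : cstar_subalg B) (hxi : is_character B xi).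

Lemma subalg0 : B 0. Proof. by have [] := hB. Qed.

Lemma subalgZ k a : B a -> B (k *: a).
Proof. by have [B0 Bl _ _ _] := hB; move=> Ba; rewrite -(addr0 (k *: a)); exact: Bl. Qed.

Lemma subalgD a b : B a -> B b -> B (a + b).
Proof. by have [_ Bl _ _ _] := hB; move=> Ba Bb; rewrite -(scale1r a); exact: Bl. Qed.

Lemma subalgN a : B a -> B (- a).
Proof. by rewrite -scaleN1r; exact: subalgZ. Qed.

Lemma subalgM a b : B a -> B b -> B (a ** b).
Proof. by have [_ _ Bm _ _] := hB; exact: Bm. Qed.

Lemma subalg_star a : B a -> B (star a).
Proof. by have [_ _ _ Bs _] := hB; exact: Bs. Qed.

Lemma subalg_sum (J : finType) (P : pred J) (F : J -> A) :
  (forall j, P j -> B (F j)) -> B (\sum_(j | P j) F j).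
Proof. by move=> BF; elim/big_ind: _ => // [|a b]; [exact: subalg0|exact: subalgD]. Qed.

Lemma char0 : xi 0 = 0.
Proof.
have [xiL _ _ _] := hxi; have := xiL 1 0 0 subalg0 subalg0.
by rewrite scaler0 addr0 mul1r => /eqP; rewrite -subr_eq subrr => /eqP <-.
Qed.

Lemma charD a b : B a -> B b -> xi (a + b) = xi a + xi b.
Proof. by have [xiL _ _ _] := hxi; move=> Ba Bb; rewrite -{1}(scale1r a) xiL // mul1r. Qed.

Lemma charZ k a : B a -> xi (k *: a) = k * xi a.
Proof. by have [xiL _ _ _] := hxi; move=> Ba; rewrite -(addr0 (k *: a)) xiL ?char0 ?addr0 //; exact: subalg0. Qed.

Lemma charM a b : B a -> B b -> xi (a ** b) = xi a * xi b.
Proof. by have [_ xiM _ _] := hxi; exact: xiM. Qed.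

Lemma char_out a : ~ B a -> xi a = 0.
Proof. by have [_ _ _] := hxi; apply. Qed.

Lemma char_sum (J : finType) (P : pred J) (F : J -> A) :
  (forall j, P j -> B (F j)) -> xi (\sum_(j | P j) F j) = \sum_(j | P j) xi (F j).
Proof.
move=> BF; pose K a c := B a /\ xi a = c.
suff [] : K (\sum_(j | P j) F j) (\sum_(j | P j) xi (F j)) by [].
apply: (big_ind2 K) => [|a c b d [Ba <-] [Bb <-]|j Pj]; rewrite /K.
- by split; [exact: subalg0|exact: char0].
- by split; [exact: subalgD|exact: charD].
- by split; [exact: BF|].
Qed.

(** If [|a| < |xi a|], rescale to [xi a = 1]; then [b = a + a b] is solvable in the
    subalgebra by the geometric series, and [xi b = 1 + xi b] is absurd. *)
Lemma char_norm a : B a -> `|xi a| <= `|a|.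
Proof.
move=> Ba; rewrite nrmE -ReN lecR leNgt; apply/negP => ax.
have xp : 0 < complex.Re `|xi a| by exact: le_lt_trans (nrm_ge0 _) ax.
have x0 : xi a != 0.
  by apply/negP => /eqP x0; move: xp; rewrite x0 normr0 ltxx.
pose b := (xi a)^-1 *: a; have Bb : B b by exact: subalgZ.
have xb : xi b = 1 by rewrite charZ // mulVf.
have q1 : nrm b < 1.
  rewrite nrmZ normfV -(ReN (xi a)) -fmorphV /= mulrC ltr_pdivrMr //.
  by rewrite mul1r.
pose u := fix u n := if n is n'.+1 then b + b ** u n' else 0.
have Bu n : B (u n).
  by elim: n => [|n IH] /=; [exact: subalg0|apply: subalgD => //; exact: subalgM].
have [l ul] : exists l, seq_lim u l.
  apply: (@geometric_cvg _ _ u (nrm b) (nrm b)) => //; try exact: nrm_ge0.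
  elim=> [|n IH]; first by rewrite /= smul0r addr0 subr0 mulr1.
  rewrite [u n.+2]/= [in X in _ - X]/= opprD addrACA subrr add0r -smulBr.
  by rewrite (le_trans (nrmM _ _)) // exprS ler_wpM2l ?nrm_ge0.
have Bl : B l by apply: seq_lim_closed ul => //; have [] := hB.
have le : l = b + b ** l.
  apply: (seq_lim_uniq (seq_limS ul)) => e e0.
  have [N uN] := ul e e0; exists N => n Nn.
  rewrite [u n.+1]/= opprD addrACA subrr add0r -smulBr (le_trans (nrmM _ _)) //.
  by rewrite (le_trans _ (uN n Nn)) // ler_piMl ?nrm_ge0 // ltW.
have : xi l = 1 + xi l by rewrite {1}le charD ?charM ?xb ?mul1r //; exact: subalgM.
by move/eqP; rewrite -subr_eq subrr eq_sym oner_eq0.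
Qed.

End Characters.

Section StarHom.
Context {R : realType} {A : cstarAlg R} {H : hilbert R} (h : A -> bop_cstar H).
Hypothesis hh : star_hom h.

Lemma homZ k a : h (k *: a) = k *: h a.
Proof.
have [hL _ _] := hh; have h0 : h 0 = 0.
  by have := hL 1 0 0; rewrite scaler0 addr0 scale1r => /eqP; rewrite -subr_eq subrr => /eqP <-.
by rewrite -(addr0 (k *: a)) hL h0 addr0.
Qed.

Lemma homD a b : h (a + b) = h a + h b.
Proof. by have [hL _ _] := hh; rewrite -{1}(scale1r a) hL scale1r. Qed.

Lemma homM a b x : h (a ** b) x = h a (h b x).
Proof. by have [_ hM _] := hh; rewrite hM. Qed.

Lemma hom_star a x y : hdot (h a x) y = hdot x (h (star a) y).
Proof. by have [_ _ hS] := hh; rewrite hS; exact: bop_starE. Qed.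

(** The solution is [1 - sqrt (1 - c)].  It is the limit of the iterates of
    [y |-> (c + y^2) / 2], a contraction of the ball of radius [|c|]. *)
Lemma sqrt_ex (c : A) : nrm c < 1 -> star c = c ->
  exists2 y, star y = y & y + y = c + y ** y.
Proof.
set q := nrm c => q1 cs; have q0 : 0 <= q by exact: nrm_ge0.
pose hf : cplx R := (2^-1 : R)%:C.
pose u := fix u n := if n is n'.+1 then hf *: (c + u n' ** u n') else 0.
have nh a : nrm (hf *: a) = 2^-1 * nrm a by rewrite nrmZR // invr_ge0.
have uq n : nrm (u n) <= q.
  elim: n => [|n IH] /=; first by rewrite nrm0.
  rewrite nh ler_pdivrMl // (le_trans (nrmD _ _)) // mulr2n mulrDl mul1r lerD //.
  rewrite (le_trans (nrmM _ _)) // (le_trans (ler_pM _ _ IH IH)) ?nrm_ge0 //.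
  by rewrite ler_piMr // ltW.
have us n : star (u n) = u n.
  by elim: n => [|n IH] /=; rewrite ?star0 // starZ starD starM IH cs conjc_real.
have step a b : nrm a <= q -> nrm b <= q ->
    nrm (hf *: (c + a ** a) - hf *: (c + b ** b)) <= q * nrm (a - b).
  move=> aq bq; rewrite -scalerBr nh opprD addrACA subrr add0r ler_pdivrMl //.
  have -> : a ** a - b ** b = a ** (a - b) + (a - b) ** b.
    by rewrite smulBr smulBl addrA subrK.
  rewrite (le_trans (nrmD _ _)) //.
  apply: (@le_trans _ _ (q * nrm (a - b) + nrm (a - b) * q)); last by lra.
  by rewrite lerD // (le_trans (nrmM _ _)) // (ler_wpM2r, ler_wpM2l) ?nrm_ge0.
have [y uy] : exists y, seq_lim u y.
  apply: (@geometric_cvg _ _ u q q) => //.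
  elim=> [|n IH]; first by rewrite subr0 mulr1 uq.
  by rewrite (le_trans (step _ _ (uq n.+1) (uq n))) // exprS ler_wpM2l.
have yq : nrm y <= q.
  apply/ler_addgt0Pr => e /uy[N /(_ N (leqnn N)) uN].
  rewrite -(subrK (u N) y) addrC (le_trans (nrmD _ _)) // lerD ?uq //.
  by rewrite nrmB.
have ys : star y = y.
  apply: (seq_lim_uniq _ uy) => e /uy[N uN]; exists N => n Nn.
  by rewrite -us -starB nrm_star uN.
exists y => //; have {1 2}-> : y = hf *: (c + y ** y).
  apply: (seq_lim_uniq (seq_limS uy)) => e /uy[N uN]; exists N => n Nn.
  rewrite (le_trans (step _ _ (uq n) yq)) // (le_trans _ (uN n Nn)) //.
  by rewrite ler_piMl ?nrm_ge0 // ltW.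
rewrite -scalerDl -rmorphD (_ : 2^-1 + 2^-1 = 1 :> R) ?scale1r //.
by rewrite [RHS](splitr 1) mul1r.
Qed.

(** A representation by bounded operators is contractive: for [|a| < 1] the element
    [a^* a] is [2 y - y^2] with [y] self-adjoint, so that
    [|a x|^2 = <a^* a x, x> = |x|^2 - |x - y x|^2]. *)
Lemma hom_norm a x : hnorm (h a x) <= nrm a * hnorm x.
Proof.
have lt1 b : nrm b < 1 -> hnorm (h b x) <= hnorm x.
  move=> b1; have [||y ys yE] := @sqrt_ex (star b ** b).
  - by rewrite nrm_starM expr_lt1 ?nrm_ge0.
  - by rewrite starM starK.
  rewrite /hnorm ler_sqrt ?hsq_ge0 // -(ler_pM2l (ltr0Sn R 3)) -!hdotxx.
  rewrite hom_star -homM (_ : star b ** b = y + y - y ** y); last first.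
    by rewrite yE addrK.
  have hN c z : h (- c) z = - h c z by have := homZ (- 1) c; rewrite !scaleN1r => ->.
  rewrite homD bopDE homD bopDE hN homM hdotDr hdotNr hdotDr.
  have -> : hdot x (h y (h y x)) = hdot (h y x) (h y x) by rewrite hom_star ys.
  have := hsq_ge0 (x - h y x); rewrite -(pmulr_rge0 _ (ltr0Sn R 3)) -hdotxx.
  rewrite hdotDl !hdotDr !hdotNl !hdotNr (hdotC (h y x) x).
  lra.
have a0 := nrm_ge0 a.
(* Rescaling by [t > nrm a], with [t * hnorm x <= nrm a * hnorm x + e]. *)
apply/ler_addgt0Pr => e e0; pose t := nrm a + e / (hnorm x + 1).
have x1 : 0 < hnorm x + 1 by rewrite ltr_wpDl ?hnorm_ge0.
have t0 : 0 < t by rewrite ltr_wpDl // divr_gt0.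
have at1 : nrm ((t^-1)%:C *: a) < 1.
  by rewrite nrmZR ?invr_ge0 ?(ltW t0) // mulrC ltr_pdivrMr // mul1r ltrDl divr_gt0.
have := lt1 _ at1; rewrite homZ bopZE hnormZ ger0_norm ?ler0c ?invr_ge0 ?(ltW t0) //=.
rewrite ler_pdivrMl // => /le_trans; apply.
rewrite /t mulrDl lerD2l -mulrA ler_piMr ?(ltW e0) // mulrC ler_pdivrMr // mul1r.
by rewrite lerDl.
Qed.


End StarHom.

(** * Vertices and arrows in the limit algebra *)

Section Commutant.
Context {R : realType} {A : cstarAlg R}.
Implicit Types (a b : A) (X : set A).

Definition commutant X : set A := [set a | forall b, X b -> a ** b = b ** a].

Lemma commutant_subalg X : (forall b, X b -> X (star b)) -> cstar_subalg (commutant X).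
Proof.
move=> Xs; split=> [b Xb|k a a' ca ca' b Xb|a a' ca ca' b Xb|a ca b Xb|].
- by rewrite smul0l smul0r.
- by rewrite smulDl smulDr smulZl smulZr ca // ca'.
- by rewrite -smulA ca' // smulA ca // smulA.
- by rewrite -[b]starK -!starM ca //; exact: Xs.
apply/closedP => l lim b Xb; apply/eqP; rewrite -subr_eq0; apply/eqP/nrm_eq0/le_anti.
rewrite nrm_ge0 andbT; apply/ler_addgt0Pr => e e0; rewrite add0r.
have d0 : 0 < 2 * nrm b + 1 by rewrite ltr_wpDl // mulr_ge0 ?nrm_ge0.
have [a ca al] := lim (e / (2 * nrm b + 1)) (divr_gt0 e0 d0).
have -> : l ** b - b ** l = b ** (a - l) - (a - l) ** b.
  by rewrite smulBl smulBr ca // opprB [RHS]addrC addrA subrK.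
rewrite (le_trans (nrmD _ _)) // nrmN (le_trans (lerD (nrmM _ _) (nrmM _ _))) //.
rewrite (mulrC (nrm b)) -mulrDr (le_trans (ler_wpM2r _ al)) ?addr_ge0 ?nrm_ge0 //.
by rewrite -mulrA ler_piMr ?(ltW e0) // mulrC ler_pdivrMr // mul1r; lra.
Qed.

(** Partial isometries that normalise the subalgebra [B]: conjugation by such a [t]
    restricts to an isomorphism between two corners of [B]. *)
Definition normaliser (B : set A) (t : A) : Prop :=
  [/\ t ** star t ** t = t, B (t ** star t), B (star t ** t),
      forall b, B b -> B (star t ** b ** t) & forall b, B b -> B (t ** b ** star t)].

Lemma normaliser_star B t : normaliser B t -> normaliser B (star t).
Proof.
case=> ttt Btt' Bt't Bc Bc'; split; rewrite ?starK //.
by have := congr1 (@star R A) ttt; rewrite !starM starK smulA.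
Qed.

Lemma conj_mul t b b' : t ** star t ** t = t ->
  (t ** star t) ** b' = b' ** (t ** star t) ->
  star t ** (b ** b') ** t = (star t ** b ** t) ** (star t ** b' ** t).
Proof.
move=> ttt tb'.
have -> : (star t ** b ** t) ** (star t ** b' ** t) = star t ** b ** (t ** star t ** b') ** t.
  by rewrite !smulA.
by rewrite tb' -!smulA; move: ttt; rewrite -smulA => ->.
Qed.

(** Conjugation is Lipschitz. *)
Lemma conj_closed (B : set A) t : closed B -> closed [set b | B (star t ** b ** t)].
Proof.
move=> /closedP Bc; apply/closedP => l lim; apply: Bc => e e0.
have d0 : 0 < nrm t * nrm t + 1 by rewrite ltr_wpDl // mulr_ge0 ?nrm_ge0.
have [a Ba al] := lim (e / (nrm t * nrm t + 1)) (divr_gt0 e0 d0).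
exists (star t ** a ** t) => //; rewrite -smulBl -smulBr.
rewrite (le_trans (nrmM _ _)) // (le_trans (ler_wpM2r (nrm_ge0 _) (nrmM _ _))) // nrm_star.
rewrite mulrAC (le_trans (ler_wpM2l _ al)) ?mulr_ge0 ?nrm_ge0 //.
by rewrite mulrC -mulrA ler_piMr ?(ltW e0) // mulrC ler_pdivrMr // mul1r lerDl.
Qed.

End Commutant.

Section LimitAlgebra.
Context {R : realType} {G : bipGraph} (M : graphSystem R G).
Local Notation O := (gsO M).
Local Notation B := (B0 M).

Definition ev n (v : vertex (canon G n)) : O := imv M v.
Definition et n (x : bE (canon G n)) : O := gsiota (gst M x).

Let iotaP n : star_hom (@gsiota R G M n).
Proof. by have [h _ _] := gsOP M; exact: h. Qed.

Let iotaE n (a : gsA M n) : gsiota (gsphi a) = gsiota a :> O.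
Proof. by have [_ h _] := gsOP M; exact: (h n a). Qed.

Lemma iotaM n (a b : gsA M n) : gsiota (a ** b) = gsiota a ** gsiota b :> O.
Proof. by have [_ h _] := iotaP n; exact: h. Qed.

Lemma iota_star n (a : gsA M n) : gsiota (star a) = star (gsiota a) :> O.
Proof. by have [_ _ h] := iotaP n; exact: h. Qed.

Lemma iotaD n : {morph (@gsiota R G M n) : a b / a + b}.
Proof.
by have [h _ _] := iotaP n => a b; rewrite -{1}(scale1r a) h scale1r.
Qed.

Lemma iota0 n : gsiota (0 : gsA M n) = 0 :> O.
Proof.
by have := iotaD (0 : gsA M n) 0; rewrite addr0 => /eqP; rewrite -subr_eq subrr => /eqP <-.
Qed.

Lemma iota_sum n (J : finType) (P : pred J) (F : J -> gsA M n) :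
  gsiota (\sum_(j | P j) F j) = \sum_(j | P j) gsiota (F j) :> O.
Proof. exact: (big_morph _ (@iotaD n) (iota0 n)). Qed.

Let relP n : graph_relations (@gsp R G M n) (@gst R G M n).
Proof. by have [h _] := gsAP M n; exact: h. Qed.

Lemma ev_mul n (v v' : vertex (canon G n)) : ev v ** ev v' = if v == v' then ev v else 0.
Proof.
have [[h _] _ _ _] := relP n; rewrite /ev /imv -iotaM h.
by case: ifP => // _; exact: iota0.
Qed.

Lemma ev_star n (v : vertex (canon G n)) : star (ev v) = ev v.
Proof. by have [[_ h] _ _ _] := relP n; rewrite /ev /imv -iota_star h. Qed.

Lemma et_rng n (x : bE (canon G n)) : ev (inl (br x) : vertex (canon G n)) ** et x = et x.
Proof. by have [_ h _ _] := relP n; rewrite /ev /imv -iotaM (proj1 (h x)). Qed.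

Lemma et_src n (x : bE (canon G n)) : et x ** ev (inr (bs x) : vertex (canon G n)) = et x.
Proof. by have [_ h _ _] := relP n; rewrite /ev /imv -iotaM (proj2 (h x)). Qed.

Lemma et_mul n (u : bV0 (canon G n)) X (x y : bE (canon G n)) :
  X \in bC u -> x \in X -> y \in X ->
  star (et x) ** et y = if x == y then ev (inr (bs x) : vertex (canon G n)) else 0.
Proof.
move=> XC xX yX; have [_ _ h _] := relP n.
rewrite /et -iota_star -iotaM (h (inl u) X) //.
by case: ifP => // _; exact: iota0.
Qed.

Lemma ev_next n (w : bV1 (canon G n)) :
  ev (inr w : vertex (canon G n)) = ev (inl w : vertex (canon G n.+1)).
Proof. by have [_ h _ _] := gsphiP M n; rewrite /ev /imv -iotaE h. Qed.

Lemma ev_split n (u : bV0 (canon G n)) : ev (inl u : vertex (canon G n)) =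
  \sum_(v : nextV1 (canon G n) | tbase v == u) ev (inr v : vertex (canon G n.+1)).
Proof. by have [_ _ h _] := gsphiP M n; rewrite /ev /imv -iotaE h iota_sum. Qed.

Lemma et_split n (x : bE (canon G n)) :
  et x = \sum_(a in nextX x) star (et (a : bE (canon G n.+1))).
Proof.
have [_ _ _ h] := gsphiP M n; rewrite /et -iotaE h iota_sum.
by apply: eq_bigr => a _; rewrite iota_star.
Qed.

(** The vertex of level [n] below a vertex of level [n.+1]: in the limit algebra a
    vertex is the sum of the vertices above it. *)
Definition parent n (v : vertex (canon G n.+1)) : vertex (canon G n) :=
  match v : bV1 (canon G n) + nextV1 (canon G n) with
  | inl w => inr w
  | inr v => inl (tbase v)
  end.

Lemma ev_parent n (v : vertex (canon G n)) (v' : vertex (canon G n.+1)) :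
  ev v ** ev v' = if parent v' == v then ev v' else 0.
Proof.
case: v => [u|w]; last first.
  rewrite ev_next ev_mul; case: v' => [w'|v'] //=; rewrite eq_sym.
  by rewrite (inj_eq (@inl_inj _ _)) (inj_eq (@inr_inj _ _)); case: eqP => // ->.
rewrite ev_split smul_suml; case: v' => [w'|v'] /=.
  by rewrite big1 // => v _; rewrite ev_mul.
rewrite (inj_eq (@inl_inj _ _)).
have [<-|vu] := eqVneq (tbase v') u; last first.
  rewrite big1 // => v vu'; rewrite ev_mul (inj_eq (@inr_inj _ _)).
  by case: eqVneq => // vv'; move: vu; rewrite -vv' vu'.
rewrite (bigD1 v') //= ev_mul eqxx big1 ?addr0 // => v /andP[_ vv'].
by rewrite ev_mul (inj_eq (@inr_inj _ _)) (negPf vv').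
Qed.

(** Hence a vertex either lies below another vertex of a later level or is orthogonal to it. *)
Lemma ev_above n k (v : vertex (canon G n)) (v' : vertex (canon G (k + n))) :
  ev v ** ev v' = ev v' \/ ev v ** ev v' = 0.
Proof.
elim: k v' => [|k IH] v'; first by rewrite ev_mul; case: eqP => [->|_]; [left|right].
have e : ev (parent v') ** ev v' = ev v' by rewrite ev_parent eqxx.
rewrite -e smulA; case: (IH (parent v')) => ->; first by left.
by rewrite smul0l; right.
Qed.

(** Of two vertices, the one of the later level is fixed or annihilated by the other. *)
Lemma ev_comm n m (v : vertex (canon G n)) (v' : vertex (canon G m)) :
  ev v ** ev v' = ev v' ** ev v.
Proof.
wlog nm : n m v v' / (n <= m)%N => [wl|].
  by case: (leqP n m) => [|/ltnW] nm; [exact: wl|apply/esym/wl].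
move: v'; rewrite -(subnK nm) => v'; rewrite -[RHS]starK starM !ev_star.
by case: (ev_above v v') => ->; rewrite ?ev_star ?star0.
Qed.

Lemma B0_subalg : cstar_subalg B.
Proof.
split=> [S [[S0 _ _ _ _] _]|k a b Ba Bb S hS|a b Ba Bb S hS|a Ba S hS|] //.
- by have [[_ Sl _ _ _] _] := hS; apply: Sl; [exact: Ba|exact: Bb].
- by have [[_ _ Sm _ _] _] := hS; apply: Sm; [exact: Ba|exact: Bb].
- by have [[_ _ _ Ss _] _] := hS; apply: Ss; exact: Ba.
apply: closed_bigI => S [[_ _ _ _ Sc] _]; exact: Sc.
Qed.

Lemma B0_ev n (v : vertex (canon G n)) : B (ev v).
Proof. by move=> S [_ GS]; apply: GS; exists n, v. Qed.

Lemma B0_ind (S : set O) : cstar_subalg S -> (forall n (v : vertex (canon G n)), S (ev v)) ->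
  forall b, B b -> S b.
Proof. by move=> hS Sv b; apply; split=> // _ [n [v ->]]; exact: Sv. Qed.

(** The elements commuting with all vertices form a closed subalgebra containing the
    vertices, so all of [B0] commutes with the vertices; then repeat with [B0] instead. *)
Lemma B0_comm a b : B a -> B b -> a ** b = b ** a.
Proof.
pose V : set O := [set b | exists n (v : vertex (canon G n)), b = ev v].
have Vs c : V c -> V (star c) by move=> [n [v ->]]; exists n, v; rewrite ev_star.
have BV c : B c -> commutant V c.
  move=> Bc; apply: (@B0_ind (commutant V) _ _ c Bc) => [|n v _ [m [v' ->]]]; last exact: ev_comm.
  exact: commutant_subalg.
move=> Ba Bb; suff : commutant B a by apply.
apply: (@B0_ind (commutant B) _ _ a Ba) => [|n v c /BV cV]; last by rewrite cV //; exists n, v.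
by apply: commutant_subalg => c Bc; exact: (subalg_star B0_subalg Bc).
Qed.

Lemma et_initial n (x : bE (canon G n)) :
  star (et x) ** et x = ev (inr (bs x) : vertex (canon G n)).
Proof. by rewrite (et_mul (part_in x) (mem_part x) (mem_part x)) eqxx. Qed.

Lemma et_partial n (x : bE (canon G n)) : et x ** star (et x) ** et x = et x.
Proof. by rewrite -smulA et_initial et_src. Qed.

(** The arrows of [X(x)] have the same colour, so the mixed terms of the product vanish. *)
Lemma et_range n (x : bE (canon G n)) : et x ** star (et x) =
  \sum_(a in nextX x) ev (inr (atup a) : vertex (canon G n.+1)).
Proof.
have XC : nextX x \in @bC (nextG (canon G n)) (bs x) by apply/nextXP; exists x.
rewrite {1}et_split smul_suml; apply: eq_bigr => a aX.
rewrite (et_split x) star_sum smul_sumr (bigD1 a) //= starK.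
rewrite (@et_mul n.+1 (bs x) _ a a XC aX aX) eqxx big1 ?addr0 // => b /andP[bX ba].
by rewrite starK (@et_mul n.+1 (bs x) _ a b XC aX bX) eq_sym (negPf ba).
Qed.

Lemma B0_range n (x : bE (canon G n)) : B (et x ** star (et x)).
Proof. by rewrite et_range; apply: (subalg_sum B0_subalg) => a _; exact: B0_ev. Qed.

Lemma B0_initial n (x : bE (canon G n)) : B (star (et x) ** et x).
Proof. by rewrite et_initial; exact: B0_ev. Qed.

(** By induction on the number of levels between [x] and [v]: write [x] as the sum of the
    [a^*], with [a] in [X(x)].  In [x^* v x] the mixed terms [a v b^*] vanish because [a]
    and [b] start at orthogonal vertices commuting with [v], and in [x v x^*] the mixed
    terms [a^* v b] vanish because [v] commutes with [a a^*] and [a^* b = 0]. *)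
Lemma conj_ev d m k (x : bE (canon G k)) (v : vertex (canon G m)) : m = (d + k)%N ->
  B (star (et x) ** ev v ** et x) /\ B (et x ** ev v ** star (et x)).
Proof.
elim: d k x => [|d IH] k x mE.
  rewrite mE add0n in v *; split.
    rewrite -smulA -{2}(et_rng x) (smulA (ev v)) ev_mul; case: eqP => [->|_].
      by rewrite et_rng; exact: B0_initial.
    by rewrite smul0l smul0r; exact: (subalg0 B0_subalg).
  rewrite -{1}(et_src x) -(smulA (et x)) ev_mul; case: eqP => [_|_].
    by rewrite et_src; exact: B0_range.
  by rewrite smul0r smul0l; exact: (subalg0 B0_subalg).
have XC : nextX x \in @bC (nextG (canon G k)) (bs x) by apply/nextXP; exists x.
have mE' : m = (d + k.+1)%N by rewrite mE addSnnS.
split; rewrite {1}(et_split x) ?star_sum !smul_suml; apply: (subalg_sum B0_subalg) => a aX;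
  rewrite (et_split x) ?star_sum smul_sumr; apply: (subalg_sum B0_subalg) => b bX;
  rewrite !starK.
- have [<-|ab] := eqVneq a b; first by have [] := IH _ (a : bE (canon G k.+1)) mE'.
  suff -> : @et k.+1 a ** ev v ** star (@et k.+1 b) = 0 by exact: (subalg0 B0_subalg).
  have vab : ev (inr (atup a) : vertex (canon G k.+1)) ** ev (inr (atup b) : vertex (canon G k.+1)) = 0.
    rewrite ev_mul (inj_eq (@inr_inj _ _)).
    case: eqVneq => // tab; case/eqP: ab; apply: arrow_ext => //.
    by move: aX bX; rewrite !nextXE => /eqP -> /eqP ->.
  rewrite -(@et_src k.+1 a) -(@et_src k.+1 b) starM ev_star -!smulA (smulA (ev v)) -(ev_comm _ v).
  by rewrite -smulA (smulA _ _ (star (@et k.+1 b))) !(smulA (ev _)) vab !(smul0l, smul0r).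
- have [<-|ab] := eqVneq a b; first by have [] := IH _ (a : bE (canon G k.+1)) mE'.
  suff -> : star (@et k.+1 a) ** ev v ** @et k.+1 b = 0 by exact: (subalg0 B0_subalg).
  have aE : star (@et k.+1 a) = star (@et k.+1 a) ** (@et k.+1 a ** star (@et k.+1 a)).
    by rewrite -{1}(@et_partial k.+1 a) !starM starK.
  rewrite {1}aE -(smulA (star (@et k.+1 a))) -(B0_comm (B0_ev v)) -?smulA; last exact: B0_range.
  rewrite (@et_mul k.+1 (bs x) _ a b XC aX bX) (negPf ab) !smul0r //.
Qed.

End LimitAlgebra.

(** * Transport of characters by arrows *)

Section Transport.
Context {R : realType} {G : bipGraph} (M : graphSystem R G).
Local Notation O := (gsO M).
Local Notation B := (B0 M).
Implicit Types xi eta zeta : Omega M.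

Lemma OmegaP xi : is_character B (val xi).
Proof. by have := valP xi; rewrite inE. Qed.

(** Characters vanish outside [B0], so they are determined by their values on it. *)
Lemma Omega_ext xi eta : (forall b, B b -> val xi b = val eta b) -> xi = eta.
Proof.
move=> xe; apply: val_inj; apply/funext => b.
have [/xe //|nb] := pselect (B b).
by rewrite (char_out (OmegaP xi) nb) (char_out (OmegaP eta) nb).
Qed.

Lemma Omega_mk (f : O -> cplx R) : is_character B f -> exists xi, forall b, val xi b = f b.
Proof.
move=> fP; have fO : (f : {ptws O -> cplx R}) \in Omega M by rewrite inE.
by exists (exist _ (f : {ptws O -> cplx R}) fO).
Qed.

Lemma xiM xi a b : B a -> B b -> val xi (a ** b) = val xi a * val xi b.
Proof. exact: (charM (OmegaP xi)). Qed.


(** Conjugation by [t] is multiplicative on the commutative algebra [B0]. *)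
Lemma conj_subalg (t : O) : t ** star t ** t = t -> B (t ** star t) ->
  cstar_subalg [set b | B b /\ B (star t ** b ** t)].
Proof.
move=> ttt Bt; have BS := B0_subalg M.
split=> [|k a b [Ba Bta] [Bb Btb]|a b [Ba Bta] [Bb Btb]|a [Ba Bta]|] /=.
- by rewrite smul0r smul0l; split; exact: (subalg0 BS).
- have [_ Bl _ _ _] := BS; split; first exact: Bl.
  by rewrite smulDr smulDl smulZr smulZl; exact: Bl.
- split; first exact: (subalgM BS).
  rewrite conj_mul //; first exact: (subalgM BS).
  exact: B0_comm.
- split; first exact: (subalg_star BS).
  have -> : star t ** star a ** t = star (star t ** a ** t).
    by rewrite !starM starK smulA.
  exact: (subalg_star BS).
have [_ _ _ _ Bc] := BS.
change (closed (B `&` [set b | B (star t ** b ** t)])).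
by apply: closedI => //; exact: conj_closed.
Qed.

Lemma normaliser_of_ev (t : O) : t ** star t ** t = t ->
  B (t ** star t) -> B (star t ** t) ->
  (forall n (v : vertex (canon G n)), B (star t ** ev M v ** t) /\ B (t ** ev M v ** star t)) ->
  normaliser B t.
Proof.
move=> ttt Btt' Bt't tv.
have ttt' : star t ** t ** star t = star t.
  by have := congr1 (@star R O) ttt; rewrite !starM starK smulA.
split=> // b Bb.
  have [] // := @B0_ind R G M [set b | B b /\ B (star t ** b ** t)] _ _ b Bb.
    exact: conj_subalg.
  by move=> n v; split; [exact: B0_ev|have [] := tv n v].
have [] // := @B0_ind R G M [set b | B b /\ B (star (star t) ** b ** star t)] _ _ b Bb.
- by apply: conj_subalg; rewrite ?starK.
- by move=> n v; split; [exact: B0_ev|rewrite starK; have [] := tv n v].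
by rewrite starK.
Qed.

Lemma ev_children n (v : vertex (canon G n)) :
  ev M v = \sum_(v' : vertex (canon G n.+1) | parent v' == v) ev M v'.
Proof.
have -> : \sum_(v' : vertex (canon G n.+1) | parent v' == v) ev M v' =
    \sum_(w : bV1 (canon G n) | inr w == v) ev M (inl w : vertex (canon G n.+1)) +
    \sum_(v' : nextV1 (canon G n) | inl (tbase v') == v) ev M (inr v' : vertex (canon G n.+1)).
  exact: big_sumType.
case: v => [u|w].
  rewrite big1 ?add0r // ev_split; apply: eq_bigl => v'.
  by rewrite (inj_eq (@inl_inj _ _)).
rewrite ev_next [X in _ + X]big1 ?addr0 //.
by rewrite (eq_bigl (pred1 w)) ?big_pred1_eq // => w'; rewrite (inj_eq (@inr_inj _ _)).
Qed.

(** Iteration of [ev_children]. *)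
Lemma ev_refine n k (v : vertex (canon G n)) :
  exists P : pred (vertex (canon G (k + n))), ev M v = \sum_(v' | P v') ev M v'.
Proof.
elim: k => [|k [P vP]].
  by exists (pred1 v); rewrite big_pred1_eq.
exists (fun v' => P (parent v')); rewrite vP.
rewrite (eq_bigr _ (fun v' _ => ev_children v')).
rewrite (exchange_big_dep (fun v'' => P (parent v''))) /=; last by move=> v' v'' Pv' /eqP ->.
apply: eq_bigr => v'' Pv''; rewrite (bigD1 (parent v'')) ?eqxx ?andbT //= big1 ?addr0 //.
by move=> v' /andP[/andP[_ /eqP <-]]; rewrite eqxx.
Qed.

Lemma et_normaliser n (x : bE (canon G n)) : normaliser B (et M x).
Proof.
apply: normaliser_of_ev; [exact: et_partial|exact: B0_range|exact: B0_initial|].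
move=> m v; case: (leqP n m) => [nm|/ltnW mn].
  by apply: (@conj_ev _ _ _ (m - n)); rewrite subnK.
have [P vP] := ev_refine (n - m) v; move: P vP; rewrite (subnK mn) => P ->.
rewrite !smul_sumr !smul_suml; split; apply: (subalg_sum (B0_subalg M)) => v' _.
  by have [] := @conj_ev _ _ M 0 n n x v' erefl.
by have [] := @conj_ev _ _ M 0 n n x v' erefl.
Qed.

(** For [t] the image of an arrow [x] of [E] this is [theta_x].  Stated for all partial
    isometries, it contains the inverses, as [Theta (star t)], and the maps given by the
    arrows of all later graphs. *)
Definition Theta (t : O) xi eta : Prop :=
  [/\ val xi (star t ** t) = 1, val eta (t ** star t) = 1 &
      forall b, B b -> val eta b = val xi (star t ** b ** t)].

Lemma Theta_fun t xi eta eta' : Theta t xi eta -> Theta t xi eta' -> eta = eta'.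
Proof. by move=> [_ _ h] [_ _ h']; apply: Omega_ext => b Bb; rewrite h // h'. Qed.

Lemma Theta_sym t xi eta : normaliser B t -> Theta t xi eta -> Theta (star t) eta xi.
Proof.
case=> ttt Btt' Bt't Bc Bc' [x1 e1 ex]; split; rewrite ?starK // => b Bb.
rewrite ex; last exact: Bc'.
have -> : star t ** (t ** b ** star t) ** t = (star t ** t) ** b ** (star t ** t).
  by rewrite !smulA.
have BS := B0_subalg M.
have Bttb : B (star t ** t ** b) by exact: (subalgM BS Bt't Bb).
by rewrite (xiM xi Bttb Bt't) (xiM xi Bt't Bb) x1 mul1r mulr1.
Qed.

Lemma Theta_inj t xi xi' eta : normaliser B t -> Theta t xi eta -> Theta t xi' eta -> xi = xi'.
Proof. by move=> tN /(Theta_sym tN) h /(Theta_sym tN); exact: Theta_fun. Qed.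

(** Multiplicativity of [b |-> xi (t^* b t)] is that of conjugation by [t]. *)
Lemma Theta_ex t xi : normaliser B t -> val xi (star t ** t) = 1 -> exists eta, Theta t xi eta.
Proof.
case=> ttt Btt' Bt't Bc Bc' x1; have BS := B0_subalg M; have xP := OmegaP xi.
have conjtt : star t ** (t ** star t) ** t = star t ** t.
  by rewrite -smulA ttt.
pose f b : cplx R := if pselect (B b) then val xi (star t ** b ** t) else 0.
have fE b : B b -> f b = val xi (star t ** b ** t) by rewrite /f; case: pselect.
have fP : is_character B f.
  split=> [k a b Ba Bb|a b Ba Bb||a nB].
  - have [_ Bl _ _ _] := BS; rewrite !fE //; last exact: Bl.
    rewrite smulDr smulDl smulZr smulZl; have [xL _ _ _] := xP; apply: xL; exact: Bc.
  - rewrite !fE //; last exact: (subalgM BS).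
    rewrite conj_mul //; last exact: B0_comm.
    by apply: xiM; exact: Bc.
  - by exists (t ** star t) => //; rewrite fE // conjtt x1 oner_eq0.
  - by rewrite /f; case: pselect.
have [eta etaE] := Omega_mk fP; exists eta; split=> //.
  by rewrite etaE fE // conjtt.
by move=> b Bb; rewrite etaE fE.
Qed.

Definition at_level n (v : level G n) xi : Prop := val xi (ev M (inl v : vertex (canon G n))) = 1.

Lemma val01 xi b : B b -> b ** b = b -> val xi b = 0 \/ val xi b = 1.
Proof.
move=> Bb bb; have := xiM xi Bb Bb; rewrite bb => /eqP.
rewrite -{1}(mulr1 (val xi b)) -subr_eq0 -mulrBr mulf_eq0 => /orP[/eqP|]; first by left.
by rewrite subr_eq0 => /eqP <-; right.
Qed.

Lemma ev01 xi n (v : vertex (canon G n)) : val xi (ev M v) = 0 \/ val xi (ev M v) = 1.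
Proof. by apply: val01; [exact: B0_ev|rewrite ev_mul eqxx]. Qed.

Lemma ev_uniq xi n (v v' : vertex (canon G n)) :
  val xi (ev M v) = 1 -> val xi (ev M v') = 1 -> v = v'.
Proof.
move=> v1 v'1; apply/eqP/negP => /negP vv'.
have := xiM xi (@B0_ev _ _ M _ v) (@B0_ev _ _ M _ v'); rewrite ev_mul (negPf vv') v1 v'1 mulr1.
rewrite (char0 (B0_subalg M) (OmegaP xi)) => /eqP.
by rewrite eq_sym oner_eq0.
Qed.

Lemma sum_ev1 xi n (J : finType) (P : pred J) (F : J -> vertex (canon G n)) :
  val xi (\sum_(j | P j) ev M (F j)) != 0 -> exists2 j, P j & val xi (ev M (F j)) = 1.
Proof.
rewrite (char_sum (B0_subalg M) (OmegaP xi)); last by move=> j _; exact: B0_ev.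
move=> s0; apply/not_exists2P => nF; case/eqP: s0; apply: big1 => j Pj.
by case: (ev01 xi (F j)) => // F1; case: (nF j) => //; rewrite F1.
Qed.

Lemma at_uniq n (v v' : level G n) xi : at_level v xi -> at_level v' xi -> v = v'.
Proof. by move=> h h'; have [] := ev_uniq h h'. Qed.

(** The vertices of [E_n], which are those of [D_n] and [D_{n+1}], are orthogonal. *)
Lemma at_next n (v : level G n) (w : level G n.+1) xi : at_level v xi -> ~ at_level w xi.
Proof.
move=> h; rewrite /at_level -[ev M _]ev_next => h'.
by have := ev_uniq h h'.
Qed.

Lemma at_child n (v : level G n) xi : at_level v xi ->
  exists2 v' : level G n.+2, tbase (G := canon G n) v' = v & at_level v' xi.
Proof.
rewrite /at_level ev_split => v1.
have [|v' /eqP <- v'1] := @sum_ev1 xi _ _ (fun v' => tbase v' == v) (fun v' => inr v' : vertex (canon G n.+1)).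
  by rewrite v1 oner_eq0.
by exists v' => //; rewrite -[ev M _]ev_next.
Qed.

Lemma at_base n (v : level G n.+2) xi : at_level v xi -> at_level (tbase (G := canon G n) v) xi.
Proof.
rewrite /at_level -[ev M (inl v : vertex (canon G n.+2))]ev_next => v1.
have := ev_parent M (inl (tbase (G := canon G n) v) : vertex (canon G n)) (inr v : vertex (canon G n.+1)).
rewrite /= eqxx => e; have := xiM xi (@B0_ev _ _ M _ (inl (tbase (G := canon G n) v) : vertex (canon G n))) (@B0_ev _ _ M _ (inr v : vertex (canon G n.+1))).
by rewrite e v1 mulr1.
Qed.

(** A point is in the range of [x] if and only if its tuple has entry [x]. *)
Lemma at_range n (x : bE (canon G n)) xi : val xi (et M x ** star (et M x)) = 1 <->
  exists2 v : level G n.+2, at_level v xi & tent (G := canon G n) v (part x) = Some x.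
Proof.
rewrite et_range; split=> [x1|[v v1 vx]].
  have [|a aX a1] := @sum_ev1 xi _ _ (mem (nextX x)) (fun a => inr (atup a) : vertex (canon G n.+1)).
    by rewrite x1 oner_eq0.
  exists (atup a : level G n.+2); first by rewrite /at_level -[ev M _]ev_next.
  by move: aX; rewrite /= nextXE => /eqP <-; exact: aentP.
have [a [av ax]] := arrow_key vx.
rewrite (char_sum (B0_subalg M) (OmegaP xi)); last by move=> ? _; exact: B0_ev.
have v1' : val xi (ev M (inr v : vertex (canon G n.+1))) = 1 by rewrite ev_next.
rewrite (bigD1 a) ?nextXE ?ax ?eqxx //= av v1' big1 ?addr0 // => b /andP[].
rewrite nextXE => /eqP bx ba; case: (ev01 xi (inr (atup b) : vertex (canon G n.+1))) => // b1.
have [bv] := ev_uniq b1 v1'; case/eqP: ba; apply: arrow_ext; first by rewrite bv av.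
by rewrite bx ax.
Qed.

Lemma Theta_src n (x : bE (canon G n)) xi eta : Theta (et M x) xi eta ->
  at_level (bs x : level G n.+1) xi.
Proof. by case=> x1 _ _; rewrite /at_level -[ev M _]ev_next -et_initial. Qed.

Lemma Theta_exists n (x : bE (canon G n)) xi : at_level (bs x : level G n.+1) xi ->
  exists eta, Theta (et M x) xi eta.
Proof.
move=> x1; apply: Theta_ex; first exact: et_normaliser.
by rewrite et_initial ev_next.
Qed.

Lemma Theta_tuple n (x : bE (canon G n)) xi eta : Theta (et M x) xi eta ->
  exists2 v : level G n.+2, at_level v eta & tent (G := canon G n) v (part x) = Some x.
Proof. by case=> _ /at_range. Qed.

Lemma Theta_rng n (x : bE (canon G n)) xi eta : Theta (et M x) xi eta ->
  at_level (br x : level G n) eta.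
Proof.
move/Theta_tuple => [v v1 vx]; have [_ _ -> _] := tent_mem vx; exact: at_base.
Qed.

Lemma et_tuple n (a : nextE (canon G n)) :
  et M (a : bE (canon G n.+1)) ** ev M (inr (atup a) : vertex (canon G n.+1)) =
  et M (a : bE (canon G n.+1)).
Proof. exact: et_src. Qed.

(** On the tuple [v] the arrow [a = (v, x)] of the next graph implements the inverse of [x]. *)
Lemma Theta_next n (a : nextE (canon G n)) xi eta :
  Theta (et M (aent a)) xi eta -> at_level (atup a : level G n.+2) eta ->
  Theta (et M (a : bE (canon G n.+1))) eta xi.
Proof.
move=> xe; set x := aent a; set v := atup a => v1.
set ta := et M (a : bE (canon G n.+1)); set tx := et M x.
have BS := B0_subalg M; have [_ Btt' _ _ Bc'] := et_normaliser x.
have v1' : val eta (ev M (inr v : vertex (canon G n.+1))) = 1 by rewrite ev_next.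
(* Among the summands [b^*] of [x], the projection [v] selects [a^*]. *)
have xa : ev M (inr v : vertex (canon G n.+1)) ** tx = star ta.
  rewrite /tx et_split smul_sumr (bigD1 a) ?nextXE //= big1 ?addr0.
    by rewrite -{1}(et_tuple a) starM ev_star smulA ev_mul eqxx /ta -{2}(et_tuple a) starM ev_star.
  move=> b /andP[]; rewrite nextXE => /eqP bx ba.
  rewrite -(@et_tuple n b) starM ev_star smulA ev_mul (inj_eq (@inr_inj _ _)).
  by case: eqVneq => [vb|_]; [case/eqP: ba; apply: arrow_ext|rewrite smul0l].
have [ix ie xeb] := Theta_sym (et_normaliser x) xe; rewrite starK in ix ie xeb.
have xE b : B b -> val xi b = val eta (star ta ** b ** ta).
  move=> Bb; rewrite xeb //.
  have -> : star ta ** b ** ta = ev M (inr v : vertex (canon G n.+1)) ** (tx ** b ** star tx) ** ev M (inr v : vertex (canon G n.+1)).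
    by rewrite -xa -[in LHS](starK ta) -xa starM ev_star !smulA.
  set ev1 := ev M (inr v : vertex (canon G n.+1)).
  have Bv : B ev1 by exact: B0_ev.
  have Btb : B (tx ** b ** star tx) by exact: Bc'.
  have Bvtb : B (ev1 ** (tx ** b ** star tx)) by exact: (subalgM BS Bv Btb).
  by rewrite (xiM eta Bvtb Bv) (xiM eta Bv Btb) v1' mul1r mulr1.
split.
- by rewrite et_initial.
- rewrite xE; last exact: B0_range.
  by rewrite -smulA (et_partial M (a : bE (canon G n.+1))) et_initial.
- exact: xE.
Qed.

End Transport.

(** * Levels and translates *)

Section Similarity.
Context {R : realType} {G : bipGraph} (M : graphSystem R G).
Implicit Types xi eta zeta : Omega M.

Definition sim n xi xi' : Prop := forall v : level G n, at_level v xi <-> at_level v xi'.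

Lemma sim_of n (v : level G n) xi xi' : at_level v xi -> at_level v xi' -> sim n xi xi'.
Proof. by move=> h h' v'; split=> [/(at_uniq h) <-|/(at_uniq h') <-]. Qed.

Lemma sim_down n xi xi' : sim n.+2 xi xi' -> sim n xi xi'.
Proof.
by move=> s v; split=> /at_child[v' <-] /s /at_base.
Qed.

Lemma sim_even_down j n xi xi' : sim (j.*2 + n) xi xi' -> sim n xi xi'.
Proof. by elim: j => // j IH; rewrite doubleS => /sim_down. Qed.

(** A point over [D_n] lies in no set of the levels [D_{n+1}, D_{n+3}, ...]. *)
Lemma sim_odd j n (v v' : level G n) xi xi' : at_level v xi -> at_level v' xi' ->
  sim (j.*2.+1 + n) xi xi'.
Proof.
have up (zeta : Omega M) (u : level G n) : at_level u zeta ->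
    exists u' : level G (j.*2 + n), at_level u' zeta.
  move=> h; elim: j => [|j [u' /at_child[u'' _ h'']]]; first by exists u.
  by rewrite doubleS; exists u''.
by move=> /up[u h] /up[u' h'] u''; split=> [/(at_next h)|/(at_next h')].
Qed.

(** The arrow that inverts [x] at [eta] is the one given by the tuple under [eta]. *)
Lemma Theta_lift k (x : bE (canon G k)) xi eta : Theta (et M x) xi eta ->
  exists a : nextE (canon G k), [/\ aent a = x, at_level (atup a : level G k.+2) eta &
    Theta (et M (a : bE (canon G k.+1))) eta xi].
Proof.
move=> xe; have [v v1 vx] := Theta_tuple xe; have [a [av ax]] := arrow_key vx.
by exists a; split; rewrite ?av //; apply: Theta_next; rewrite ?ax ?av.
Qed.

Definition star_sim k (w : level G k.+1) m xi xi' : Prop :=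
  forall (x : bE (canon G k)) eta eta', bs x = w ->
    Theta (et M x) xi eta -> Theta (et M x) xi' eta' -> sim m eta eta'.

(** Points over the same vertex of [E_k^{0,1}] lie in the same set of a level if and only
    if all their translates lie in the same set one level below.  Two levels further up,
    the arrows of [E_{k+2}] starting at the vertex of [D_{k+3}] under a point act on it
    as the arrows of [E_k] do. *)
Lemma sim_star_even j k (w : level G k.+1) xi xi' : at_level w xi -> at_level w xi' ->
  sim (j.*2 + k.+1) xi xi' <-> star_sim w (j.*2 + k) xi xi'.
Proof.
elim: j k w => [|j IH] k w h h'.
  split=> [_ x eta eta' _ /Theta_rng h1 /Theta_rng h2|_]; first exact: sim_of h1 h2.
  exact: sim_of h h'.
rewrite doubleS !addSn -!addnS.
(* Lifting twice returns to the direction of [x], two levels up. *)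
have twice (z t : Omega M) (x : bE (canon G k)) : Theta (et M x) z t ->
    exists (a : nextE (canon G k)) (b : nextE (canon G k.+1)),
    [/\ aent a = x, aent b = a, at_level (atup a : level G k.+2) t,
        at_level (atup b : level G k.+3) z & Theta (et M (b : bE (canon G k.+2))) z t].
  move=> /Theta_lift[a [ax av /(@Theta_lift k.+1)[b [ba bv bT]]]].
  by exists a, b; split.
split=> [s x eta eta' xw xe xe'|s].
  have [a [b [ax ba av bv bT]]] := twice _ _ _ xe.
  have [a' [b' [ax' ba' av' bv' bT']]] := twice _ _ _ xe'.
  have s3 := sim_even_down s.
  have bb' : atup b = atup b' :> level G k.+3 by apply: at_uniq bv _; apply/s3.
  have aa' : a = a'.
    have := aentP b; have := aentP b'; rewrite -bb' ba ba' !part_next ax ax'.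
    by move=> -> [].
  have ab : aent b = aent b' by rewrite ba ba' aa'.
  have bE : b = b' := arrow_ext bb' ab.
  rewrite -bE in bv' bT'.
  have [hs _] := IH k.+2 (atup b : level G k.+3) bv bv'.
  have bs_sim := hs s b eta eta' erefl.
  exact: (bs_sim bT bT').
have [v vw vx] := at_child h; have [v' vw' vx'] := at_child h'.
have vv' : v = v'.
  apply: (@tuple_ext (canon G k.+1)); first by rewrite vw vw'.
  move=> X; rewrite vw => /nextXP[x xw ->].
  have [eta xe] := @Theta_exists _ _ M k x xi (eq_ind_r (fun u => at_level u xi) h xw).
  have [eta' xe'] := @Theta_exists _ _ M k x xi' (eq_ind_r (fun u => at_level u xi') h' xw).
  have [a [b [ax ba av bv bT]]] := twice _ _ _ xe.
  have [a' [b' [ax' ba' av' bv' bT']]] := twice _ _ _ xe'.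
  have s2 : sim k.+2 eta eta' := sim_even_down (s x eta eta' xw xe xe').
  have aa' : a = a'.
    by apply: arrow_ext; [apply: at_uniq av _; apply/s2|rewrite ax ax'].
  rewrite (at_uniq vx bv) (at_uniq vx' bv') -[in LHS]ax -part_next -ba aentP ba.
  by rewrite -ax' -part_next -ba' aentP ba' aa'.
rewrite -vv' in vx'; have [_ hs] := IH k.+2 v vx vx'.
apply: hs => b eta eta' bv be be'.
pose c : nextE (canon G k.+1) := b; have cv : atup c = v := bv.
pose a : nextE (canon G k) := aent c; pose x := aent a.
have av : @br (canon G k.+1) a = tbase v by rewrite /a aent_br cv.
have xw : bs x = w := etrans av vw.
have [z xz] := @Theta_exists _ _ M k x xi (eq_ind_r (fun u => at_level u xi) h xw).
have [z' xz'] := @Theta_exists _ _ M k x xi' (eq_ind_r (fun u => at_level u xi') h' xw).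
have same (y t u : Omega M) : at_level v y -> Theta (et M x) y t ->
    Theta (et M (c : bE (canon G k.+2))) y u -> u = t.
  move=> vy xt bu; have [a1 [b1 [ax1 ba1 av1 bv1 bT1]]] := twice _ _ _ xt.
  suff bb : b1 = c by rewrite bb in bT1; exact: Theta_fun bu bT1.
  have tb : atup b1 = atup c by rewrite cv; exact: at_uniq bv1 vy.
  have ab : aent b1 = aent c.
    have := aentP c; have := aentP b1; rewrite tb !part_next ba1 ax1 -/a -/x => ->.
    by case.
  exact: arrow_ext tb ab.
rewrite (same xi z eta vx xz be) (same xi' z' eta' vx' xz' be').
exact: s xw xz xz'.
Qed.

Lemma sim_star m k (w : level G k.+1) xi xi' : at_level w xi -> at_level w xi' ->
  sim (m + k.+1) xi xi' <-> star_sim w (m + k) xi xi'.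
Proof.
move=> h h'; rewrite -(odd_double_half m); case: (odd m); last exact: sim_star_even.
rewrite add1n; split=> _; last exact: sim_odd h h'.
by move=> x eta eta' _ /Theta_rng h1 /Theta_rng h2; exact: sim_odd h1 h2.
Qed.

(** The same for points over a tuple [v], whose neighbours are their preimages under the
    entries of [v]. *)
Lemma sim_tuple m k (v : level G k.+2) eta eta' : at_level v eta -> at_level v eta' ->
  (forall (x : bE (canon G k)) xi xi', tent (G := canon G k) v (part x) = Some x ->
    Theta (et M x) xi eta -> Theta (et M x) xi' eta' -> sim (m + k.+1) xi xi') <->
  sim (m + k.+2) eta eta'.
Proof.
move=> h h'; rewrite (@sim_star m k.+1 v) //; split=> s.
  move=> a0 xi xi' av aT aT'; pose a : nextE (canon G k) := a0.
  have av' : atup a = v := av.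
  have vx : tent (G := canon G k) v (part (aent a)) = Some (aent a) by rewrite -av' aentP.
  have back (z t : Omega M) : at_level v z -> Theta (et M (a : bE (canon G k.+1))) z t ->
      Theta (et M (aent a)) t z.
    move=> vz aT1; have xN := et_normaliser M (aent a).
    have [|t' t'T] := @Theta_ex _ _ M (star (et M (aent a))) z (normaliser_star xN).
      by rewrite starK; apply/at_range; exists v.
    have := Theta_sym (normaliser_star xN) t'T; rewrite starK => t'T'.
    suff -> : t = t' by [].
    by apply: Theta_fun aT1 _; apply: Theta_next t'T' _; rewrite av'.
  exact: (s _ _ _ vx (back _ _ h aT) (back _ _ h' aT')).
move=> x xi xi' vx xT xT'.
have [a [ax av aT]] := Theta_lift xT; have [a' [ax' av' aT']] := Theta_lift xT'.
have aa' : a' = a.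
  by apply: arrow_ext; rewrite ?ax ?ax' // (at_uniq av h) (at_uniq av' h').
rewrite aa' in aT'; have atup_v : atup a = v := at_uniq av h.
have a_sim := s a xi xi' atup_v; exact: (a_sim aT aT').
Qed.

End Similarity.

(** * E-functions as trees of choices *)

Section ChoiceTrees.
Context {G : bipGraph} (w : bV1 G).
Implicit Types (h : seq (bE G * bool)) (x y : bE G) (X Y : {set bE G}).
Local Notation F := (freeGroup (bE G)).

Implicit Types c : seq (bE G * bool) -> {set bE G} -> option (bE G).

(** The vertex of [E^{0,1}] at which a word ends; words ending in [E^{0,0}] have a head
    [(x, false)] and end at [br x]. *)
Definition word_vertex h : option (bV1 G) :=
  match h with
  | [::] => Some w
  | (y, true) :: _ => Some (bs y)
  | _ => None
  end.

(** The words of the tree grown from [w]: at a vertex of [E^{0,1}] all arrows starting there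
    are followed, except back along the last letter; at a vertex [br x] reached by [x], the
    arrow chosen by [c] in each colour other than that of [x] is followed backwards.  The
    elements of [Omega_{j+1}] are the nodes of length [2 j + 1]. *)
Fixpoint node c h : Prop :=
  match h with
  | [::] => True
  | (x, false) :: h' => [/\ node c h', word_vertex h' = Some (bs x) & ohead h' != Some (x, true)]
  | (y, true) :: h' => node c h' /\
      if h' is (x, false) :: _ then
        exists Y, [/\ Y \in bC (br x), Y != part x & c h' Y = Some y]
      else False
  end.

(** Choices are made for all words and colours, so that those of a tree can be prescribed
    and the others left arbitrary. *)
Definition choice_fun c : Prop :=
  (forall h u Y, Y \in bC u -> exists y, c h Y = Some y) /\
  (forall h Y y, c h Y = Some y -> y \in Y).

Definition zval c h : @zelt G :=
  if h is (e, false) :: _ then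
    (part e, [ffun Y : {set bE G} => if Y \in bC (br e) :\ part e then c h Y else None])
  else (finset.set0, [ffun=> None]).

Fixpoint efun_choice c (j : nat) : @emap G :=
  [fmap g : (if j is i.+1 then next_dom (efun_choice c i) else src_dom w)
     => zval c (word (fsval g))]%fmap.

Lemma node_in_neq c h x y : choice_fun c -> node c ((y, true) :: (x, false) :: h) ->
  y != x /\ br y = br x.
Proof.
move=> [_ cin] [_ [Y [YC Yx /cin yY]]]; split; last exact: bC_br YC yY.
by apply: contraNneq Yx => yx; rewrite -yx (bC_part YC yY).
Qed.

Lemma node_reduced c h : choice_fun c -> node c h -> reduced h.
Proof.
move=> hc; elim: h => [|[x b] h IH] //.
rewrite /reduced; case: b => nh; last first.
  have [nh' _ hx] := nh; move: (IH nh') hx; case: h {IH nh nh'} => [|[z d] h] //= rh.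
  by rewrite rh andbT /linv /=; apply: contraNneq => ->.
have [nh' _] := nh; move: (IH nh') nh; case: h {IH nh'} => [|[z []] h] //= rh nh.
  by case: nh => _ [].
have [yz _] := node_in_neq hc nh; move: rh; rewrite /reduced /= => ->.
by rewrite andbT /linv /=; apply: contraNneq yz => -[->].
Qed.

Lemma node_size c h : node c h -> odd (size h) = if h is (_, b) :: _ then ~~ b else false.
Proof.
elim: h => [|[x b] h IH] // nh; have nh' : node c h by move: nh => /=; case: b => -[].
rewrite /= (IH nh'); move: nh; case: b; case: h {IH nh'} => [|[y []] h] //=.
- by case.
- by case.
- by case.
Qed.

Lemma src_domP (g : F) : (g \in src_dom w) <-> exists2 e, bs e = w & word g = [:: (e, false)].
Proof.
split=> [/imfsetP[e /=]|[e ew gE]].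
  by move=> /eqP ew ->; exists e.
apply/imfsetP; exists e; last by apply: val_inj; exact: gE.
by rewrite /= ?inE; apply/eqP.
Qed.

Lemma word_eword (g : F) x h (e e' : bE G) : word g = (x, false) :: h -> e != x -> e' != e ->
  word (eword g e e') = (e', false) :: (e, true) :: word g.
Proof.
move=> gE ex e'e.
have -> : word (eword g e e') = rcancel (e', false) (rcancel (e, true) (word g)).
  rewrite /eword /= /fg_mul /= /winv /= /linv /=.
  have /negPf -> : (e, true) != (e', true) by apply: contraNneq e'e => -[->].
  by [].
rewrite gE /= /linv /=.
have /negPf -> : (x, false) != (e, false) by apply: contraNneq ex => -[->].
rewrite /=; have /negPf -> : (e, true) != (e', true) by apply: contraNneq e'e => -[->].
by [].
Qed.

Lemma next_domP (m : @emap G) (g : F) : (g \in next_dom m) <->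
  exists g0 e e', [/\ g0 \in domf m, estep m g0 e e' & g = eword g0 e e'].
Proof.
split=> [/imfset2P[g0 /= g0m [[e e'] /=]]|[g0 [e [e' [g0m st ->]]]]].
  by move=> st ->; exists g0, e, e'.
by apply/imfset2P; exists g0 => //; exists (e, e').
Qed.

Lemma fnd_efun c j (g : F) : (efun_choice c j).[? g]%fmap =
  if g \in domf (efun_choice c j) then Some (zval c (word g)) else None.
Proof.
case: ifPn => gm; last exact: not_fnd.
by rewrite in_fnd; case: j gm => [|j] gm; rewrite /= ffunE.
Qed.

Lemma estep_zval c (m : @emap G) (g : F) x h e e' : word g = (x, false) :: h ->
  m.[? g]%fmap = Some (zval c (word g)) ->
  estep m g e e' <-> [/\ exists Y, [/\ Y \in bC (br x), Y != part x & c (word g) Y = Some e],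
    bs e' = bs e & e' != e].
Proof.
move=> gE mg; rewrite /estep mg /zval; move: (word g) gE => _ ->.
split=> [/and3P[/existsP[Y]]|[[Y [YC Yx cY]] -> ->]].
  rewrite /= ffunE !inE; case: ifP => // /andP[Yx YC] /eqP cY /eqP ee e'e.
  by split=> //; exists Y.
rewrite eqxx andbT /=; apply/andP; split=> //.
by apply/existsP; exists Y; rewrite /= ffunE !inE YC Yx cY.
Qed.

(** The step from [Omega_j] to [Omega_{j+1}] adds two letters without cancellation. *)
Lemma domf_efun c j (g : F) : choice_fun c ->
  (g \in domf (efun_choice c j)) <-> node c (word g) /\ size (word g) = j.*2.+1.
Proof.
move=> hc; elim: j g => [|j IH] g.
  rewrite /=; split=> [/src_domP[e ew ->]|[]]; first by split=> //=; rewrite ew.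
  case gE : (word g) => [|[x b] [|a h]] //=; case: b gE => gE; first by case.
  by move=> [_ [xw] _] _; apply/src_domP; exists x.
have -> : (g \in domf (efun_choice c j.+1)) = (g \in next_dom (efun_choice c j)) by [].
have shape (g0 : F) : node c (word g0) -> size (word g0) = j.*2.+1 ->
    exists x h, word g0 = (x, false) :: h.
  move=> n0 s0; have := node_size n0; rewrite s0 /= odd_double.
  by case: (word g0) => [|[x []] h] // _; exists x, h.
split.
  move=> /next_domP[g0 [e [e' [g0m st gE]]]].
  have [n0 s0] := (IH g0).1 g0m; have [x [h g0E]] := shape g0 n0 s0.
  have fg : (efun_choice c j).[? g0]%fmap = Some (zval c (word g0)).
    by rewrite fnd_efun g0m.
  have [[Y [YC Yx cY]] ss e'e] := (estep_zval e e' g0E fg).1 st.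
  have ex : e != x.
    by have [_ cin] := hc; apply: contraNneq Yx => <-; rewrite (bC_part YC (cin _ _ _ cY)).
  rewrite gE (word_eword g0E ex e'e) g0E /=; split.
    split=> //; first split=> //.
    - by move: n0; rewrite g0E.
    - by exists Y; split=> //; rewrite -g0E.
    - by rewrite ss.
    - by apply: contraNneq e'e => -[->].
  by move: s0; rewrite g0E /= => -[->]; rewrite doubleS.
move=> [ng]; rewrite doubleS => sz.
have [e' [b' [e [b [x [d [h gE]]]]]]] : exists e' b' e b x d h,
    word g = [:: (e', b'), (e, b), (x, d) & h].
  move: sz; case: (word g) => [|[e' b'] [|[e b] [|[x d] h]]] //= _.
  by exists e', b', e, b, x, d, h.
move: sz; rewrite gE /= => -[sh].
rewrite gE in ng; have := node_size ng; rewrite /= sh /= odd_double /=.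
case: b' gE ng => // gE ng _; move: ng => /=; case: b gE => gE; last by case.
move=> [[nx]]; case: d gE nx => // gE nx [Y [YC Yx cY]] [ss] ee'.
have rh : reduced ((x, false) :: h) by apply: (node_reduced hc); exact: nx.
pose g0 : F := FreeGroup rh.
have g0m : g0 \in domf (efun_choice c j) by apply/IH; split=> //=; rewrite sh.
have fg : (efun_choice c j).[? g0]%fmap = Some (zval c (word g0)).
  by rewrite fnd_efun g0m.
have e'e : e' != e by apply: contraNneq ee' => ->.
have ex : e != x.
  by have [_ cin] := hc; apply: contraNneq Yx => <-; rewrite (bC_part YC (cin _ _ _ cY)).
apply/next_domP; exists g0, e, e'; split=> //.
  by apply/(estep_zval e e' (erefl : word g0 = (x, false) :: h) fg); split=> //; exists Y.
apply: val_inj.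
exact: (etrans gE (esym (word_eword (erefl : word g0 = (x, false) :: h) ex e'e))).
Qed.


Lemma zval_Zset c h e : choice_fun c -> zval c ((e, false) :: h) \in Zset e.
Proof.
move=> [ctot cin]; rewrite inE /= eqxx; apply: prodsetP => Y YP; rewrite ffunE.
  have YC : Y \in bC (br e) by move: YP; rewrite !inE => /andP[].
  have [y cy] := ctot ((e, false) :: h) _ _ YC; rewrite YP.
  by exists y => //; exact: cin cy.
by rewrite (negPf YP).
Qed.

Lemma estep_efun c j (g : F) e e' : choice_fun c -> estep (efun_choice c j) g e e' ->
  exists x h, [/\ g \in domf (efun_choice c j), word g = (x, false) :: h, e != x & e' != e].
Proof.
move=> hc st; have gm : g \in domf (efun_choice c j).
  apply/negP => /negP gm; move: st; rewrite /estep not_fnd //.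
have [n0 s0] := (domf_efun j g hc).1 gm.
have [x [h gE]] : exists x h, word g = (x, false) :: h.
  have := node_size n0; rewrite s0 /= odd_double.
  by case: (word g) => [|[x []] h] // _; exists x, h.
have fg : (efun_choice c j).[? g]%fmap = Some (zval c (word g)) by rewrite fnd_efun gm.
have [[Y [YC Yx cY]] ss e'e] := (estep_zval e e' gE fg).1 st.
exists x, h; split=> //; have [_ cin] := hc; apply: contraNneq Yx => <-.
by rewrite (bC_part YC (cin _ _ _ cY)).
Qed.

Lemma efun_choiceP c : choice_fun c -> is_efun (efun_choice c).
Proof.
move=> hc [|j] /=.
  exists w; split=> // e ew; exists (zval c [:: (e, false)]); last exact: zval_Zset.
  have := fnd_efun c 0 (fg_gen e); rewrite ifT //.
  by apply/src_domP; exists e.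
split=> // g e e' st; have [x [h [gm gE ex e'e]]] := estep_efun hc st.
exists (zval c (word (eword g e e'))); last first.
  by rewrite (word_eword gE ex e'e); exact: zval_Zset.
have := fnd_efun c j.+1 (eword g e e'); rewrite ifT //.
by apply/next_domP; exists g, e, e'.
Qed.

(** Every choice function agrees with one read off from a sequence of finite maps, as long
    as the latter satisfies the conditions of an [E]-function; elsewhere the choices are
    arbitrary. *)
Definition read_choice (f : nat -> @emap G) h Y : option (bE G) :=
  let a := if insub h : option F is Some g then
      (if (f (size h)./2).[? g]%fmap is Some a then a.2 Y else None) else None in
  if [pick y in Y | a == Some y] is Some y then Some y else [pick y in Y].

Lemma read_choice_fun f : choice_fun (read_choice f).
Proof.
split=> [h u Y YC|h Y y]; rewrite /read_choice.
  case: pickP => [y _|_]; first by exists y.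
  case: pickP => [y _|Y0]; first by exists y.
  by have [y] := bC_neq0 YC; rewrite Y0.
case: pickP => [z /andP[zY _] [<-] //|_].
by case: pickP => // z zY [<-].
Qed.

Lemma read_choiceE (f : nat -> @emap G) (g : F) (a : @zelt G) Y y : (f (size (word g))./2).[? g]%fmap = Some a ->
  a.2 Y = Some y -> y \in Y -> read_choice f (word g) Y = Some y.
Proof.
move=> fg aY yY; rewrite /read_choice (_ : insub (word g) = Some g); last exact: valK.
rewrite fg aY; case: pickP => [z /andP[_ /eqP[->]] //|no].
by move: (no y); rewrite /= yY eqxx.
Qed.

(** The domains agree by the recursion for [Omega_{j+1}], and the values because the
    coordinates of an element of [Z_X] are exactly what the choice function reads. *)
Lemma efun_read (f : nat -> @emap G) (J : nat -> Prop) :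
  (forall j, J j.+1 -> J j) -> (forall j, J j -> efun_cond f j) ->
  domf (f 0%N) = src_dom w ->
  forall j, J j -> efun_choice (read_choice f) j = f j.
Proof.
move=> Jdown Jf f0; set c := read_choice f; have hc : choice_fun c := read_choice_fun f.
have val_ok j (g : F) e h a : word g = (e, false) :: h -> (size (word g))./2 = j ->
    (f j).[? g]%fmap = Some a -> a \in Zset e -> a = zval c (word g).
  move=> gE sj fg; rewrite inE => /andP[/eqP a1 a2].
  rewrite (surjective_pairing a) a1 {1}gE /=; congr pair; apply/ffunP => Y.
  rewrite ffunE; case: ifP => YP; last by apply: prodset_none a2 _; rewrite YP.
  have [y aY yY] := prodset_some a2 YP; rewrite aY -gE.
  by apply/esym/read_choiceE => //; [rewrite sj; exact: fg|exact: aY].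
elim=> [|j IH] Jj; apply/fmapP => g; rewrite fnd_efun; case: ifPn => gm.
- have [w' [dw' fw']] := Jf _ Jj.
  have /src_domP[e ew gE] : g \in src_dom w by [].
  have gg : g = fg_gen e by exact: val_inj.
  have ew' : bs e = w'.
    have : g \in src_dom w' by rewrite (etrans (esym dw') f0).
    rewrite gg => /imfsetP[e' /=]; rewrite /= => /eqP <- /(congr1 (@word _)) [->] //.
  have [a fa aZ] := fw' e ew'; rewrite gg fa; congr Some.
  by apply/esym/(val_ok 0%N _ e [::]).
- by have := gm : g \notin src_dom w; rewrite -f0 => gm'; rewrite not_fnd.
- have [dj fj] := Jf _ Jj; have IHj := IH (Jdown _ Jj).
  have /next_domP[g0 [e [e' [g0m st gE]]]] : g \in next_dom (efun_choice c j) by [].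
  have [x [h [_ g0E ex e'e]]] := estep_efun hc st.
  rewrite IHj in st; have [a fa aZ] := fj _ _ _ st; rewrite gE fa; congr Some.
  have wE := word_eword g0E ex e'e.
  apply/esym/(val_ok j.+1 _ e' _ _ wE) => //.
  have [_ s0] := (domf_efun j g0 hc).1 g0m; rewrite wE.
  change ((size (word g0)).+2./2 = j.+1); rewrite s0.
  exact: (half_bit_double j.+1 true).
- have [dj fj] := Jf _ Jj; have IHj := IH (Jdown _ Jj).
  by have := gm : g \notin next_dom (efun_choice c j); rewrite IHj -dj => gm'; rewrite not_fnd.
Qed.

Definition agree_below c c' n : Prop :=
  forall x h, node c ((x, false) :: h) -> ((size h).+1 < n)%N ->
    zval c ((x, false) :: h) = zval c' ((x, false) :: h).

Lemma efun_agree c c' r : choice_fun c -> choice_fun c' ->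
  (forall j, (j < r)%N -> efun_choice c j = efun_choice c' j) <-> agree_below c c' r.*2.
Proof.
move=> hc hc'; split=> [ff x h nh sh|cc' j].
  have rh := node_reduced hc nh; pose g : F := FreeGroup rh.
  have := node_size nh; rewrite /= => oh; have {}oh : ~~ odd (size h) by rewrite oh.
  pose j := (size h)./2; have sj : (size h).+1 = j.*2.+1 by rewrite /j even_halfK.
  have jr : (j < r)%N by rewrite -ltn_Sdouble -sj.
  have gm : g \in domf (efun_choice c j) by apply/(domf_efun j g hc); split=> //=.
  have := fnd_efun c j g; rewrite gm ff // fnd_efun -ff // gm => -[<-] //.
have zz k (g : F) : (k < r)%N -> g \in domf (efun_choice c k) ->
    zval c (word g) = zval c' (word g).
  move=> kr /(domf_efun k g hc)[ng sg]; have := node_size ng; rewrite sg /= odd_double.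
  case gE : (word g) => [|[x []] h] // _; rewrite gE in ng sg; apply: cc' => //.
  by rewrite (sg : (size h).+1 = k.*2.+1) ltn_Sdouble.
elim: j => [|j IH] jr; apply/fmapP => g; rewrite !fnd_efun.
  have -> : (g \in domf (efun_choice c' 0)) = (g \in domf (efun_choice c 0)) by [].
  by case: ifP => // gm; rewrite (zz 0%N).
have -> : (g \in domf (efun_choice c' j.+1)) = (g \in domf (efun_choice c j.+1)).
  by rewrite /= IH // ltnW.
by case: ifP => // gm; rewrite (zz j.+1).
Qed.

End ChoiceTrees.

(** * The model of a set representation *)

Section Model.
Context {R : realType} {G : bipGraph} (M : graphSystem R G) {I : choiceType}.
Variables (p : vertex G -> set I) (t : arrow G -> I -> I -> Prop).
Hypothesis rep : set_rep p t.
Local Notation O := (gsO M).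
Local Notation B := (B0 M).
Local Notation H := (ell2_hilbert R I).

Definition model_v n : vertex (canon G n) -> bop_cstar H := rep_v R (canon_rep p t n).1.
Definition model_e n : arrow (canon G n) -> bop_cstar H := rep_e R (canon_rep p t n).2.

Lemma star_hom_comp (A1 A2 A3 : cstarAlg R) (f : A1 -> A2) (g : A2 -> A3) :
  star_hom f -> star_hom g -> star_hom (g \o f).
Proof.
move=> [fL fM fS] [gL gM gS]; split=> [k a b|a b|a] /=; first by rewrite fL gL.
  by rewrite fM gM.
by rewrite fS gS.
Qed.

Lemma star_hom_sum (A1 A2 : cstarAlg R) (f : A1 -> A2) (J : finType) (P : pred J) (F : J -> A1) :
  star_hom f -> f (\sum_(j | P j) F j) = \sum_(j | P j) f (F j).
Proof.
move=> [fL _ _]; have f0 : f 0 = 0.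
  by have := fL 1 0 0; rewrite scaler0 addr0 scale1r => /eqP; rewrite -subr_eq subrr => /eqP <-.
apply: (big_morph f) => // a b.
by rewrite -{1}(scale1r a) fL scale1r.
Qed.

(** The representations of the graphs [E_n] on one set are compatible with the canonical
    maps, hence factor through the inductive limit. *)
Lemma model_hom : exists h : O -> bop_cstar H, [/\ star_hom h,
  forall n v, h (ev M (v : vertex (canon G n))) = model_v v &
  forall n x, h (et M (x : bE (canon G n))) = model_e x].
Proof.
have relP n : graph_relations (@model_v n) (@model_e n).
  by apply: rep_graph_relations; exact: canon_set_rep.
pose g n := sval (cid ((gsAP M n).2 _ _ _ (relP n))).
have gP n : unique (fun f : gsA M n -> bop_cstar H => [/\ star_hom f,
    forall v, f (gsp M v) = model_v v & forall e, f (gst M e) = model_e e]) (g n).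
  exact: svalP (cid ((gsAP M n).2 _ _ _ (relP n))).
have gS n : star_hom (g n) by have [[]] := gP n.
have gc n a : g n.+1 (gsphi a) = g n a.
  have [[_ gv1 ge1] _] := gP n.+1; have [_ gu] := gP n.
  have [phiS phiw phiu phix] := gsphiP M n.
  rewrite (gu (g n.+1 \o @gsphi R G M n)) //; split=> [|[u|v]|x] /=.
  - exact: star_hom_comp.
  - rewrite phiu star_hom_sum // [RHS](rep_v_split (canon_set_rep n rep)).
    by apply: eq_bigr => v _; rewrite gv1.
  - by rewrite phiw gv1.
  - rewrite phix star_hom_sum // [RHS](rep_e_split (canon_set_rep n rep)).
    by apply: eq_bigr => a' _; have [_ _ ->] := gS n.+1; rewrite ge1.
have [_ _ /(_ (bop_cstar H) g gS gc)[h [[hS hg] _]]] := gsOP M.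
exists h; split=> // n v; have [[_ gv ge] _] := gP n.
  by rewrite /ev /imv hg gv.
by rewrite /et hg ge.
Qed.

Definition delta_fun (q i : I) : cplx R := if i == q then 1 else 0.

Lemma esq_delta q : esq setT (delta_fun q) = 1%E.
Proof.
have -> : esq setT (delta_fun q) = esq [set q] (delta_fun q).
  rewrite /esq [RHS]esum_mkcond; apply: eq_esum => i _; rewrite /delta_fun.
  case: ifPn => [/eqP ->|iq]; first by rewrite mem_set.
  by rewrite memNset ?sqn0 // => /= iq'; rewrite iq' eqxx in iq.
by rewrite /esq esum_set1 /delta_fun eqxx ?lee_fin ?sqn_ge0 // /sqn /= expr1n expr0n addr0.
Qed.

Lemma delta_funP q : delta_fun q \in @ell2_pred R I.
Proof. by apply/asboolP; rewrite esq_delta ltey. Qed.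

Definition delta q : H := Ell2 (delta_funP q).

Lemma coord_delta q i : coord (delta q) i = if i == q then 1 else 0.
Proof. by []. Qed.

Lemma hnorm_delta q : hnorm (delta q) = 1.
Proof. by rewrite /hnorm /hsq /= /psq esq_delta sqrtr1. Qed.

Lemma coordZ (k : cplx R) (x : H) i : coord (k *: x) i = k * coord x i.
Proof. exact: (ell2ZE k (x : ell2 R I) i). Qed.

Lemma coordZ_op (k : cplx R) (A : bop_cstar H) x i :
  coord ((k *: A) x) i = k * coord (A x) i.
Proof.
have -> : (k *: A) x = k *: A x by exact: (bopZE k (A : bop H) x).
exact: coordZ.
Qed.

Lemma coord_norm (x : H) i : complex.Re `|coord x i| <= hnorm x.
Proof. by rewrite -sqn_norm ler_sqrt ?hsq_ge0 //; exact: psq_coord. Qed.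

Variable h : O -> bop_cstar H.
Hypotheses (hS : star_hom h) (hv : forall n v, h (ev M (v : vertex (canon G n))) = model_v v)
  (he : forall n x, h (et M (x : bE (canon G n))) = model_e x).

(** Elements mapped to operators that are diagonal at [q], together with their adjoints, form
    a closed subalgebra: the matrix coefficients are contractive in [b]. *)
Lemma model_diag q b : B b -> h b (delta q) = coord (h b (delta q)) q *: delta q.
Proof.
pose S : set O := [set b | forall i, i != q ->
  coord (h b (delta q)) i = 0 /\ coord (h (star b) (delta q)) i = 0].
have diag a : (forall i, i != q -> coord (h a (delta q)) i = 0) ->
    h a (delta q) = coord (h a (delta q)) q *: delta q.
  move=> a0; apply: coord_ext => i; rewrite coordZ coord_delta.
  by case: eqVneq => [->|/a0 ->]; rewrite ?mulr1 ?mulr0.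
suff BS : B b -> S b by move=> /BS Sb; apply: diag => i /Sb[].
have lin k a c i : coord (h (k *: a + c) (delta q)) i =
    k * coord (h a (delta q)) i + coord (h c (delta q)) i.
  by have [-> _ _] := hS; rewrite coordD coordZ_op.
have zero i : coord (h 0 (delta q)) i = 0.
  by have := homZ hS 0 0; rewrite !scale0r => ->.
apply: B0_ind => [|n v i iq]; last first.
  have e : coord (h (ev M v) (delta q)) i = 0.
    rewrite hv /model_v /rep_v.
    have [pi|npi] := pselect ((canon_rep p t n).1 v i).
      by rewrite (popE _ (rdiag_inj _) (conj erefl pi)) coord_delta (negPf iq).
    by rewrite pop0 // => j [_].
  by rewrite ev_star.
split=> [i iq|k a c Sa Sc i iq|a c Sa Sc i iq|a Sa i iq|].
- by rewrite star0 zero.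
- have [a0 sa0] := Sa i iq; have [c0 sc0] := Sc i iq.
  by rewrite starD starZ !lin a0 c0 sa0 sc0 !mulr0 addr0.
- have da := diag _ (fun i iq => (Sa i iq).1); have dc := diag _ (fun i iq => (Sc i iq).1).
  have da' := diag _ (fun i iq => (Sa i iq).2); have dc' := diag _ (fun i iq => (Sc i iq).2).
  have [a0 sa0] := Sa i iq; have [c0 sc0] := Sc i iq.
  rewrite starM !(homM hS) dc da' !bopZ.
  split; rewrite coordZ.
    by rewrite a0 mulr0.
  by rewrite sc0 mulr0.
- by rewrite starK; have [] := Sa i iq.
have close (f : O -> O) : (forall a c, f (a - c) = f a - f c) -> (forall a, nrm (f a) = nrm a) ->
    forall l i, (forall e, 0 < e -> exists2 a, coord (h (f a) (delta q)) i = 0 & nrm (a - l) <= e) ->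
    coord (h (f l) (delta q)) i = 0.
  move=> fB fN l i lim; apply/eqP; rewrite -normr_eq0 -ReN; apply/eqP; congr (_%:C).
  apply/le_anti; rewrite -[X in _ && X]ler0c ReN normr_ge0 andbT.
  apply/ler_addgt0Pr => e /lim[a a0 al]; rewrite add0r; apply: le_trans al.
  have -> : coord (h (f l) (delta q)) i = - coord (h (f (a - l)) (delta q)) i.
    by have := lin (- 1) (f l) (f a) i; rewrite scaleN1r addrC -fB a0 addr0 mulN1r => ->; rewrite opprK.
  rewrite normrN (le_trans (coord_norm _ _)) // (le_trans (hom_norm hS _ _)) //.
  by rewrite hnorm_delta mulr1 fN.
apply/closedP => l lim i iq; split.
  apply: (close id) => // e /lim[a Sa al]; exists a => //; by have [] := Sa i iq.
apply: (close (@star R O)) => [a c|a|e /lim[a Sa al]].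
- exact: starB.
- exact: nrm_star.
- by exists a => //; have [] := Sa i iq.
Qed.

(** The vector state at [q] is multiplicative on diagonal operators. *)
Lemma model_point q v : p v q -> exists xi : Omega M,
  forall b, B b -> val xi b = coord (h b (delta q)) q.
Proof.
move=> pv; pose f b : cplx R := if pselect (B b) then coord (h b (delta q)) q else 0.
have fE b : B b -> f b = coord (h b (delta q)) q by rewrite /f; case: pselect.
have BS := B0_subalg M.
have fP : is_character B f.
  split=> [k a b Ba Bb|a b Ba Bb||a nB].
  - have [_ Bl _ _ _] := BS; rewrite !fE //; last exact: Bl.
    by have [-> _ _] := hS; rewrite coordD coordZ_op.
  - rewrite !fE //; last exact: (subalgM BS Ba Bb).
    by rewrite (homM hS) {1}(model_diag q Bb) bopZ coordZ mulrC.
  - exists (ev M (v : vertex (canon G 0))); first exact: B0_ev.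
    rewrite fE; last exact: B0_ev.
    rewrite hv /model_v /rep_v (popE _ (rdiag_inj _) (conj erefl pv)) coord_delta eqxx.
    exact: oner_neq0.
  - by rewrite /f; case: pselect.
have [xi xiE] := Omega_mk fP; exists xi => b Bb; by rewrite xiE fE.
Qed.

Variable pt : I -> Omega M.
Definition points_at q := forall b, B b -> val (pt q) b = coord (h b (delta q)) q.

Lemma model_at q v : points_at q -> p v q -> val (pt q) (ev M (v : vertex (canon G 0))) = 1.
Proof.
move=> pq pv; rewrite pq; last exact: B0_ev.
by rewrite hv /model_v /rep_v (popE _ (rdiag_inj _) (conj erefl pv)) coord_delta eqxx.
Qed.

Lemma model_range q (x : bE (canon G 0)) : points_at q ->
  (exists j, t x q j) -> val (pt q) (et M x ** star (et M x)) = 1.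
Proof.
move=> pq [j tx]; rewrite pq; last exact: B0_range.
have [hL hM hstar] := hS; have tI := rep_inj rep x.
have -> : h (et M x ** star (et M x)) = pop (rcomp (t x) (rconv (t x))).
  have hx : h (et M x) = pop (t x) by exact: (he x).
  by rewrite hM hstar hx pop_star // pop_mul //; exact: rconv_inj.
rewrite (@popE _ _ _ _ q q) ?coord_delta ?eqxx //; last by exists j.
by apply: rcomp_inj => //; exact: rconv_inj.
Qed.

(** [T] moves the basis vector at [q0] to the one at [q1]. *)
Lemma model_Theta (x : bE (canon G 0)) q0 q1 : points_at q0 -> points_at q1 ->
  t x q1 q0 -> Theta (et M x) (pt q0) (pt q1).
Proof.
move=> pq0 pq1 tx; have tI := rep_inj rep x; split=> [||b Bb].
- rewrite et_initial; apply: model_at => //.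
  exact: (@rep_src _ _ _ _ rep x q1 q0 tx).
- by apply: model_range => //; exists q0.
have [_ _ _ Bc _] := et_normaliser M x.
rewrite pq1 // pq0; last exact: Bc.
have hx : h (et M x) = pop (t x) by exact: (he x).
have [_ _ hstar] := hS.
rewrite !(homM hS) hstar hx pop_star //.
rewrite (@popE _ _ (rconv (t x)) _ q0 q1) //; last exact: rconv_inj.
congr (coord (h b _) q1); apply: coord_ext => i; rewrite coord_delta.
have [-> |iq] := eqVneq i q1; first by rewrite (popE _ tI tx) coord_delta eqxx.
have [[j tj]|nt] := pselect (exists j, t x i j); last first.
  by rewrite pop0 // => j tj; apply: nt; exists j.
rewrite (popE _ tI tj) coord_delta; case: eqVneq => // jq.
by case/eqP: iq; rewrite jq in tj; have [_ Ti] := tI; exact: Ti tj tx.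
Qed.

End Model.

(** * The tree of a choice function *)

Section TreeModel.
Context {G : bipGraph} (w : bV1 G) (c : seq (bE G * bool) -> {set bE G} -> option (bE G)).
Hypothesis hc : choice_fun c.
Local Notation I := (seq (bE G * bool)).
Implicit Types (h : I) (x y : bE G).

Definition tree_p (v : vertex G) : set I :=
  match v with
  | inl u => [set h | node w c h /\ exists x h', h = (x, false) :: h' /\ br x = u]
  | inr u => [set h | node w c h /\ word_vertex w h = Some u]
  end.

(** Left multiplication by [x] in the free group, between nodes. *)
Definition tree_t (x : bE G) : I -> I -> Prop := fun h1 h0 =>
  [/\ node w c h1, node w c h0, word_vertex w h0 = Some (bs x) &
      h1 = (x, false) :: h0 \/ h0 = (x, true) :: h1].

Lemma tree_t_head x h1 h0 : tree_t x h1 h0 -> exists e h', h1 = (e, false) :: h' /\ br e = br x.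
Proof.
case=> n1 n0 _ [->|h0E]; first by exists x, h0.
move: n0; rewrite h0E => n0; have := n0 => -[_]; case: h1 h0E n0 {n1} => [|[e []] h'] // _ n0 _.
by exists e, h'; have [_ ->] := node_in_neq hc n0.
Qed.

(** At a node ending in [br e] with last letter [e], the colour of [e] is covered by the last
    step undone and every other colour by the chosen arrow. *)
Lemma tree_set_rep : @set_rep I G tree_p tree_t.
Proof.
have [ctot cin] := hc.
split.
- move=> [u|u] [u'|u'] h /= [_ hu] [_ hu'].
  + by move: hu hu' => [x [h' [-> <-]]] [y [h'' [[-> _] <-]]].
  + by move: hu hu' => [x [h' [-> _]]].
  + by move: hu' => [x [h' [hE _]]]; rewrite hE in hu.
  + by move: hu'; rewrite hu => -[->].
- move=> x; split=> [h1 h h' [n1 nh _ e] [_ nh' _ e']|h1 h1' h [n1 nh _ e] [n1' _ _ e']].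
    case: e e' => [E|E] [E'|E'].
    + by move: E'; rewrite E => -[].
    + by move: nh'; rewrite E' E => /(node_in_neq hc)[]; rewrite eqxx.
    + by move: nh; rewrite E E' => /(node_in_neq hc)[]; rewrite eqxx.
    + by rewrite E E'.
  case: e e' => [E|E] [E'|E'].
  + by rewrite E E'.
  + by move: n1; rewrite E E' => -[_ _]; rewrite eqxx.
  + by move: n1'; rewrite E' E => -[_ _]; rewrite eqxx.
  + by move: E'; rewrite E => -[].
- by move=> x h1 h0 [n1 n0 v0 _]; split.
- move=> x h1 h0 tx; have [e [h' [h1E ee]]] := tree_t_head tx; case: tx => n1 _ _ _.
  by split=> //; exists e, h'; rewrite h1E ee.
- move=> x h0 [n0 v0]; have [hx|hx] := eqVneq (ohead h0) (Some (x, true)); last first.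
    by exists ((x, false) :: h0); split=> //; left.
  case: h0 n0 v0 hx => [|a h1] // n0 v0 [aE]; rewrite aE in n0 v0 *.
  by exists h1; split=> //; [have [] := n0|right].
- move=> [u|u] X h; last by rewrite inE.
  move=> XC [nh [e [h' [hE eu]]]]; have [eX|eX] := boolP (e \in X).
    exists e => //; exists h'; rewrite hE in nh *; have [nh' v' _] := nh.
    by split=> //; left.
  have [y cy] := ctot h u X XC; have yX := cin _ _ _ cy.
  exists y => //; exists ((y, true) :: h); split=> //=; last by right.
  split=> //; rewrite hE; exists X; split=> //; first by rewrite eu.
    by apply: contraNneq eX => ->; exact: mem_part.
  by rewrite -hE.
- move=> [u|u] X y z h h1 h2; last by rewrite inE.
  move=> XC yX zX ty tz; have [e [h' [hE ey]]] := tree_t_head ty.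
  have split_ (x : bE G) k : x \in X -> tree_t x h k -> (x = e /\ part e = X) \/
      (part e != X /\ c h X = Some x).
    move=> xX [_ nk _ [E|E]].
      by left; move: E; rewrite hE => -[-> _]; rewrite (bC_part XC xX).
    right; move: nk; rewrite E => -[_]; rewrite hE => -[Y [YC Ye cY]].
    have xY := cin _ _ _ cY.
    have YX : Y = X by rewrite -(bC_part YC xY) (bC_part XC xX).
    by rewrite -YX eq_sym Ye cY.
  case: (split_ _ _ yX ty) (split_ _ _ zX tz) => [[-> pe]|[pe cy]] [[-> pe']|[pe' cz]] //.
  + by rewrite pe eqxx in pe'.
  + by rewrite pe' eqxx in pe.
  + by move: cz; rewrite cy => -[].
Qed.

End TreeModel.

Section Points.
Context {R : realType} {G : bipGraph} (M : graphSystem R G).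
Implicit Types (xi eta zeta : Omega M) (w : bV1 G) (h : seq (bE G * bool)).

Lemma thetaE (x : bE G) xi eta : theta x xi eta <-> Theta (et M (x : bE (canon G 0))) xi eta.
Proof.
rewrite /theta /Theta et_initial.
by split=> -[h1 h2 h3]; split.
Qed.

Lemma theta_word_cons h x b xi zeta eta : theta_word h xi zeta ->
  (if b then theta x eta zeta else theta x zeta eta) -> theta_word ((x, b) :: h) xi eta.
Proof. by move=> hz; exists zeta. Qed.

Lemma theta_word_fun h xi eta eta' : theta_word h xi eta -> theta_word h xi eta' -> eta = eta'.
Proof.
elim: h eta eta' => [|[x b] h IH] eta eta' /=; first by move=> -> ->.
move=> [z hz tz] [z' hz' tz']; have zz := IH _ _ hz hz'; rewrite -zz in tz'.
case: b tz tz' => /thetaE tz /thetaE tz'; first exact: Theta_inj (et_normaliser _ _) tz tz'.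
exact: Theta_fun tz tz'.
Qed.

(** Every assignment of choices is realised by a point: a coherent family of points
    indexed by the nodes of the tree, moved into each other by the maps [theta]. *)
Lemma tree_points w (c : seq (bE G * bool) -> {set bE G} -> option (bE G)) : choice_fun c ->
  exists pt : seq (bE G * bool) -> Omega M,
  [/\ Omega_at M (inr w) (pt [::]),
      forall h, node w c h -> theta_word h (pt [::]) (pt h) &
      forall h1 h0 x, tree_t w c x h1 h0 -> theta x (pt h0) (pt h1)].
Proof.
move=> hc; have rep := tree_set_rep w hc.
have [hm [hS hv he]] := model_hom M rep.
have root : tree_p w c (inr w) [::] by [].
have [xi0 xi0P] := model_point hS hv root.
have ex h : exists xi : Omega M, node w c h -> forall b, B0 M b -> val xi b = coord (hm b (delta h)) h.
  have [nh|nh] := pselect (node w c h); last by exists xi0.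
  have [v hvv] : exists v : vertex G, tree_p w c v h.
    have := nh; case E : h => [|[x b] h'] nh'; first by exists (inr w).
    case: b nh' E => nh' E; [exists (inr (bs x))|exists (inl (br x))]; split=> //.
    by exists x, h'.
  by have [xi xiP] := model_point hS hv hvv; exists xi.
have [pt ptP] := choice ex.
have tT h1 h0 x : tree_t w c x h1 h0 -> theta x (pt h0) (pt h1).
  move=> tx; have [n1 n0 _ _] := tx; apply/thetaE.
  exact: (model_Theta rep hS hv he (ptP _ n0) (ptP _ n1) tx).
exists pt; split=> //; first exact: (model_at hv (ptP [::] I) root).
elim=> [|[x b] h IH] // nh.
have nh' : node w c h by move: nh => /=; case: b => -[].
apply: (theta_word_cons (IH nh')); case: b nh => nh; apply: tT.
  by split=> //; right.
by have [_ hx _] := nh; split=> //; left.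
Qed.

End Points.

(** * The tree of a point *)

Section PointTrees.
Context {R : realType} {G : bipGraph} (M : graphSystem R G) (w : bV1 G).
Implicit Types (xi eta zeta : Omega M) (h : seq (bE G * bool)) (x y : bE G).

Lemma Omega_atE xi (u : bV1 G) : Omega_at M (inr u) xi <-> at_level (u : level G 1) xi.
Proof. by rewrite /Omega_at /Aset /at_level /= -[imv M _]/(ev M (inr u : vertex (canon G 0))) ev_next. Qed.

Lemma theta_src x xi eta : theta x xi eta -> at_level (bs x : level G 1) xi.
Proof. by move/thetaE/Theta_src. Qed.

Lemma theta_fun x xi eta eta' : theta x xi eta -> theta x xi eta' -> eta = eta'.
Proof. by move=> /thetaE h /thetaE; exact: Theta_fun h. Qed.

Lemma theta_inj x xi xi' eta : theta x xi eta -> theta x xi' eta -> xi = xi'.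
Proof. by move=> /thetaE h /thetaE; exact: Theta_inj (et_normaliser _ _) h. Qed.

Lemma sim_src m (u : bV1 G) zeta zeta' :
  at_level (u : level G 1) zeta -> at_level (u : level G 1) zeta' ->
  sim m.+1 zeta zeta' <-> forall x eta eta', bs x = u -> theta x zeta eta ->
    theta x zeta' eta' -> sim m eta eta'.
Proof.
move=> h h'; have := @sim_star _ _ M m 0 u zeta zeta' h h'; rewrite addn1 addn0 => ->.
by split=> s x eta eta' xu xe xe'; apply: (s x) => //; apply/thetaE.
Qed.

Lemma sim_rng m (v : nextV1 G) eta eta' :
  at_level (v : level G 2) eta -> at_level (v : level G 2) eta' ->
  sim m.+2 eta eta' <-> forall x xi xi', tent v (part x) = Some x -> theta x xi eta ->
    theta x xi' eta' -> sim m.+1 xi xi'.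
Proof.
move=> h h'; have := @sim_tuple _ _ M m 0 v eta eta' h h'; rewrite addn1 addn2 => <-.
by split=> s x xi xi' xv xe xe'; apply: (s x) => //; apply/thetaE.
Qed.

Lemma Hset_tent xi (v : nextV1 G) y : at_level (v : level G 2) xi ->
  Hset M y xi <-> tent v (part y) = Some y.
Proof.
move=> h; split=> [/at_range[v' h' yv]|yv].
  by rewrite (at_uniq h h').
by apply/(@at_range _ _ M 0 y xi); exists v.
Qed.

(** The arrow of [Y] whose range contains the translate of [xi] by [h], if there is one, and
    any arrow of [Y] otherwise. *)
Definition point_choice xi h (Y : {set bE G}) : option (bE G) :=
  if [pick y in Y | `[< exists2 zeta, theta_word h xi zeta & Hset M y zeta >]] is Some y
  then Some y else [pick y in Y].

Lemma point_choice_fun xi : choice_fun (point_choice xi).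
Proof.
split=> [h u Y YC|h Y y]; rewrite /point_choice.
  case: pickP => [y _|_]; first by exists y.
  case: pickP => [y _|Y0]; first by exists y.
  by have [y] := bC_neq0 YC; rewrite Y0.
case: pickP => [z /andP[zY _] [<-] //|_].
by case: pickP => // z zY [<-].
Qed.

(** The choices at a node are the entries of the tuple of [D_2] under the translate. *)
Lemma point_entry xi x h zeta : theta_word ((x, false) :: h) xi zeta ->
  exists v : nextV1 G, [/\ at_level (v : level G 2) zeta, tent v (part x) = Some x &
    forall Y, Y \in bC (br x) ->
      [pick y in Y | `[< exists2 zeta', theta_word ((x, false) :: h) xi zeta' & Hset M y zeta' >]]
        = tent v Y].
Proof.
move=> hz; have [z _ /thetaE/Theta_tuple[v vz vx]] := hz.
exists v; split=> // Y YC; have [_ _ xv _] := tent_mem vx; rewrite xv in YC.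
have [y vy yY] := tent_some YC; have py := bC_part YC yY.
case: pickP => [y' /andP[y'Y /asboolP[z' hz' Hy']]|no].
  rewrite (theta_word_fun hz' hz) in Hy'.
  by have /(Hset_tent y' vz) := Hy'; rewrite (bC_part YC y'Y).
have := no y; rewrite yY /= => /asboolP; case; exists zeta => //.
by apply/(Hset_tent y vz); rewrite py.
Qed.

Lemma point_choiceE xi x h zeta (v : nextV1 G) Y : theta_word ((x, false) :: h) xi zeta ->
  at_level (v : level G 2) zeta -> Y \in bC (br x) ->
  point_choice xi ((x, false) :: h) Y = tent v Y.
Proof.
move=> hz vz YC; have [v' [vz' vx' vE]] := point_entry hz.
have vv : v' = v := at_uniq vz' vz; subst v'.
rewrite /point_choice vE //.
have [_ _ xv _] := tent_mem vx'; rewrite xv in YC.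
by have [y -> _] := tent_some YC.
Qed.

Lemma word_at h xi zeta : Omega_at M (inr w) xi -> theta_word h xi zeta ->
  forall u, word_vertex w h = Some u -> at_level (u : level G 1) zeta.
Proof.
move=> xw; case: h => [|[x b] h] /=; first by move=> -> u [<-]; apply/Omega_atE.
by move=> [z _]; case: b => // /theta_src hx u [<-].
Qed.

Lemma node_point h xi : Omega_at M (inr w) xi -> node w (point_choice xi) h ->
  exists zeta, theta_word h xi zeta.
Proof.
move=> xw; elim: h => [|[x b] h IH] nh; first by exists xi.
have nh' : node w (point_choice xi) h by move: nh => /=; case: b => -[].
have [z hz] := IH nh'; case: b nh.
  move=> [_]; case: h {IH nh'} hz => [|[e []] h] // hz [Y [YC Ye cY]].
  have [v [vz ve vE]] := point_entry hz.
  have vx : tent v Y = Some x by rewrite -(point_choiceE hz vz YC).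
  have [_ _ _ px] := tent_mem vx.
  have xN := normaliser_star (et_normaliser M (x : bE (canon G 0))).
  have [|z' z'T] := @Theta_ex _ _ M _ z xN.
    by rewrite starK; apply/(Hset_tent x vz); rewrite px.
  exists z', z => //; apply/thetaE; have := Theta_sym xN z'T.
  by rewrite starK.
move=> [_ hv _]; have zx := word_at xw hz hv.
have [z' z'T] := @Theta_exists _ _ M 0 x z zx.
by exists z', z => //; apply/thetaE.
Qed.

(** On the tree the translates exist, and then the choices are the coordinates of [f_j]. *)
Lemma efun_ofE xi : Omega_at M (inr w) xi ->
  forall j, efun_of M w xi j = efun_choice w (point_choice xi) j.
Proof.
move=> xw; have hc := point_choice_fun xi.
have vals j (g : freeGroup (bE G)) : g \in domf (efun_choice w (point_choice xi) j) ->
    efun_val xi g = zval (point_choice xi) (word g).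
  move=> /(domf_efun w j g hc)[ng sg]; have := node_size ng; rewrite sg /= odd_double.
  rewrite /efun_val /zval; case gE : (word g) => [|[e []] h] // _; congr pair.
  rewrite gE in ng; have [z hz] := node_point xw ng.
  apply/ffunP => Y; rewrite !ffunE; case: ifP => // YP.
  have YC : Y \in bC (br e) by move: YP; rewrite !inE => /andP[].
  have [v [vz ve vE]] := point_entry hz.
  by rewrite vE // (point_choiceE hz vz).
elim=> [|j IH]; apply/fmapP => g; rewrite fnd_efun.
  case: ifPn => gm; last by rewrite not_fnd.
  by rewrite in_fnd /= ffunE /= (vals 0%N).
have dE : domf (efun_of M w xi j.+1) = domf (efun_choice w (point_choice xi) j.+1).
  by rewrite /= IH.
case: ifPn => gm; last first.
  have gm' : g \notin domf (efun_of M w xi j.+1) by rewrite dE.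
  exact: (not_fnd gm').
have gm' : g \in domf (efun_of M w xi j.+1) by rewrite dE.
by rewrite (in_fnd gm') /= ffunE /= (vals j.+1).
Qed.

Variables (xi xi' : Omega M).
Hypotheses (xw : Omega_at M (inr w) xi) (xw' : Omega_at M (inr w) xi').
Local Notation c := (point_choice xi).
Local Notation c' := (point_choice xi').

Lemma entry_sim x h zeta zeta' : theta_word ((x, false) :: h) xi zeta ->
  theta_word ((x, false) :: h) xi' zeta' -> sim 2 zeta zeta' ->
  forall Y, Y \in bC (br x) -> c ((x, false) :: h) Y = c' ((x, false) :: h) Y.
Proof.
move=> hz hz' s Y YC; have [v [vz _ _]] := point_entry hz.
by rewrite (point_choiceE hz vz YC) (point_choiceE hz' ((s v).1 vz) YC).
Qed.

(** All nodes at distance [2 r - i] from the root are treated together, by induction on [r]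
    and then on [i].  The neighbours of a node are its parent and its children.  The
    children are one step further from the root, which costs one level; the parent is one
    step closer, and agreement on one layer less already gives the level needed there. *)
Lemma sim_of_agree r : agree_below w c c' r.*2 -> forall i h zeta zeta',
  (i + size h = r.*2)%N -> node w c h -> theta_word h xi zeta -> theta_word h xi' zeta' ->
  sim i.+1 zeta zeta'.
Proof.
elim: r => [|r IHr] ag; elim=> [|i IHi] h zeta zeta' ih nh hz hz'.
- move: ih; rewrite add0n => /size0nil h0; rewrite h0 /= in hz hz'; rewrite hz hz'.
  by apply: (@sim_of _ _ _ 1 w); apply/Omega_atE.
- by [].
- have [u hu] : exists u, word_vertex w h = Some u.
    have := node_size nh; rewrite -[size h]add0n ih odd_double.
    by case: (h) => [|[x []] h'] // _; [exists w|exists (bs x)].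
  exact: (@sim_of _ _ _ 1 u _ _ (word_at xw hz hu) (word_at xw' hz' hu)).
have ag' : agree_below w c c' r.*2.
  by move=> x k nk sk; apply: ag => //; rewrite doubleS !ltnS ltnW // ltnW.
have {}IHr := IHr ag'.
have [[u hu]|nu] := pselect (exists u, word_vertex w h = Some u).
  apply/(sim_src i.+1 (word_at xw hz hu) (word_at xw' hz' hu)) => x eta eta' xu xe xe'.
  (* The arrow [x] leads back to the parent of [h], or forward to a child. *)
  have [hx|hx] := eqVneq (ohead h) (Some (x, true)).
    case: h hx nh ih hz hz' hu => [|a h] // [aE]; rewrite aE.
    move=> [nh _] ih [z hz tz] [z' hz' tz'] _.
    rewrite (theta_fun xe tz) (theta_fun xe' tz'); apply: (IHr i h) => //.
    by move: ih; rewrite /= doubleS addSn addnS => -[].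
  apply: (IHi ((x, false) :: h)).
  - by rewrite /= -ih addSn addnS.
  - by split=> //; rewrite hu xu.
  - by exists zeta.
  - by exists zeta'.
case: h nu nh ih hz hz' => [|[x []] h] nu; try by case: nu; eexists.
move=> nh ih hz hz'.
have [v [vz vx vE]] := point_entry hz; have [v' [vz' vx' vE']] := point_entry hz'.
have vv' : v' = v.
  have [_ _ xv _] := tent_mem vx; have [_ _ xv' _] := tent_mem vx'.
  apply: tuple_ext => [|Y YC]; first by rewrite -xv -xv'.
  rewrite -xv' in YC; have [->|Yx] := eqVneq Y (part x); first by rewrite vx vx'.
  rewrite -(point_choiceE hz vz YC) -(point_choiceE hz' vz' YC).
  have := ag x h nh; rewrite -ih /= addSn ltnS leq_addl => /(_ isT) [] /ffunP/(_ Y).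
  by rewrite !ffunE !inE Yx YC.
rewrite vv' in vz'; apply/(sim_rng i vz vz') => y z z' vy tz tz'.
have [YC _ yv py] := tent_mem vy.
have [_ _ xv _] := tent_mem vx.
(* In the colour of the last letter [x] the entry leads back to the parent of the node. *)
have [pxy|pxy] := eqVneq (part y) (part x).
  have yx : y = x by move: vy; rewrite pxy vx => -[].
  rewrite yx in tz tz'; have [z0 hz0 tz0] := hz; have [z0' hz0' tz0'] := hz'.
  rewrite (theta_inj tz tz0) (theta_inj tz' tz0'); apply: (IHr i h) => //; last by case: nh.
  by move: ih; rewrite /= doubleS addSn addnS => -[].
apply: (IHi ((y, true) :: (x, false) :: h)).
- by rewrite /= -ih /= addSn !addnS.
- split=> //; exists (part y); split=> //; first by rewrite xv.
  by rewrite (point_choiceE hz vz) // xv.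
- by exists zeta.
- by exists zeta'.
Qed.

(** Walking along a word costs one level for each letter; as long as two levels are left at
    a node ending in [E^{0,0}], the tuples of [D_2] there coincide, and so do the choices. *)
Lemma agree_of_sim r : sim r.*2.+1 xi xi' -> agree_below w c c' r.*2.
Proof.
move=> s; have P h : node w c h -> (size h <= r.*2)%N -> node w c' h /\
    forall zeta zeta', theta_word h xi zeta -> theta_word h xi' zeta' ->
    sim (r.*2.+1 - size h) zeta zeta'.
  elim: h => [|[x b] h IH] nh sh.
    by split=> // zeta zeta' /= -> ->; rewrite subn0.
  have nh0 : node w c h by clear sh; move: nh => /=; case: b => -[].
  have [nh0' sz] := IH nh0 (ltnW sh); have {}sh : (size h < r.*2)%N := sh.
  case: b nh => nh; last first.
    have [_ hv hx] := nh; split; first by split.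
    move=> zeta zeta' [z hz tz] [z' hz' tz'].
    have := sz _ _ hz hz'; rewrite /= subSS subSn ?(ltnW sh) // => s'.
    exact: ((sim_src _ (word_at xw hz hv) (word_at xw' hz' hv)).1 s' x _ _ erefl tz tz').
  have := nh => -[_]; case: h nh0 nh0' sz sh nh {IH} => [|[e []] h] // nh0 nh0' sz sh nh.
  move=> [Y [YC Ye cY]].
  have := node_size nh0; rewrite /= => oh; have {}oh : ~~ odd (size h) by rewrite oh.
  pose k := (size h)./2; have sk : size h = k.*2 by rewrite /k even_halfK.
  have kr : (k < r)%N by move: sh; rewrite /= sk ltn_Sdouble.
  have dE : (r.*2.+1 - size ((e, false) :: h) = ((r - k).-1).*2.+2)%N.
    rewrite /= subSS sk -doubleB -doubleS prednK // subn_gt0 //.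
  rewrite dE in sz.
  have [z0 hz0] := node_point xw nh0; have [z0' hz0'] := node_point xw' nh0'.
  have s0 := sz _ _ hz0 hz0'.
  have s2 : sim 2 z0 z0' by apply: (@sim_even_down _ _ _ (r - k).-1); rewrite addn2.
  split.
    split=> //; exists Y; split=> //.
    by rewrite -(entry_sim hz0 hz0' s2).
  move=> zeta zeta' [z hz tz] [z' hz' tz'].
  have zz : z = z0 := @theta_word_fun _ _ _ ((e, false) :: h) _ _ _ hz hz0.
  have zz' : z' = z0' := @theta_word_fun _ _ _ ((e, false) :: h) _ _ _ hz' hz0'.
  subst z z'; have [v [vz ve vE]] := point_entry hz0.
  have vx : tent v Y = Some x by rewrite -(point_choiceE hz0 vz YC).
  have [_ _ _ px] := tent_mem vx.
  have -> : (r.*2.+1 - size ((x, true) :: (e, false) :: h) = ((r - k).-1).*2.+1)%N.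
    by rewrite [size _]/= -[(size h).+2]/((size ((e, false) :: h)).+1) subnS dE.
  apply: ((sim_rng _ vz ((s2 v).1 vz)).1 s0 x _ _ _ tz tz').
  by rewrite px.
move=> x h nh sh; have [nh' sz] := P _ nh (ltnW sh).
have := node_size nh; rewrite /= => oh; have {}oh : ~~ odd (size h) by rewrite oh.
pose k := (size h)./2; have sk : size h = k.*2 by rewrite /k even_halfK.
have kr : (k < r)%N by move: sh; rewrite /= sk ltn_Sdouble.
have dE : (r.*2.+1 - size ((x, false) :: h) = ((r - k).-1).*2.+2)%N.
  by rewrite /= subSS sk -doubleB -doubleS prednK // subn_gt0.
have [z hz] := node_point xw nh; have [z' hz'] := node_point xw' nh'.
have s2 : sim 2 z z'.
  by apply: (@sim_even_down _ _ _ (r - k).-1); rewrite addn2 -dE; exact: sz.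
congr pair; apply/ffunP => Y; rewrite !ffunE; case: ifP => // YP.
by apply: (entry_sim hz hz' s2); move: YP; rewrite !inE => /andP[].
Qed.

(** The first [r] terms of the [E]-function and the vertex of [D_{2r+1}] carry the same information. *)
Lemma efun_agree_sim r :
  (forall j, (j < r)%N -> efun_of M w xi j = efun_of M w xi' j) <-> sim r.*2.+1 xi xi'.
Proof.
have hc := point_choice_fun; split=> [ff|s j jr].
  have ag : agree_below w c c' r.*2.
    by apply/(efun_agree w r (hc xi) (hc xi')) => j jr; rewrite -!efun_ofE // ff.
  by apply: (sim_of_agree ag (h := [::])); rewrite ?addn0.
rewrite !efun_ofE //; have := agree_of_sim s.
by move/(efun_agree w r (hc xi) (hc xi')); apply.
Qed.

End PointTrees.

(** * Convergence in the spectrum and the correspondence *)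

Lemma cvg_lin (K : numFieldType) (T : Type) (F : set_system T) (FF : Filter F)
    (k : K) (f g : T -> K) (a b : K) :
  f @ F --> a -> g @ F --> b -> k * f t + g t @[t --> F] --> k * a + b.
Proof. by move=> fa gb; apply: cvgD => //; apply: cvgMr. Qed.

Lemma cvg_mul (K : numFieldType) (T : Type) (F : set_system T) (FF : Filter F)
    (f g : T -> K) (a b : K) :
  f @ F --> a -> g @ F --> b -> f t * g t @[t --> F] --> a * b.
Proof. exact: cvgM. Qed.

Section Spectrum.
Context {R : realType} {G : bipGraph} (M : graphSystem R G) (w : bV1 G).
Implicit Types (xi eta zeta : Omega M).
Local Notation B := (B0 M).

Lemma eval_continuous (b : gsO M) : continuous (fun xi : Omega M => val xi b).
Proof.
move=> xi; apply: (@continuous_comp (Omega M) {ptws gsO M -> cplx R} (cplx R) val (proj b)).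
  exact: initial_continuous.
exact: proj_continuous.
Qed.

(** The evaluation at a projection is continuous with values [0] and [1]. *)
Lemma Aset_clopen n (v : vertex (canon G n)) : clopen (Aset M n v).
Proof.
have cl (z : cplx R) : closed [set z].
  exact: (accessible_closed_set1 (hausdorff_accessible (@norm_hausdorff _ (cplx R)))).
split; last first.
  by apply: (@closed_comp _ _ (fun xi : Omega M => val xi (imv M v))) (cl 1) => xi _; exact: eval_continuous.
have -> : Aset M n v = (fun xi : Omega M => val xi (imv M v)) @^-1` (~` [set 0]).
  apply/seteqP; split=> xi; rewrite /Aset /= => h.
    by rewrite h; apply/eqP; exact: oner_neq0.
  by case: (ev01 xi v).
apply: open_comp => [xi _|]; first exact: eval_continuous.
by rewrite openC.
Qed.

(** Over a vertex of [E^{0,1}] only the odd levels are occupied. *)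
Lemma sim_cofinal n : exists r, forall xi eta, Omega_at M (inr w) xi ->
  Omega_at M (inr w) eta -> sim r.*2.+1 xi eta -> sim n xi eta.
Proof.
rewrite -(odd_double_half n); case: (odd n); first by exists n./2 => xi eta _ _; rewrite add1n.
exists 0%N => xi eta /Omega_atE h /Omega_atE h' _; rewrite add0n; case: n./2 => [|k].
  by move=> u; split=> hu; [case: (at_next hu h)|case: (at_next hu h')].
by have := @sim_odd _ _ M k 1 w w xi eta h h'; rewrite addn1 doubleS.
Qed.

Lemma sim_val n (u : level G n) xi eta : sim n xi eta ->
  val eta (ev M (inl u : vertex (canon G n))) = val xi (ev M (inl u : vertex (canon G n))).
Proof.
move=> s; have := s u; rewrite /at_level.
case: (ev01 xi (inl u : vertex (canon G n))) (ev01 eta (inl u : vertex (canon G n))) => -> [] -> //.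
  by case=> _ /(_ erefl)/esym/eqP; rewrite oner_eq0.
by case=> /(_ erefl)/esym/eqP; rewrite oner_eq0.
Qed.

Lemma sim_mono r r' xi eta : (r <= r')%N -> sim r'.*2.+1 xi eta -> sim r.*2.+1 xi eta.
Proof.
move=> rr'; rewrite -(subnK rr') doubleD -addnS; exact: sim_even_down.
Qed.

Section Point.
Variable xi : Omega M.
Hypothesis xw : Omega_at M (inr w) xi.

(** The filter of the sets that contain a set represented by a partial [E]-function of [xi]. *)
Definition near_sets : set_system (Omega M) :=
  [set A | exists r, [set eta | Omega_at M (inr w) eta /\ sim r.*2.+1 xi eta] `<=` A].

#[local] Instance near_sets_filter : ProperFilter near_sets.
Proof.
split; first by move=> [r /(_ xi)]; apply; split.
split=> [|A A' [r rA] [r' rA']|A A' AA' [r rA]].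
- by exists 0%N.
- exists (maxn r r') => eta [ew s]; split.
    by apply: rA; split=> //; apply: sim_mono s; exact: leq_maxl.
  by apply: rA'; split=> //; apply: sim_mono s; exact: leq_maxr.
- by exists r => eta /rA /AA'.
Qed.

(** The elements whose evaluations converge, together with those of their adjoints, form a
    closed subalgebra, because characters are contractive; it contains the vertices, whose
    evaluations are eventually constant. *)
Lemma near_eval b : B b -> val eta b @[eta --> near_sets] --> val xi b.
Proof.
pose K : set (gsO M) := [set b | B b /\ val eta b @[eta --> near_sets] --> val xi b].
suff KP : B b -> K b /\ K (star b) by move=> /KP[[]].
have BS := B0_subalg M.
pose S : set (gsO M) := [set b | K b /\ K (star b)].
have Klin (k : cplx R) a c : K a -> K c -> K (k *: a + c).
  move=> [Ba Ka] [Bc Kc]; split; first by have [_ Bl _ _ _] := BS; exact: Bl.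
  have lin eta : val eta (k *: a + c) = k * val eta a + val eta c.
    by have [h _ _ _] := OmegaP eta; exact: h.
  rewrite lin (_ : (fun eta => _) = (fun eta : Omega M => k * val eta a + val eta c)); last first.
    by apply/funext => eta; exact: lin.
  exact: (@cvg_lin (cplx R) _ near_sets _ k _ _ _ _ Ka Kc).
have Kmul a c : K a -> K c -> K (a ** c).
  move=> [Ba Ka] [Bc Kc]; split; first exact: (subalgM BS).
  rewrite (xiM xi Ba Bc) (_ : (fun eta => _) = (fun eta : Omega M => val eta a * val eta c)); last first.
    by apply/funext => eta; exact: xiM.
  exact: (@cvg_mul (cplx R) _ near_sets _ _ _ _ _ Ka Kc).
have Kclosed l : B l -> (forall e : R, 0 < e -> exists2 a, K a & nrm (a - l) <= e) -> K l.
  move=> Bl lim; split=> //; apply/cvgrPdist_le => e e0.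
  have eE : e = (complex.Re e)%:C by rewrite RRe_real // gtr0_real.
  have re0 : 0 < complex.Re e / 3.
    by rewrite divr_gt0 //; move: e0; rewrite eE ltcR.
  have [a [Ba Ka] al] := lim _ re0.
  have e3 : (0 : cplx R) < (complex.Re e / 3)%:C by rewrite ltcR.
  move/cvgrPdist_le : Ka => /(_ _ e3); apply: filterS => eta ea.
  have Bla : B (l - a) by apply: (subalgD BS) => //; exact: (subalgN BS).
  have Bal : B (a - l) by apply: (subalgD BS) => //; exact: (subalgN BS).
  (* Both characters move by at most [nrm (a - l)] when [l] is replaced by [a]. *)
  have -> : val xi l - val eta l = (val xi (l - a) + (val xi a - val eta a)) + val eta (a - l).
    have sub (z : Omega M) c d : B c -> B d -> val z (c - d) = val z c - val z d.
      move=> Bc Bd; rewrite (charD (OmegaP z)) //; last exact: (subalgN BS).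
      by rewrite -scaleN1r (charZ BS (OmegaP z)) // mulN1r.
    by rewrite !sub // !addrA !subrK.
  have -> : e = (complex.Re e / 3)%:C + (complex.Re e / 3)%:C + (complex.Re e / 3)%:C.
    by rewrite {1}eE -!rmorphD; congr (_%:C); field.
  have small (z : Omega M) c : B c -> nrm c <= complex.Re e / 3 -> `|val z c| <= (complex.Re e / 3)%:C :> cplx R.
    move=> Bc ce; have := char_norm BS (OmegaP z) Bc; rewrite nrmE => /le_trans; apply.
    by rewrite lecR.
  rewrite (le_trans (ler_normD _ _)) // lerD //; last exact: small.
  by rewrite (le_trans (ler_normD _ _)) // lerD //; apply: small => //; rewrite nrmB.
apply: (@B0_ind R G M S) => [|n v].
  split=> [|k a c [Ka Ka'] [Kc Kc']|a c [Ka Ka'] [Kc Kc']|a [Ka Ka']|].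
  - have K0 : K 0.
      split; first exact: (subalg0 BS).
      rewrite (char0 BS (OmegaP xi)) (_ : (fun eta => _) = (fun=> 0)); first exact: cvg_cst.
      by apply/funext => eta; exact: (char0 BS (OmegaP eta)).
    by split; rewrite ?star0.
  - by split; [exact: Klin|rewrite starD starZ; exact: Klin].
  - by split; [exact: Kmul|rewrite starM; exact: Kmul].
  - by split; rewrite ?starK.
  - have [_ _ _ _ Bc] := BS; apply/closedP => l lim.
    have Bl : B l.
      by apply: ((closedP B).1 Bc) => e /lim[a [[Ba _] _] al]; exists a.
    split; first by apply: Kclosed => // e /lim[a [Ka _] al]; exists a.
    apply: Kclosed; first exact: (subalg_star BS).
    by move=> e /lim[a [_ Ka] al]; exists (star a) => //; rewrite -starB nrm_star.
suff Kv : K (ev M v) by split; rewrite ?ev_star.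
split; first exact: B0_ev.
have Kat m (u : level G m) : val eta (ev M (inl u : vertex (canon G m))) @[eta --> near_sets]
    --> val xi (ev M (inl u : vertex (canon G m))).
  apply: cvg_near_cst; have [r rP] := sim_cofinal m.
  by exists r => eta [ew s]; apply: sim_val; exact: rP.
by case: v => [u|u]; [exact: Kat|rewrite ev_next; exact: (Kat n.+1)].
Qed.

(** The topology is that of pointwise convergence, and evaluations outside [B0] vanish. *)
Lemma near_sets_cvg : near_sets --> (xi : Omega M).
Proof.
have val_cvg : (val : Omega M -> {ptws gsO M -> cplx R}) @ near_sets --> val xi.
  apply/pointwise_cvgP => b; have [Bb|nB] := pselect (B b); first exact: near_eval.
  rewrite (char_out (OmegaP xi) nB); apply: cvg_near_cst; exists 0%N => eta _.
  exact: (char_out (OmegaP eta) nB).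
move=> U [V /= [[W oW <-] Wxi] VU]; have := val_cvg W.
move=> /(_ (open_nbhs_nbhs (conj oW Wxi))) [r rW].
by exists r => eta /rW /VU.
Qed.

(** All evaluations at [eta] are limits along [near_sets xi] of a constant family. *)
Lemma sim_eq eta : Omega_at M (inr w) eta -> (forall r, sim r.*2.+1 xi eta) -> xi = eta.
Proof.
move=> ew s; apply: Omega_ext => b Bb; apply/eqP; rewrite -subr_eq0 -normr_le0.
have small (e : R) : 0 < e -> complex.Re `|val xi b - val eta b| <= e.
  move=> e0; have e1 : (0 : cplx R) < e%:C by rewrite ltcR.
  move/cvgrPdist_le : (near_eval Bb) => /(_ _ e1)[r rP].
  by have := rP eta (conj ew (s r)); rewrite /= -(ReN (_ - _)) lecR.
rewrite -ReN -[leRHS]/((0 : R)%:C) lecR; apply/ler_addgt0Pr => e e0.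
by rewrite add0r small.
Qed.

Lemma represented_sim r : represented M w (mkseq (efun_of M w xi) r) =
  [set eta | Omega_at M (inr w) eta /\ sim r.*2.+1 xi eta].
Proof.
apply/seteqP; split=> eta; rewrite /represented /= size_mkseq => -[ew h]; split=> //.
  apply/(efun_agree_sim xw ew) => j jr.
  by have := congr1 (fun s => nth [fmap]%fmap s j) h; rewrite !nth_mkseq.
apply: (@eq_from_nth _ [fmap]%fmap); rewrite ?size_mkseq // => j jr.
by rewrite !nth_mkseq //; apply/esym; apply: (efun_agree_sim xw ew r).2 jr.
Qed.

(** The vertex is the one of [D_{2r+1}] under [xi]. *)
Lemma represented_level r : exists v : level G (2 * r).+1,
  represented M w (mkseq (efun_of M w xi) r) = Aset M (2 * r).+1 (inl v).
Proof.
have [v hv] : exists v : level G (2 * r).+1, at_level v xi.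
  have /Omega_atE := xw; elim: r => [|r IH] h; first by exists w.
  have [v /at_child[v' _ hv']] := IH h.
  by rewrite mulnS; exists v'.
exists v; rewrite represented_sim; apply/seteqP; split=> eta /=.
  by rewrite -mul2n => -[_ s]; apply/(s v).
move=> hv'; have s : sim r.*2.+1 xi eta by rewrite -mul2n; exact: sim_of hv hv'.
split=> //; apply/Omega_atE; have : sim 1 xi eta.
  by apply: (@sim_even_down _ _ _ r); rewrite addn1.
by move=> /(_ w) [+ _]; apply; apply/Omega_atE.
Qed.

End Point.
End Spectrum.

Section Surjectivity.
Context {R : realType} {G : bipGraph} (M : graphSystem R G) (w : bV1 G).

(** The translates of the root of the tree are its nodes, and a node lies in the range of an
    arrow of a colour other than that of its last letter exactly if that arrow was chosen. *)
Lemma choice_realised (c : seq (bE G * bool) -> {set bE G} -> option (bE G)) : choice_fun c ->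
  exists xi : Omega M, Omega_at M (inr w) xi /\
    forall j, efun_of M w xi j = efun_choice w c j.
Proof.
move=> hc; have [pt [p0 pw pt_theta]] := tree_points M w hc.
exists (pt [::]); split=> // j; rewrite efun_ofE //; apply/esym.
have hc' := point_choice_fun (pt [::]).
apply: (efun_agree w j.+1 hc hc').2 => // x h nh _.
congr pair; apply/ffunP => Y; rewrite !ffunE; case: ifP => // YP.
have [YC Yx] : Y \in bC (br x) /\ Y != part x by move: YP; rewrite !inE => /andP[].
have hz := pw _ nh; have [v [vz vx vE]] := point_entry hz.
rewrite (point_choiceE hz vz YC); have [ctot cin] := hc.
have [y cy] := ctot ((x, false) :: h) _ Y YC; have yY := cin _ _ _ cy.
rewrite cy; apply/esym; rewrite -(bC_part YC yY); apply/(Hset_tent y vz).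
have [] // : theta y (pt ((y, true) :: (x, false) :: h)) (pt ((x, false) :: h)).
apply: pt_theta; split=> //; last by right.
by split=> //; exists Y.
Qed.

(** Applied with all indices to an [E]-function, and with [j < r] to a partial one. *)
Lemma efun_realised (f : nat -> @emap G) (J : nat -> Prop) :
  (forall j, J j.+1 -> J j) -> (forall j, J j -> efun_cond f j) ->
  domf (f 0%N) = src_dom w ->
  exists xi : Omega M, Omega_at M (inr w) xi /\ forall j, J j -> efun_of M w xi j = f j.
Proof.
move=> Jdown Jf f0; have [xi [xw xE]] := choice_realised (read_choice_fun f).
exists xi; split=> // j Jj; rewrite xE.
exact: efun_read Jdown Jf f0 j Jj.
Qed.

End Surjectivity.

Theorem theorem8p3 (R : realType) (G : bipGraph) (M : graphSystem R G)
  (hC : forall v : bV0 G, (2 <= #|bC v|)%N)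
  (hr : forall v : bV0 G, exists e : bE G, br e = v)
  (hs : forall u : bV1 G, exists e : bE G, bs e = u)
  (w : bV1 G) :
  [/\ set_bij (Omega_at M (inr w))
        [set f : nat -> @emap G | is_efun f /\ domf (f 0%N) = src_dom w]
        (efun_of M w),
      forall xi : Omega M, Omega_at M (inr w) xi ->
        (forall r : nat, (0 < r)%N ->
           clopen (represented M w (mkseq (efun_of M w xi) r)) /\
           nbhs xi (represented M w (mkseq (efun_of M w xi) r))) /\
        (forall U : set (Omega M), nbhs xi U ->
           exists2 r : nat, (0 < r)%N &
             represented M w (mkseq (efun_of M w xi) r) `<=` U) &
      forall s : seq (@emap G),
        is_partial_efun s -> domf (nth [fmap]%fmap s 0) = src_dom w ->
        clopen (represented M w s) /\
        exists v : level G (2 * size s).+1,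
          represented M w s = Aset M (2 * size s).+1 (inl v)].
Proof.
have clop (xi : Omega M) r : Omega_at M (inr w) xi ->
    clopen (represented M w (mkseq (efun_of M w xi) r)).
  by move=> /(represented_level)/(_ r)[v ->]; exact: Aset_clopen.
split.
- split=> [xi xw|xi eta /set_mem xw /set_mem ew ff|f [fP f0]].
  + have -> : efun_of M w xi = efun_choice w (point_choice xi).
      by apply/funext => j; exact: efun_ofE.
    by split; [exact: efun_choiceP (point_choice_fun xi)|].
  + by apply: (sim_eq xw ew) => r; apply/(efun_agree_sim xw ew) => j _; rewrite ff.
  + have [xi [xw xE]] := @efun_realised R G M w f (fun=> True) (fun _ => id) (fun j _ => fP j) f0.
    by exists xi => //; apply/funext => j; exact: xE.
- move=> xi xw; split=> [r r0|U /(near_sets_cvg xw)[r rU]].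
    split; first exact: clop.
    have [op _] := clop xi r xw; apply: open_nbhs_nbhs; split=> //.
    by rewrite represented_sim //; split.
  exists r.+1 => //; rewrite represented_sim // => eta [ew s]; apply: rU; split=> //.
  exact: sim_mono s.
move=> s [s0 sP] d0; set f := nth [fmap]%fmap s.
have [xi [xw xE]] := @efun_realised R G M w f (fun j => (j < size s)%N) (fun j => @ltnW _ _) sP d0.
have -> : s = mkseq (efun_of M w xi) (size s).
  apply: (@eq_from_nth _ [fmap]%fmap); rewrite ?size_mkseq // => j js.
  by rewrite nth_mkseq // xE.
by split; [exact: clop|rewrite size_mkseq; exact: represented_level].
Qed.
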